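(* Assume that $F$ is $\sigma$-strongly convex, $f$ is $L$-smooth, each $f_{i,j}$ is $(\ell_1,\ell_2)$-smooth, and $W$ is doubly stochastic with the properties listed in the context. With batch size $b=\sqrt n$ (up to rounding) and appropriate choices of the remaining parameters $\eta,\tau,M,K$ of PMGT-KatyushaX, to obtain an $\epsilon$-approximate solution $\bar y^K$, i.e. $\mathbb{E}[F(\bar y^K)]-F(x^* )\le\epsilon$, PMGT-KatyushaX requires (in expectation) at most $$\mathcal O\left(\left(n+\frac{L^{1/2}+(\ell_1\ell_2)^{1/4}}{\sqrt\sigma}\,n^{3/4}\right)\log\frac{F(\bar y^0)-F(x^* )}{\epsilon}\right)$$ stochastic first-order oracle (SFO) calls and $$\tilde{\mathcal O}\left(\frac{\sqrt n+\frac{L^{1/2}+(\ell_1\ell_2)^{1/4}}{\sqrt\sigma}\,n^{1/4}}{\sqrt{1-\lambda_2(W)}}\,\log\frac{F(\bar y^0)-F(x^* )}{\epsilon}\right)$$ rounds of communication.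
   Context: Problem. Let $m,n,d\ge 1$. For $i\in[m]$, $j\in[n]$ let $f_{i,j}:\mathbb{R}^d\to\mathbb{R}$ be differentiable (possibly nonconvex), $f_i=\frac1n\sum_{j=1}^n f_{i,j}$, $f=\frac1m\sum_{i=1}^m f_i$, $F=f+\psi$ with $\psi$ proper convex (possibly non-smooth), $x^*=\arg\min F$. Standing assumptions: $f$ is convex and $L$-smooth ($\|\nabla f(x)-\nabla f(y)\|\le L\|x-y\|$); $f$ is $\sigma_f$-strongly convex and $\psi$ is $\sigma_\psi$-strongly convex with $\sigma_f,\sigma_\psi\ge0$ and $\sigma=\sigma_f+\sigma_\psi>0$; each $f_{i,j}$ is $(\ell_1,\ell_2)$-smooth, i.e. $-\frac{\ell_2}{2}\|x-y\|^2\le f_{i,j}(x)-f_{i,j}(y)-\langle\nabla f_{i,j}(y),x-y\rangle\le\frac{\ell_1}{2}\|x-y\|^2$ for all $x,y$, with $\ell_2\ge\ell_1>0$. Notation. Bold letters denote matrices in $\mathbb{R}^{m\times d}$ whose $i$-th row (subscript $i$) is held by agent $i$; $\bar x=\frac1m\mathbf 1^\top\mathbf x$ (same for other letters). $\Psi(\mathbf x)=\frac1m\sum_i\psi(x_i)$ and $\mathrm{prox}_{m\eta,\Psi}(\mathbf x)=\arg\min_{\mathbf z}\{\Psi(\mathbf z)+\frac{1}{2m\eta}\|\mathbf z-\mathbf x\|^2\}$ (row-wise $\mathrm{prox}_{\eta,\psi}$). Network. $W\in\mathbb{R}^{m\times m}$ is doubly stochastic, with $W_{i,j}\ge0$ for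 neighbouring agents and $W_{i,j}=0$ for agents that are not connected; $W$ is symmetric, $0\preccurlyeq W\preccurlyeq I$, $W\mathbf 1=\mathbf 1$, $\mathrm{null}(I-W)=\mathrm{span}(\mathbf 1)$; $\lambda_2(W)$ is its second largest eigenvalue. $\mathrm{FastMix}(\mathbf x^0,M)$ returns $\mathbf x^M$ where $\mathbf x^{-1}=\mathbf x^0$, $\mathbf x^{k+1}=(1+\eta_w)W\mathbf x^k-\eta_w\mathbf x^{k-1}$, $\eta_w=\frac{1}{1+\sqrt{1-\lambda_2^2(W)}}$; one call costs $M$ rounds of communication. PMGT-KatyushaX. Parameters: $M$, minibatch size $b$, step size $\eta>0$, $\tau\in(0,1]$, number of epochs $K$; $t_0=\lceil n/b\rceil$. Initialize $x_i^0=y_i^0=q_i^0=x^0$, $\hat s_i^0=\nabla f(x^0)$ for all $i$. For $k=0,\dots,K-1$: $\mathbf x^{k+1}=\mathrm{FastMix}(\tau\mathbf q^k+(1-\tau)\mathbf y^k,M)$; $\nu_i^{k+1}=\hat s_i^k+\nabla f_i(x_i^{k+1})-\nabla f_i(x_i^k)$; $\hat{\mathbf s}^{k+1}=\mathrm{FastMix}(\nu^{k+1},M)$; $\mathbf s^{-1}=\mathbf v^{-1}=\mu=\hat{\mathbf s}^{k+1}$, $\mathbf w^0=\mathbf x^{k+1}$; sample $T\sim\mathrm{Geom}(1/t_0)$ ($\Pr[T=t]=(1-p)^tp$, $t\ge0$, $p=1/t_0$); for $t=0,\dots,T$: each agent samples a batch $B_i^t$ of $b$ indices uniformly from $[n]$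 with replacement, $v_i^t=\mu_i+\frac1b\sum_{j\in B_i^t}(\nabla f_{i,j}(w_i^t)-\nabla f_{i,j}(w_i^0))$, $\mathbf s^t=\mathrm{FastMix}(\mathbf s^{t-1}+\mathbf v^t-\mathbf v^{t-1},M)$, $\mathbf w^{t+1}=\mathrm{FastMix}(\mathrm{prox}_{m\eta,\Psi}(\mathbf w^t-\eta\mathbf s^t),M)$; then $\mathbf y^{k+1}=\mathbf w^{T+1}$ and $\mathbf q^{k+1}=\mathrm{FastMix}\left(\frac{\mathbf q^k+\frac\tau2\mathbf y^{k+1}-\frac{1}{2\tau}(\mathbf x^{k+1}-\mathbf y^{k+1})}{1+\frac\tau2},M\right)$. An SFO call is one evaluation of some $\nabla f_{i,j}$ (counted per agent). $\tilde{\mathcal O}$ hides logarithmic factors. *)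

(* Defs.v *)
From HB Require Import structures.
From mathcomp Require Import all_boot all_order all_algebra.
From mathcomp Require Import all_classical all_reals all_analysis.

Set Implicit Arguments.
Unset Strict Implicit.
Unset Printing Implicit Defensive.

Import Order.TTheory GRing.Theory Num.Theory.
Import numFieldNormedType.Exports.

Local Open Scope classical_set_scope.
Local Open Scope ring_scope.

Section Geometry.
Context {R : realType}.

Definition inner {d : nat} (u v : 'rV[R]_d) : R := \sum_(j < d) u 0 j * v 0 j.

(* Euclidean norm on row vectors, Frobenius norm on matrices: the library's
   norm on 'M[R]_(p, d) is the sup norm. *)
Definition enorm {p d : nat} (A : 'M[R]_(p, d)) : R :=
  Num.sqrt (\sum_(i < p) \sum_(j < d) A i j ^+ 2).

Definition grad {d : nat} (g : 'rV[R]_d -> R) (x : 'rV[R]_d) : 'rV[R]_d :=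
  \row_(j < d) 'D_(delta_mx 0 j) g x.

(* Convexity is the case s = 0. *)
Definition strongly_convex {d : nat} (s : R) (g : 'rV[R]_d -> \bar R) : Prop :=
  forall (x y : 'rV[R]_d) (t : R), 0 <= t <= 1 ->
    (g (t *: x + (1 - t) *: y)%R <=
     t%:E * g x + (1 - t)%:E * g y
       - (s / 2 * (t * (1 - t)) * enorm (x - y) ^+ 2)%R%:E)%E.

Definition proper_function {d : nat} (g : 'rV[R]_d -> \bar R) : Prop :=
  (forall x, g x != -oo%E) /\ (exists x, g x != +oo%E).

Definition lsmooth {d : nat} (L : R) (g : 'rV[R]_d -> R) : Prop :=
  forall x y : 'rV[R]_d, enorm (grad g x - grad g y) <= L * enorm (x - y).

Definition l12smooth {d : nat} (l1 l2 : R) (g : 'rV[R]_d -> R) : Prop :=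
  forall x y : 'rV[R]_d,
    - (l2 / 2) * enorm (x - y) ^+ 2 <= g x - g y - inner (grad g y) (x - y)
      <= l1 / 2 * enorm (x - y) ^+ 2.

Definition is_argmin {A : Type} (g : A -> \bar R) (z : A) : Prop :=
  forall z', (g z <= g z')%E.

Definition prox_obj {p d : nat} (eta : R) (g : 'M[R]_(p, d) -> \bar R)
    (x z : 'M[R]_(p, d)) : \bar R :=
  (g z + ((2 * eta)^-1 * enorm (z - x) ^+ 2)%R%:E)%E.

Definition prox {p d : nat} (eta : R) (g : 'M[R]_(p, d) -> \bar R)
    (x : 'M[R]_(p, d)) : 'M[R]_(p, d) :=
  xget x [set z | is_argmin (prox_obj eta g x) z].

Definition Psi {m d : nat} (psi : 'rV[R]_d -> \bar R) (x : 'M[R]_(m, d)) :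
    \bar R :=
  ((m%:R^-1)%:E * \sum_(i < m) psi (row i x))%E.

Definition mean {m d : nat} (x : 'M[R]_(m, d)) : 'rV[R]_d :=
  m%:R^-1 *: \sum_(i < m) row i x.

Definition f_local {m n d : nat} (f : 'I_m -> 'I_n -> 'rV[R]_d -> R) (i : 'I_m)
    (x : 'rV[R]_d) : R :=
  n%:R^-1 * \sum_(j < n) f i j x.

Definition f_global {m n d : nat} (f : 'I_m -> 'I_n -> 'rV[R]_d -> R)
    (x : 'rV[R]_d) : R :=
  m%:R^-1 * \sum_(i < m) f_local f i x.

Definition objective {m n d : nat} (f : 'I_m -> 'I_n -> 'rV[R]_d -> R)
    (psi : 'rV[R]_d -> \bar R) (x : 'rV[R]_d) : \bar R :=
  ((f_global f x)%:E + psi x)%E.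

End Geometry.

Section Network.
Context {R : realType}.

Record gossip_matrix {m : nat} (edge : rel 'I_m) (W : 'M[R]_m) : Prop := {
  gossip_ge0 : forall i j, 0 <= W i j;
  gossip_edge : forall i j, i != j -> ~~ edge i j -> W i j = 0;
  gossip_row : forall i, \sum_(j < m) W i j = 1;
  gossip_col : forall j, \sum_(i < m) W i j = 1;
  gossip_sym : W^T = W;
  gossip_psd : forall x : 'rV[R]_m, 0 <= inner (x *m W) x;
  gossip_le1 : forall x : 'rV[R]_m, inner (x *m W) x <= inner x x;
  gossip_null : forall v : 'cV[R]_m,
    (1%:M - W) *m v = 0 <-> exists c : R, v = const_mx c }.

(* Eigenvalues are counted with multiplicity. When m = 1 there is no second
   eigenvalue and the default of `_ gives lam2 = 0. *)
Definition second_largest_eigenvalue {m : nat} (W : 'M[R]_m) (lam2 : R) : Prop :=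
  exists s : seq R,
    [/\ sorted >=%R s, char_poly W = \prod_(a <- s) ('X - a%:P) & lam2 = s`_1].

Definition eta_w (lam2 : R) : R := (1 + Num.sqrt (1 - lam2 ^+ 2))^-1.

(* The iterated pair is (x^k, x^(k-1)). *)
Definition fastmix {m d : nat} (W : 'M[R]_m) (lam2 : R) (M : nat)
    (x : 'M[R]_(m, d)) : 'M[R]_(m, d) :=
  (iter M (fun p => ((1 + eta_w lam2) *: (W *m p.1) - eta_w lam2 *: p.2, p.1))
          (x, x)).1.

End Network.

(* Smallest natural number >= n / b, for b > 0. *)
Definition ceil_div (n b : nat) : nat := (n %/ b + ~~ (b %| n))%N.

Section Algorithm.
Context {R : realType} {m n d : nat}.
Variables (f : 'I_m -> 'I_n -> 'rV[R]_d -> R) (psi : 'rV[R]_d -> \bar R).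
Variables (W : 'M[R]_m) (lam2 : R) (x0 : 'rV[R]_d).
Variables (b : nat) (eta tau : R) (M : nat).

Let mix : 'M[R]_(m, d) -> 'M[R]_(m, d) := fastmix W lam2 M.

(* sfo counts gradient evaluations of one agent (all agents do the same number),
   comm counts communication rounds. *)
Record inner_state := InnerState {
  in_w : 'M[R]_(m, d);   (* w^t *)
  in_s : 'M[R]_(m, d);   (* s^(t-1) *)
  in_v : 'M[R]_(m, d);   (* v^(t-1) *)
  in_sfo : nat;
  in_comm : nat }.

Record outer_state := OuterState {
  out_x : 'M[R]_(m, d);
  out_y : 'M[R]_(m, d);
  out_q : 'M[R]_(m, d);
  out_s : 'M[R]_(m, d);  (* hat s^k *)
  out_sfo : nat;
  out_comm : nat }.

(* batch i l is the l-th index drawn by agent i, so repetitions are allowed. *)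
Definition inner_step (mu w0 : 'M[R]_(m, d)) (batch : 'I_m -> 'I_b -> 'I_n)
    (st : inner_state) : inner_state :=
  let w := in_w st in
  let v := \matrix_(i < m)
    (row i mu + b%:R^-1 *: \sum_(l < b)
       (grad (f i (batch i l)) (row i w) - grad (f i (batch i l)) (row i w0))) in
  let s := mix (in_s st + v - in_v st) in
  InnerState (mix (prox (m%:R * eta) (Psi psi) (w - eta *: s))) s v
    (in_sfo st + 2 * b) (in_comm st + 2 * M).

Fixpoint inner_loop (mu w0 : 'M[R]_(m, d)) (batch : nat -> 'I_m -> 'I_b -> 'I_n)
    (sfo comm t : nat) : inner_state :=
  if t is t'.+1
  then inner_step mu w0 (batch t') (inner_loop mu w0 batch sfo comm t')
  else InnerState w0 mu mu sfo comm.

(* The inner loop runs for t = 0, ..., T, that is T.+1 times. *)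
Definition epoch (T : nat) (batch : nat -> 'I_m -> 'I_b -> 'I_n)
    (st : outer_state) : outer_state :=
  let x := mix (tau *: out_q st + (1 - tau) *: out_y st) in
  let nu := \matrix_(i < m)
    (row i (out_s st) + grad (f_local f i) (row i x)
       - grad (f_local f i) (row i (out_x st))) in
  let s := mix nu in
  let inn := inner_loop s x batch
               (out_sfo st + 2 * n) (out_comm st + 2 * M) T.+1 in
  let y := in_w inn in
  let q := mix ((1 + tau / 2)^-1 *:
             (out_q st + (tau / 2) *: y - (2 * tau)^-1 *: (x - y))) in
  OuterState x y q s (in_sfo inn) (in_comm inn + M).

Definition initial_state : outer_state :=
  let x := \matrix_(i < m) x0 in
  OuterState x x x (\matrix_(i < m) grad (f_global f) x0) n 0.

Fixpoint pmgt_katyushaX (T : nat -> nat)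
    (batch : nat -> nat -> 'I_m -> 'I_b -> 'I_n) (K : nat) : outer_state :=
  if K is k.+1
  then epoch (T k) (batch k) (pmgt_katyushaX T batch k)
  else initial_state.

End Algorithm.

Section Sampling.
Context {R : realType} {dO : measure_display} {Omega : measurableType dO}.
Variable P : probability Omega R.

Definition independent_systems (I : eqType) (G : I -> set (set Omega)) : Prop :=
  forall (s : seq I) (A : I -> set Omega),
    uniq s -> (forall i, i \in s -> G i (A i)) ->
    P (\bigcap_(i in [set` s]) A i) = (\prod_(i <- s) P (A i))%E.

Definition events {A : Type} (X : Omega -> A) : set (set Omega) :=
  [set X @^-1` U | U in setT].

(* An index is an epoch k (for the variable T k), or an epoch k, an inner
   iteration t, an agent i and a slot l in its batch. *)
Definition sample_events {m n b : nat} (T : nat -> Omega -> nat)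
    (B : nat -> nat -> 'I_m -> 'I_b -> Omega -> 'I_n)
    (idx : nat + nat * nat * 'I_m * 'I_b) : set (set Omega) :=
  match idx with
  | inl k => events (T k)
  | inr (k, t, i, l) => events (B k t i l)
  end.

Record sampling {m n b : nat} (T : nat -> Omega -> nat)
    (B : nat -> nat -> 'I_m -> 'I_b -> Omega -> 'I_n) : Prop := {
  sampling_measurable : forall idx A, sample_events T B idx A -> measurable A;
  sampling_geom : forall k t,
    let p : R := (ceil_div n b)%:R^-1 in
    P (T k @^-1` [set t]) = ((1 - p) ^+ t * p)%:E;
  sampling_unif : forall k t i l j,
    P (B k t i l @^-1` [set j]) = (n%:R^-1)%:E;
  sampling_indep : independent_systems (sample_events T B) }.

End Sampling.

(* The quantity whose powers are hidden by soft-O: logarithms of the problem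
   parameters, not of the accuracy. *)
Definition log_factor {R : realType} (m n : nat) (L l1 l2 sigma : R) : R :=
  1 + ln m%:R + ln n%:R + ln (1 + L / sigma) + ln (1 + l1 / sigma)
    + ln (1 + l2 / sigma).

(* Main.v *)
Require Import Defs.
From mathcomp Require Import all_boot all_order all_algebra.
From mathcomp Require Import all_classical all_reals all_analysis.
From mathcomp Require Import ring lra complex measurable_realfun.

Set Implicit Arguments.
Unset Strict Implicit.
Unset Printing Implicit Defensive.

Import Order.TTheory GRing.Theory Num.Theory.
Import numFieldNormedType.Exports.

Local Open Scope classical_set_scope.
Local Open Scope ring_scope.

(** FastMix preserves the average of the rows, and its two-term recurrence acts on an
    eigenvector of [W] for an eigenvalue [lam <= lam2] as a Chebyshev-like polynomial
    bounded by [2 eta_w^(M/2)]; the consensus error is therefore multiplied by at most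
    [4 eta_w^M].  A number of rounds [M] logarithmic in the condition numbers makes this
    factor so small that consensus errors are absorbed by the progress of the averaged
    iterates.

    The averaged iterates perform an inexact proximal variance-reduced gradient step.
    Averaged over all components, [(l1, l2)]-smoothness together with convexity of the
    sum bounds the variance by [l1 l2 |x - y|^2 / b], and each step obeys a three-point
    inequality.  Weighted with the geometric law of the epoch length, these inequalities
    telescope.  With [tau^2 = eta sigma t0 / 4], where [t0] is the mean epoch length, the
    momentum step makes the potential
      [F y - F x* + sigma / 4 (1 + tau / 2) |q - x*|^2 + weight * consensus error]
    contract in expectation by [1 - tau / 4] per epoch.  Taking [eta] of order
    [1 / (L + sqrt (l1 l2) + sigma t0)] gives the number of epochs. *)

(** A single component is nonconvex and its gradient is only known to be [l2]-Lipschitz. Two facts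
    keep [l2] alone out of the polynomial part of the rates. In the cocoercivity inequality of a
    component the inner product carries the factor [l1 - l2 <= 0], so it drops out after averaging
    at a common pair of points, where convexity of the sum gives it a sign. Where the agents' points
    differ, [l2] multiplies a consensus error, and condition numbers there enter [M] only under a
    logarithm. The momentum argument alone contracts by [1 - tau / 3]; the room up to [1 - tau / 4]
    pays for consensus.

    The epoch length is unbounded, so epoch expectations are not known to be finite beforehand: each
    epoch inequality is proved for sums truncated at [N], with a remainder of order [(1 - p)^N] that
    a monotone limit removes. The iterates carry no sigma-algebra; they are discrete functions of
    the samples, and independence from the samples not yet drawn turns integrals into iterated
    finite averages. *)

Section Dot.
Context {R : realType}.

Definition dot {p d : nat} (A B : 'M[R]_(p, d)) : R :=
  \sum_(i < p) \sum_(j < d) A i j * B i j.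

Definition nsq {p d : nat} (A : 'M[R]_(p, d)) : R := dot A A.

(** * Inner product and squared Frobenius norm *)

Section DotTheory.
Context {p d : nat}.
Implicit Types A B C : 'M[R]_(p, d).

Lemma dotC A B : dot A B = dot B A.
Proof. by apply: eq_bigr => i _; apply: eq_bigr => j _; rewrite mulrC. Qed.

Lemma dotDl A B C : dot (A + B) C = dot A C + dot B C.
Proof.
rewrite -big_split; apply: eq_bigr => i _ /=; rewrite -big_split.
by apply: eq_bigr => j _ /=; rewrite !mxE mulrDl.
Qed.

Lemma dotZl a A B : dot (a *: A) B = a * dot A B.
Proof.
rewrite mulr_sumr; apply: eq_bigr => i _ /=; rewrite mulr_sumr.
by apply: eq_bigr => j _ /=; rewrite !mxE mulrA.
Qed.

Lemma dotDr A B C : dot C (A + B) = dot C A + dot C B.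
Proof. by rewrite dotC dotDl !(dotC C). Qed.

Lemma dotZr a A B : dot A (a *: B) = a * dot A B.
Proof. by rewrite dotC dotZl dotC. Qed.

Lemma dotNl A B : dot (- A) B = - dot A B.
Proof. by rewrite -scaleN1r dotZl mulN1r. Qed.

Lemma dotNr A B : dot A (- B) = - dot A B.
Proof. by rewrite dotC dotNl dotC. Qed.

Definition dotE := (dotDl, dotDr, dotNl, dotNr, dotZl, dotZr).

Lemma dot0l A : dot 0 A = 0.
Proof. by rewrite -(scale0r 0) dotZl mul0r. Qed.

Lemma dot_suml (I : Type) (r : seq I) (P : pred I) (F : I -> 'M[R]_(p, d)) B :
  dot (\sum_(i <- r | P i) F i) B = \sum_(i <- r | P i) dot (F i) B.
Proof. by elim/big_rec2: _ => [|i y1 y2 _ <-]; rewrite ?dot0l ?dotDl. Qed.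

Lemma dot_sumr (I : Type) (r : seq I) (P : pred I) (F : I -> 'M[R]_(p, d)) B :
  dot B (\sum_(i <- r | P i) F i) = \sum_(i <- r | P i) dot B (F i).
Proof. by rewrite dotC dot_suml; under eq_bigr do rewrite dotC. Qed.

Lemma nsq_ge0 A : 0 <= nsq A.
Proof.
by apply: sumr_ge0 => i _; apply: sumr_ge0 => j _; rewrite -expr2 sqr_ge0.
Qed.

Lemma nsq0 : nsq (0 : 'M[R]_(p, d)) = 0.
Proof. exact: dot0l. Qed.

Lemma enorm_sqr A : enorm A ^+ 2 = nsq A.
Proof.
rewrite /enorm sqr_sqrtr; last first.
  by apply: sumr_ge0 => i _; apply: sumr_ge0 => j _; rewrite sqr_ge0.
by apply: eq_bigr => i _; apply: eq_bigr => j _; rewrite expr2.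
Qed.

Lemma enorm_ge0 A : 0 <= enorm A.
Proof. exact: sqrtr_ge0. Qed.

Lemma nsqB A B : nsq (A - B) = nsq (B - A).
Proof. by rewrite -(opprB B A) /nsq dotNl dotNr opprK. Qed.

Lemma nsqZ a A : nsq (a *: A) = a ^+ 2 * nsq A.
Proof. by rewrite /nsq dotZl dotZr mulrA expr2. Qed.

Lemma nsqN A : nsq (- A) = nsq A.
Proof. by rewrite /nsq dotNl dotNr opprK. Qed.

Lemma nsqD_le A B : nsq (A + B) <= 2 * nsq A + 2 * nsq B.
Proof.
have := nsq_ge0 (A - B); rewrite /nsq !dotE (dotC B A); lra.
Qed.

Lemma nsqD3_le A B C : nsq (A + B + C) <= 3 * (nsq A + nsq B + nsq C).
Proof.
have := (nsq_ge0 (A - B), nsq_ge0 (A - C), nsq_ge0 (B - C)).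
rewrite /nsq !dotE (dotC B A) (dotC C A) (dotC C B) => -[[]]; lra.
Qed.

Lemma nsqB_le A B : nsq (A - B) <= 2 * nsq A + 2 * nsq B.
Proof. by rewrite -(nsqN B) nsqD_le. Qed.

Lemma dot_young (c : R) A B : 0 < c ->
  dot A B <= c / 2 * nsq A + (2 * c)^-1 * nsq B.
Proof.
move=> c0; have := nsq_ge0 (c *: A - B); rewrite /nsq !dotE (dotC B A) => h.
rewrite -(ler_pM2l (x := 2 * c)) ?mulr_gt0//.
rewrite [leRHS](_ : _ = c * (c * dot A A) + dot B B); last first.
  field; lra.
lra.
Qed.

Lemma cauchy_schwarz A B : dot A B ^+ 2 <= nsq A * nsq B.
Proof.
have [A0|A0] := eqVneq (nsq A) 0.
  have h := nsq_ge0 B.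
  (* Degenerate case: Young's inequality with weight [1 / (2 c)] loses its first term, and [c] is
     arbitrary. *)
  have key c : 0 < c -> `|dot A B| <= c * nsq B.
    move=> c0; have k0 : 0 < (2 * c)^-1 by rewrite invr_gt0 mulr_gt0.
    have := dot_young A B k0; have := dot_young (- A) B k0.
    rewrite dotNl nsqN A0 !mulr0 !add0r.
    have -> : (2 * (2 * c)^-1)^-1 = c by field; lra.
    by move=> h1 h2; rewrite ler_norml; lra.
  have : `|dot A B| <= 0.
    rewrite leNgt; apply/negP => h0.
    have := key (`|dot A B| / (2 * (nsq B + 1))).
    rewrite divr_gt0// ?mulr_gt0// ?ltr_wpDl// => /(_ isT).
    rewrite mulrAC ler_pdivlMr ?mulr_gt0 ?ltr_wpDl//.
    by nra.
  by rewrite normr_le0 => /eqP ->; rewrite A0 expr0n mul0r.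
have Ap : 0 < nsq A by rewrite lt_neqAle eq_sym A0 nsq_ge0.
have := nsq_ge0 (dot A B *: A - nsq A *: B).
rewrite {1}/nsq !dotE (dotC B A) -/(nsq A) -/(nsq B) => h.
rewrite -(ler_pM2l Ap); nra.
Qed.

End DotTheory.

Lemma innerE {d : nat} (u v : 'rV[R]_d) : inner u v = dot u v.
Proof. by rewrite /dot big_ord1. Qed.

Lemma dot_row {p d : nat} (A B : 'M[R]_(p, d)) :
  dot A B = \sum_(i < p) dot (row i A) (row i B).
Proof.
apply: eq_bigr => i _; rewrite /dot big_ord1.
by apply: eq_bigr => j _; rewrite !mxE.
Qed.

Lemma nsq_row {p d : nat} (A : 'M[R]_(p, d)) :
  nsq A = \sum_(i < p) nsq (row i A).
Proof. exact: dot_row. Qed.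

Lemma nsq_sum_le {d : nat} (I : finType) (F : I -> 'rV[R]_d) :
  nsq (\sum_i F i) <= #|I|%:R * \sum_i nsq (F i).
Proof.
rewrite /nsq dot_suml; under eq_bigr do rewrite dot_sumr.
have : \sum_i \sum_j dot (F i) (F j) <=
       \sum_i \sum_j (nsq (F i) / 2 + nsq (F j) / 2).
  apply: ler_sum => i _; apply: ler_sum => j _.
  by have := dot_young (F i) (F j) (ltr01 : 0 < 1 :> R); rewrite !mulr1 !mul1r; lra.
move=> /le_trans; apply.
rewrite (eq_bigr (fun i => #|I|%:R / 2 * nsq (F i) + 2^-1 * \sum_j nsq (F j))).
  rewrite big_split /= -mulr_sumr sumr_const -mulr_natl /nsq; lra.
by move=> i _; rewrite big_split /= sumr_const -mulr_suml -mulr_natl; ring.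
Qed.

End Dot.

(** * Row averages and consensus errors *)

Section Consensus.
Context {R : realType} {m d : nat}.
Implicit Types (A B C : 'M[R]_(m, d)) (u v : 'rV[R]_d).

Definition bcast u : 'M[R]_(m, d) := \matrix_(i < m) u.

(** For [m > 0] the factor [1 / m] makes [msq (bcast u)] equal to [nsq u], so errors of the rows and
    of their average are on the same scale. *)
Definition msq A : R := m%:R^-1 * nsq A.

(** Consensus error: the variance of the rows around their average. *)
Definition nvar A : R := msq (A - bcast (mean A)).

Lemma row_bcast u i : row i (bcast u) = u.
Proof. exact: rowK. Qed.

Lemma meanD A B : mean (A + B) = mean A + mean B.
Proof.
rewrite /mean -scalerDr -big_split /=; congr (_ *: _).
by apply: eq_bigr => i _; rewrite linearD.
Qed.

Lemma meanZ a A : mean (a *: A) = a *: mean A.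
Proof.
rewrite /mean scalerA mulrC -scalerA; congr (_ *: _).
by rewrite scaler_sumr; apply: eq_bigr => i _; rewrite linearZ.
Qed.

Lemma meanN A : mean (- A) = - mean A.
Proof. by rewrite -scaleN1r meanZ scaleN1r. Qed.

Lemma meanB A B : mean (A - B) = mean A - mean B.
Proof. by rewrite meanD meanN. Qed.

Lemma bcastD u v : bcast (u + v) = bcast u + bcast v.
Proof. by apply/row_matrixP => i; rewrite linearD /= !row_bcast. Qed.

Lemma bcastZ a u : bcast (a *: u) = a *: bcast u.
Proof. by apply/row_matrixP => i; rewrite linearZ /= !row_bcast. Qed.

Lemma bcastN u : bcast (- u) = - bcast u.
Proof. by rewrite -scaleN1r bcastZ scaleN1r. Qed.

Lemma msq_row A : msq A = m%:R^-1 * \sum_(i < m) nsq (row i A).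
Proof. by rewrite /msq nsq_row. Qed.

Lemma minv_ge0 : 0 <= m%:R^-1 :> R.
Proof. by rewrite invr_ge0 ler0n. Qed.
Local Hint Resolve minv_ge0 : core.

Lemma msq_ge0 A : 0 <= msq A.
Proof. by rewrite mulr_ge0 ?nsq_ge0. Qed.

Lemma msqZ a A : msq (a *: A) = a ^+ 2 * msq A.
Proof. by rewrite /msq nsqZ mulrCA. Qed.

Lemma msqD_le A B : msq (A + B) <= 2 * msq A + 2 * msq B.
Proof.
rewrite /msq !(mulrCA 2) -mulrDr ler_wpM2l//; exact: nsqD_le.
Qed.

Lemma msqD3_le A B C : msq (A + B + C) <= 3 * (msq A + msq B + msq C).
Proof.
rewrite /msq -!mulrDr mulrCA ler_wpM2l//; exact: nsqD3_le.
Qed.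

Lemma nvar_ge0 A : 0 <= nvar A.
Proof. exact: msq_ge0. Qed.

Lemma nvarZ a A : nvar (a *: A) = a ^+ 2 * nvar A.
Proof. by rewrite /nvar meanZ bcastZ -scalerBr msqZ. Qed.

Lemma nvarN A : nvar (- A) = nvar A.
Proof. by rewrite -scaleN1r nvarZ expr2 mulrNN !mul1r. Qed.

Lemma nvarD_le A B : nvar (A + B) <= 2 * nvar A + 2 * nvar B.
Proof.
rewrite /nvar meanD bcastD opprD addrACA; exact: msqD_le.
Qed.

Lemma nvarB_le A B : nvar (A - B) <= 2 * nvar A + 2 * nvar B.
Proof. by rewrite -(nvarN B) nvarD_le. Qed.

Lemma nvarD3_le A B C : nvar (A + B + C) <= 3 * (nvar A + nvar B + nvar C).
Proof.
rewrite /nvar !meanD !bcastD opprD (opprD (bcast (mean A))) addrACA.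
rewrite [A + B + _]addrACA; exact: msqD3_le.
Qed.

Hypothesis m_gt0 : (0 < m)%N.

Lemma mR_neq0 : m%:R != 0 :> R.
Proof. by rewrite pnatr_eq0 -lt0n. Qed.

Lemma mean_bcast u : mean (bcast u) = u.
Proof.
rewrite /mean; under eq_bigr do rewrite row_bcast.
by rewrite sumr_const card_ord -[u *+ m]scaler_nat scalerA mulVf ?mR_neq0// scale1r.
Qed.

Lemma mean_dev A : mean (A - bcast (mean A)) = 0.
Proof. by rewrite meanB mean_bcast subrr. Qed.

Lemma nsq_bcast u : msq (bcast u) = nsq u.
Proof.
rewrite msq_row; under eq_bigr do rewrite row_bcast.
by rewrite sumr_const card_ord -[nsq u *+ m]mulr_natl mulrA mulVf ?mR_neq0// mul1r.
Qed.

(** Bias-variance decomposition: the deviations sum to zero, hence are orthogonal to every broadcast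
    row. *)
Lemma msq_mean A : msq A = nsq (mean A) + nvar A.
Proof.
rewrite -{1}(subrK (bcast (mean A)) A) -[nsq (mean A)]nsq_bcast /nvar.
have := mean_dev A; move: (A - bcast (mean A)) => B; move: (mean A) => u mB.
rewrite /msq /nsq !dotDl !dotDr (dotC _ B).
suff -> : dot B (bcast u) = 0 by ring.
rewrite dot_row; under eq_bigr do rewrite row_bcast.
rewrite -dot_suml (_ : \sum_(i < m) _ = m%:R *: mean B).
  by rewrite mB scaler0 dot0l.
by rewrite /mean scalerA mulfV ?mR_neq0// scale1r.
Qed.

Lemma nsq_mean_le A : nsq (mean A) <= msq A.
Proof. by rewrite msq_mean lerDl nvar_ge0. Qed.

Lemma nvar_le_msq A : nvar A <= msq A.
Proof. by rewrite msq_mean lerDr nsq_ge0. Qed.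

Lemma nvar_bcast u : nvar (bcast u) = 0.
Proof. by rewrite /nvar mean_bcast subrr /msq nsq0 mulr0. Qed.

Lemma nvarDbcast A u : nvar (A + bcast u) = nvar A.
Proof. by rewrite /nvar meanD mean_bcast bcastD opprD addrACA subrr addr0. Qed.

Lemma msq_split A u : msq (A - bcast u) = nsq (mean A - u) + nvar A.
Proof. by rewrite msq_mean meanB mean_bcast -bcastN nvarDbcast. Qed.

Lemma nvar_le_msqB A u : nvar A <= msq (A - bcast u).
Proof. by rewrite msq_split lerDr nsq_ge0. Qed.

End Consensus.

(** * Accelerated gossip *)

Section FastMixScalar.
Context {R : realType}.

(** Scalar form of the [fastmix] recurrence on an eigenvector for [lam]; the start [(1, 1)] mirrors
    the convention that both initial iterates coincide. *)
Definition cheb (h lam : R) (M : nat) : R * R :=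
  iter M (fun p => ((1 + h) * lam * p.1 - h * p.2, p.1)) (1, 1).

Lemma eta_w_gt0 (l : R) : 0 < eta_w l.
Proof. by rewrite invr_gt0 ltr_wpDr ?sqrtr_ge0. Qed.

(* [u^2 - a u v + h v^2] is multiplied by [h] along the recurrence. *)
Lemma cheb_bound (l lam : R) (M : nat) : 0 <= lam -> lam <= l -> l < 1 ->
  (cheb (eta_w l) lam M).1 ^+ 2 <= 4 * eta_w l ^+ M.
Proof.
move=> lam0 laml l1; set h := eta_w l.
have h0 : 0 < h := eta_w_gt0 l.
set a := (1 + h) * lam.
pose Q (p : R * R) := p.1 ^+ 2 - a * p.1 * p.2 + h * p.2 ^+ 2.
(* At the start [u = v = 1], so [Q = 1 - a + h = (1 + h) * (1 - lam)]. *)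
have QE : Q (cheb h lam M) = h ^+ M * ((1 + h) * (1 - lam)).
  elim: M => [|M IH]; first by rewrite /Q /cheb /= /a expr0; ring.
  rewrite exprS -mulrA -IH /cheb iterS -/(cheb h lam M).
  by case: (cheb h lam M) => u v; rewrite /Q /= /a; ring.
set s := Num.sqrt (1 - l ^+ 2).
have s2 : s ^+ 2 = 1 - l ^+ 2 by rewrite sqr_sqrtr// subr_ge0; nra.
have s0 : 0 <= s by exact: sqrtr_ge0.
have hs : h * (1 + s) = 1 by rewrite /h /eta_w -/s mulVf// gt_eqF// ltr_wpDr.
have s1 : s <= 1 by nra.
(* The lower bound on [4 h - a^2] keeps the initial value of [Q] as a factor. It cancels at the end,
   which makes the final estimate uniform in [lam]. *)
have gap : h * ((1 + h) * (1 - lam)) <= 4 * h - a ^+ 2.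
  rewrite -(ler_pM2l (x := (1 + s) ^+ 2)) ?exprn_gt0 ?ltr_wpDr//.
  have -> : (1 + s) ^+ 2 * (h * ((1 + h) * (1 - lam))) =
    (h * (1 + s)) * ((1 + s) + h * (1 + s)) * (1 - lam) by ring.
  have -> : (1 + s) ^+ 2 * (4 * h - a ^+ 2) =
    4 * (1 + s) * (h * (1 + s)) - ((1 + s) + h * (1 + s)) ^+ 2 * lam ^+ 2.
    by rewrite /a; ring.
  rewrite hs.
  have : s ^+ 2 <= 1 - lam ^+ 2 by rewrite s2; nra.
  by nra.
have [lamE|lamN] := eqVneq lam 1; first by move: laml l1; lra.
have lam1 : lam < 1 by lra.
(* Completing the square: [4 h Q = (4 h - a^2) u^2 + (2 h v - a u)^2]. *)
have low : (4 * h - a ^+ 2) * (cheb h lam M).1 ^+ 2 <= 4 * h * Q (cheb h lam M).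
  case: (cheb h lam M) => u v; rewrite /Q /=.
  by have := sqr_ge0 (2 * h * v - a * u); nra.
rewrite QE in low.
have k0 : 0 < h * ((1 + h) * (1 - lam)) by rewrite !mulr_gt0 ?subr_gt0 ?addr_gt0.
rewrite -(ler_pM2l k0).
apply: le_trans (_ : _ <= (4 * h - a ^+ 2) * (cheb h lam M).1 ^+ 2) _.
  by rewrite ler_wpM2r ?sqr_ge0.
by apply: le_trans low _; rewrite le_eqVlt; apply/orP; left; apply/eqP; ring.
Qed.

End FastMixScalar.

Section FastMixMean.
Context {R : realType} {m d : nat} (edge : rel 'I_m) (W : 'M[R]_m) (lam2 : R).
Hypothesis gW : gossip_matrix edge W.
Implicit Types (A B : 'M[R]_(m, d)).

Let h := eta_w lam2.
Let step (p : 'M[R]_(m, d) * 'M[R]_(m, d)) :=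
  ((1 + h) *: (W *m p.1) - h *: p.2, p.1).

Lemma mean_mulmx A : mean (W *m A) = mean A.
Proof.
rewrite /mean; congr (_ *: _); apply/rowP => j; rewrite !summxE.
under eq_bigr do rewrite !mxE.
rewrite exchange_big /=; apply: eq_bigr => i _.
by rewrite -mulr_suml (gossip_col gW) mul1r mxE.
Qed.

Lemma mulmx_bcast u : W *m bcast u = bcast u :> 'M[R]_(m, d).
Proof.
apply/matrixP => i j; rewrite !mxE.
under eq_bigr do rewrite !mxE.
by rewrite -mulr_suml (gossip_row gW) mul1r.
Qed.

Lemma mean_fastmix M A : mean (fastmix W lam2 M A) = mean A.
Proof.
rewrite /fastmix.
suff: let p := iter M step (A, A) in mean p.1 = mean A /\ mean p.2 = mean A.
  by case.
elim: M => [|M [/= IH1 IH2]] //=; split=> //.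
by rewrite meanB !meanZ mean_mulmx IH1 IH2 -scalerBl addrK scale1r.
Qed.

(** Lets the average be subtracted before mixing, so that contraction has to be shown only for
    matrices of zero average. *)
Lemma fastmixB M A u :
  fastmix W lam2 M (A - bcast u) = fastmix W lam2 M A - bcast u.
Proof.
rewrite /fastmix.
suff: let p := iter M step (A, A) in
  iter M step (A - bcast u, A - bcast u) = (p.1 - bcast u, p.2 - bcast u).
  by move=> /= ->.
elim: M => [|M /= ->] //; rewrite {1}/step /=; congr pair.
rewrite mulmxBr mulmx_bcast; move: (W *m _) (bcast u) => X V.
by apply/matrixP => i j; rewrite !mxE; ring.
Qed.

End FastMixMean.

Lemma char_poly_similar {F : fieldType} {n : nat} (P A B : 'M[F]_n) :
  P \in unitmx -> P *m A = B *m P -> char_poly A = char_poly B.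
Proof.
move=> Pu PA; pose Pc := map_mx polyC P.
have detP : \det Pc != 0 by rewrite det_map_mx polyC_eq0 -unitfE -unitmxE.
apply: (mulfI detP); rewrite /char_poly -det_mulmx mulrC -det_mulmx.
congr (\det _); rewrite /char_poly_mx mulmxBr mulmxBl -!map_mxM PA.
by rewrite scalar_mxC.
Qed.

(** * Spectrum of the gossip matrix *)

Section Spectral.
Local Open Scope sesquilinear_scope.
Context {R : realType} {m : nat} (edge : rel 'I_m) (W : 'M[R]_m).
Hypothesis gW : gossip_matrix edge W.
Local Notation C := R[i].
Local Notation toC := (real_complex R).
Local Notation WC := (map_mx toC W).

Lemma gossip_normal : WC \is normalmx.
Proof.
apply: hermitian_normalmx; apply: realsym_hermsym.
  by rewrite qualifE /= expr0 scale1r map_mx_id// map_trmx (gossip_sym gW).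
by apply/mxOverP => i j; rewrite mxE; apply/complex_realP; exists (W i j).
Qed.

(** The Rayleigh quotient of an eigenvector lies between the bounds [gossip_psd] and
    [gossip_le1]. *)
Lemma gossip_eigenvalue (r : R) : eigenvalue W r -> 0 <= r <= 1.
Proof.
case/eigenvalueP => v vW v0.
have vv : 0 < inner v v.
  rewrite innerE -/(nsq v) lt_neqAle nsq_ge0 andbT eq_sym.
  apply: contra v0 => /eqP h; apply/eqP/rowP => j; rewrite mxE.
  move: h; rewrite /nsq /dot big_ord1 => /eqP.
  rewrite psumr_eq0 => [|k _]; last by rewrite -expr2 sqr_ge0.
  by move/allP/(_ j (mem_index_enum _)); rewrite mulf_eq0 orbb => /eqP.
have := gossip_psd gW v; have := gossip_le1 gW v.
rewrite vW !innerE dotZl -!innerE -[X in _ <= X -> _]mul1r.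
by rewrite ler_pM2r// pmulr_lge0// => -> ->.
Qed.

(** [gossip_null] speaks of real columns: symmetry turns the row into a column, and as [W] is real,
    the real and imaginary parts of [v] are fixed separately. *)
Lemma gossip_eigen1 (v : 'rV[C]_m) : v *m WC = v -> exists c, v = const_mx c.
Proof.
move=> vW.
have part (g : {additive C -> R}) : (forall x (y : R), g (x * y%:C%C) = g x * y) ->
    exists c, forall j, g (v 0 j) = c.
  move=> gM; pose u : 'cV[R]_m := \col_j g (v 0 j).
  have : (1%:M - W) *m u = 0.
    rewrite mulmxBl mul1mx; apply/eqP; rewrite subr_eq0; apply/eqP/colP => j.
    rewrite !mxE -{1}vW !mxE raddf_sum /=; apply: eq_bigr => k _.
    by rewrite !mxE gM mulrC -{1}(gossip_sym gW) mxE.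
  move/(gossip_null gW) => [c uc]; exists c => j.
  by have /colP/(_ j) := uc; rewrite !mxE.
have [a Ha] := part (@complex.Re R : {additive Rcomplex R -> R})
  ltac:(case=> x y z /=; rewrite mulr0 subr0 //).
have [b Hb] := part (@complex.Im R : {additive Rcomplex R -> R})
  ltac:(case=> x y z /=; rewrite mulr0 add0r //).
exists (a +i* b)%C; apply/rowP => j; rewrite mxE.
by move: (Ha j) (Hb j); case: (v 0 j) => x y /= -> ->.
Qed.

(** Unitary diagonalisation of a Hermitian matrix, whose spectral values are real. The factored
    characteristic polynomial is kept because [second_largest_eigenvalue] counts eigenvalues with
    multiplicity. *)
Lemma gossip_spectral : exists (P : 'M[C]_m) (r : 'I_m -> R),
  [/\ P \is unitarymx, P *m WC = diag_mx (\row_i (r i)%:C%C) *m P &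
      char_poly WC = \prod_(i < m) ('X - (r i)%:C%C%:P)].
Proof.
have Punit := spectral_unitarymx WC.
have /orthomx_spectralP WE := gossip_normal.
have hreal : spectral_diag WC \is a realmx.
  apply: hermitian_spectral_diag_real; apply: realsym_hermsym.
    by rewrite qualifE /= expr0 scale1r map_mx_id// map_trmx (gossip_sym gW).
  by apply/mxOverP => i j; rewrite mxE; apply/complex_realP; exists (W i j).
exists (spectralmx WC), (fun i => complex.Re (spectral_diag WC 0 i)).
have -> : \row_i (complex.Re (spectral_diag WC 0 i))%:C%C = spectral_diag WC.
  by apply/rowP => i; rewrite mxE RRe_real//; apply: (mxOverP hreal).
split=> //.
  by rewrite {2}WE -mulmxA mulKVmx// unitarymx_unit.
rewrite (char_poly_similar (B := diag_mx (spectral_diag WC)) (unitarymx_unit Punit)).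
  2: by rewrite {2}WE -mulmxA mulKVmx// unitarymx_unit.
rewrite char_poly_trig ?diag_mx_is_trig//; apply: eq_bigr => i _.
by rewrite mxE eqxx mulr1n RRe_real//; apply: (mxOverP hreal).
Qed.

End Spectral.

(** * Contraction of the consensus error by FastMix *)

Section Contraction.
Local Open Scope sesquilinear_scope.
Context {R : realType} {m : nat} (edge : rel 'I_m) (W : 'M[R]_m) (lam2 : R).
Hypotheses (m_gt0 : (0 < m)%N) (gW : gossip_matrix edge W).
Hypothesis lam2P : second_largest_eigenvalue W lam2.
Local Notation C := R[i].
Local Notation toC := (real_complex R).
Local Notation WC := (map_mx toC W).

Lemma spectral_eigenvalue (P : 'M[C]_m) (r : 'I_m -> R) :
  P \is unitarymx -> P *m WC = diag_mx (\row_i (r i)%:C%C) *m P ->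
  forall i, row i P *m WC = (r i)%:C%C *: row i P /\ eigenvalue W (r i).
Proof.
move=> Pu PW i.
have rE : row i P *m WC = (r i)%:C%C *: row i P.
  by rewrite -row_mul PW row_mul row_diag_mx -scalemxAl -rowE mxE.
split=> //.
rewrite eigenvalue_root_char -(fmorph_root toC) map_char_poly.
rewrite -eigenvalue_root_char; apply/eigenvalueP; exists (row i P) => //.
apply/eqP => r0; have /row_unitarymxP/(_ i i) := Pu.
by rewrite r0 dotmxE mul0mx mxE eqxx => /eqP; rewrite eq_sym oner_eq0.
Qed.

Lemma eigenvalue1 : eigenvalue W 1.
Proof.
apply/eigenvalueP; exists (const_mx 1).
  rewrite scale1r; apply/rowP => j; rewrite !mxE.
  by under eq_bigr do rewrite mxE mul1r; rewrite (gossip_col gW).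
by apply/eqP => /rowP/(_ (Ordinal m_gt0)); rewrite !mxE => /eqP; rewrite oner_eq0.
Qed.

(** If the second eigenvalue were [1], two distinct rows of the unitary [P] would be fixed by [W],
    hence constant; but two nonzero constant rows are never orthogonal. *)
Lemma lam2_spec : [/\ 0 <= lam2, lam2 < 1 &
  forall r, eigenvalue W r -> r = 1 \/ r <= lam2].
Proof.
have [s [ss Ws ->]] := lam2P.
have mems r : (r \in s) = eigenvalue W r.
  by rewrite eigenvalue_root_char Ws root_prod_XsubC.
have s01 r : r \in s -> 0 <= r <= 1.
  by rewrite mems; exact: gossip_eigenvalue gW _.
have s1 : 1 \in s by rewrite mems eigenvalue1.
(* For a list of one eigenvalue the entry at index [1] is the default [0]. *)
have : (nth 0 s 1 = 0 /\ size s = 1%N) \/ (nth 0 s 1 \in s /\ (1 < size s)%N).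
  case: s s1 {ss Ws mems s01} => [|a [|b s]] //; first by left.
  by right; rewrite /= !inE eqxx orbT.
move=> H; split.
- by case: H => [[-> _]//|[/s01/andP[]]].
- case: H => [[-> _]//|[s1s sz]]; have /andP[_ le1] := s01 _ s1s.
  rewrite lt_neqAle le1 andbT; apply/negP => /eqP e1.
  have [P [r [Pu PW cW]]] := gossip_spectral gW.
  have pe : perm_eq [seq toC a | a <- s] [seq toC (r i) | i <- enum 'I_m].
    apply: prod_XsubC_eq; rewrite big_map big_image /=.
    rewrite -cW -map_char_poly Ws rmorph_prod /=.
    by apply: eq_bigr => a _; rewrite map_polyXsubC.
  (* [s] is nonincreasing with entries at most [1], so a [1] in second place forces a [1] in first
     place. *)
  have c2 : (2 <= count_mem 1%R s)%N.
    case: s s1s sz e1 ss s01 {Ws mems s1 pe le1} => [|a [|b s]] // _ _ /= ->.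
    case/andP => ba _ /(_ a (mem_head _ _))/andP[_ a1].
    by have -> : a = 1 by [apply/eqP; rewrite eq_le a1]; rewrite eqxx.
  have : (2 <= #|[pred i | r i == 1%R]|)%N.
    rewrite cardE /enum_mem size_filter -enumT /= -(count_map r (pred1 1%R)).
    have /permP <- : perm_eq s [seq r i | i <- enum 'I_m]; last exact: c2.
    by apply: (perm_map_inj (@complexI R)); rewrite -map_comp.
  case/card_gt1P => i [j []] /[!inE] /eqP ri /eqP rj ij.
  have [iP _] := spectral_eigenvalue Pu PW i.
  have [jP _] := spectral_eigenvalue Pu PW j.
  rewrite ri rj !scale1r in iP jP.
  have [ci Ei] := gossip_eigen1 gW iP; have [cj Ej] := gossip_eigen1 gW jP.
  have /row_unitarymxP Po := Pu.
  have dotc a b : dotmx (const_mx a : 'rV[C]_m) (const_mx b) = m%:R * (a * b^*).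
    rewrite dotmxE !mxE; under eq_bigr do rewrite !mxE.
    by rewrite sumr_const card_ord mulr_natl.
  have one0 : (true%:R == 0 :> C) = false := oner_eq0 C.
  have := Po i i; have := Po j j; have := Po i j.
  rewrite Ei Ej !dotc (negPf ij) eqxx => /eqP.
  rewrite !mulf_eq0 conjC_eq0 => /orP[/eqP->|/orP[/eqP->|/eqP->]].
  + by rewrite mul0r => /esym/eqP; rewrite one0.
  + by move=> _; rewrite !(mul0r, mulr0) eqxx => /esym/eqP; rewrite one0.
  + by rewrite !(mul0r, mulr0) => /esym/eqP; rewrite one0.
move=> r; rewrite -mems.
case: s ss s01 s1 {Ws mems H} => [//|a s] ss s01 s1.
have a1 : a = 1.
  apply/eqP; rewrite eq_le; have /andP[_ ->] := s01 a (mem_head _ _) => /=.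
  have := order_path_min ge_trans ss => /allP h.
  by move: s1; rewrite inE => /orP[/eqP->//|/h].
rewrite inE a1 => /orP[/eqP|rs]; [by left|right].
case: s ss rs {s01 s1 a1} => [//|b s] /= /andP[_ ss]; rewrite inE => /orP[/eqP->//|].
by move/(allP (order_path_min ge_trans ss)).
Qed.

(** In the eigenbasis the coordinates decouple, and each follows the scalar recurrence with its own
    eigenvalue. *)
Lemma cheb_diag {d : nat} (P : 'M[C]_m) (r : 'I_m -> R) (A : 'M[R]_(m, d)) M i j :
  P *m WC = diag_mx (\row_i (r i)%:C%C) *m P ->
  (P *m map_mx toC (fastmix W lam2 M A)) i j =
  ((cheb (eta_w lam2) (r i) M).1)%:C%C * (P *m map_mx toC A) i j.
Proof.
move=> PW; rewrite /fastmix /cheb; set h := eta_w lam2.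
set st := (X in iter M X (A, A)); set sc := (X in iter M X (1, 1)).
suff: (P *m map_mx toC (iter M st (A, A)).1) i j =
       ((iter M sc (1, 1)).1)%:C%C * (P *m map_mx toC A) i j /\
      (P *m map_mx toC (iter M st (A, A)).2) i j =
       ((iter M sc (1, 1)).2)%:C%C * (P *m map_mx toC A) i j by case.
elim: M => [|M [IH1 IH2]]; first by rewrite /= mul1r.
rewrite !iterS {1 3}/st {1 3}/sc /=; split=> //.
move: IH1 IH2; case: (iter M st _) => x y /=; case: (iter M sc _) => u v /= IH1 IH2.
rewrite map_mxB !map_mxZ map_mxM mulmxBr -!scalemxAr mulmxA PW -mulmxA.
rewrite [LHS]mxE [X in _ + X = _]mxE [X in _ - X = _]mxE IH2.
rewrite mul_diag_mx 2!mxE IH1 mxE !rmorphE /=; ring.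
Qed.

(** Parseval's identity; it brings the complex coordinates back to the real norm. *)
Lemma unitary_nsq {d : nat} (P : 'M[C]_m) (A : 'M[R]_(m, d)) :
  P \is unitarymx ->
  \sum_i \sum_j `|(P *m map_mx toC A) i j| ^+ 2 = (nsq A)%:C%C.
Proof.
move=> Pu; set Y := P *m _.
have YY : Y^t* *m Y = (map_mx toC A)^t* *m map_mx toC A.
  rewrite trmx_mul map_mxM -mulmxA [P^t* *m _]mulmxA.
  by rewrite -invmx_unitary// mulVmx ?unitarymx_unit// mul1mx.
have trE (B : 'M[C]_(m, d)) : \tr (B^t* *m B) = \sum_i \sum_j `|B i j| ^+ 2.
  rewrite /mxtrace exchange_big /=; apply: eq_bigr => j _; rewrite mxE.
  by apply: eq_bigr => i _; rewrite !mxE normCK mulrC.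
rewrite -trE YY trE /nsq /dot rmorph_sum /=; apply: eq_bigr => i _.
rewrite rmorph_sum /=; apply: eq_bigr => j _; rewrite mxE normc_def /=.
by rewrite -rmorphXn /= expr0n addr0 sqr_sqrtr ?sqr_ge0// expr2.
Qed.

Lemma fastmix_contract {d : nat} (A : 'M[R]_(m, d)) M :
  nvar (fastmix W lam2 M A) <= 4 * eta_w lam2 ^+ M * nvar A.
Proof.
have [l0 l1 lP] := lam2_spec.
rewrite /nvar (mean_fastmix _ gW) -(fastmixB _ gW).
rewrite /msq mulrCA ler_wpM2l ?minv_ge0//.
have := mean_dev m_gt0 A; move: (A - bcast (mean A)) => B mB.
have [P [r [Pu PW _]]] := gossip_spectral gW.
rewrite -lecR rmorphM /= -!(unitary_nsq _ Pu) mulr_sumr.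
apply: ler_sum => i _; rewrite mulr_sumr; apply: ler_sum => j _.
rewrite (cheb_diag _ _ _ _ PW) normrM exprMn.
have [iP ei] := spectral_eigenvalue Pu PW i.
(* Along an eigenvector for [1] the coordinate vanishes: that eigenvector is constant and the
   columns of [B] sum to zero. All other eigenvalues are at most [lam2]. *)
have [r1|rl] := lP _ ei.
  rewrite r1 scale1r in iP; have [c Ec] := gossip_eigen1 gW iP.
  have -> : (P *m map_mx toC B) i j = 0.
    rewrite mxE.
    under eq_bigr => k _.
      have -> : P i k = c by have /rowP/(_ k) := Ec; rewrite !mxE.
      rewrite mxE; over.
    rewrite -mulr_sumr -rmorph_sum /=.
    have -> : \sum_k B k j = 0.
      have /rowP/(_ j) := mB; rewrite /mean !mxE summxE.
      under eq_bigr do rewrite mxE.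
      by move/eqP; rewrite mulf_eq0 invr_eq0 (negPf (mR_neq0 m_gt0))/= => /eqP.
    by rewrite mulr0.
  by rewrite normr0 expr0n !mulr0.
rewrite ler_wpM2r ?exprn_ge0//.
have /andP[r0 _] := gossip_eigenvalue gW ei.
by rewrite -add_Re2_Im2 /= expr0n addr0 lecR cheb_bound.
Qed.

End Contraction.

(** * Gradients and proximal steps *)

Section Gradient.
Context {R : realType} {d : nat}.
Implicit Types (g : 'rV[R]_d -> R) (x y v : 'rV[R]_d).

Lemma derive_grad g x v : differentiable g x -> 'D_v g x = dot (grad g x) v.
Proof.
move=> dg; rewrite deriveE// {1}(row_sum_delta v) linear_sum /= -innerE /inner.
apply: eq_bigr => j _; rewrite linearZ /= -deriveE// mxE mulrC.
by rewrite -[LHS]/(v 0 j * _) mulrC.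
Qed.

Lemma avg_funE (k : nat) (c : R) (g : 'I_k -> 'rV[R]_d -> R) :
  (fun x => c * \sum_(i < k) g i x) = c *: \sum_(i < k) g i.
Proof. by apply/funext => x; rewrite -[RHS]/(c * _ x) fct_sumE. Qed.

Lemma differentiable_avg (k : nat) (c : R) (g : 'I_k -> 'rV[R]_d -> R) x :
  (forall i, differentiable (g i) x) ->
  differentiable (fun x => c * \sum_(i < k) g i x) x.
Proof.
by move=> dg; rewrite avg_funE; apply: differentiableZ; apply: differentiable_sum.
Qed.

Lemma grad_avg (k : nat) (c : R) (g : 'I_k -> 'rV[R]_d -> R) x :
  (forall i, differentiable (g i) x) ->
  grad (fun x => c * \sum_(i < k) g i x) x = c *: \sum_(i < k) grad (g i) x.
Proof.
move=> dg; apply/rowP => j; rewrite mxE avg_funE.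
have dgj i : derivable (g i) x (delta_mx 0 j) by apply: diff_derivable.
rewrite deriveZ; last exact: derivable_sum.
rewrite derive_sum// mxE summxE; congr (_ * _).
by apply: eq_bigr => i _; rewrite mxE.
Qed.

(** One-sided difference quotients suffice: as [t] decreases to [0] the quadratic term disappears.
    Only [t] in [(0, 1)] is asked for, since convexity says nothing outside. *)
Lemma derive_le_linear g x v (c e : R) : differentiable g x ->
  (forall t, 0 < t < 1 -> g (x + t *: v) - g x <= t * c + t ^+ 2 * e) ->
  'D_v g x <= c.
Proof.
move=> dg H.
have cv : h^-1 *: ((g \o shift x) (h *: v) - g x) @[h --> (0 : R)^'+] --> 'D_v g x.
  apply: cvg_dnbhs_at_right; exact: diff_derivable.
have ce : c + h * e @[h --> (0 : R)^'+] --> c.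
  apply: cvg_at_right_filter; rewrite -[X in _ --> X]addr0 -[X in _ + X](mul0r e).
  by apply: cvgD; [exact: cvg_cst|apply: cvgMl; exact: cvg_id].
apply: (ler_cvg_to cv ce).
have : \forall h \near (0 : R)^'+, h < 1 by apply: nbhs_right_lt.
have := nbhs_right_gt (0 : R); apply: filterS2 => h h0 h1.
rewrite -[leLHS]/(h^-1 * _) ler_pdivrMl// /= [_ *: v + x]addrC.
apply: le_trans (H h _) _; first by rewrite h0 h1.
by rewrite mulrDr expr2 mulrA.
Qed.

Lemma strongly_convex_fin (s : R) g : strongly_convex s (EFin \o g) ->
  forall x y t, 0 <= t <= 1 -> g (t *: x + (1 - t) *: y) <=
   t * g x + (1 - t) * g y - s / 2 * (t * (1 - t)) * nsq (x - y).
Proof.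
by move=> cg x y t t01; have := cg x y t t01; rewrite lee_fin enorm_sqr.
Qed.

Lemma strongly_convex_grad (s : R) g x y :
  strongly_convex s (EFin \o g) -> differentiable g x ->
  g x + dot (grad g x) (y - x) + s / 2 * nsq (y - x) <= g y.
Proof.
move=> /strongly_convex_fin cg dg; rewrite -derive_grad//.
suff: 'D_(y - x) g x <= g y - g x - s / 2 * nsq (y - x) by lra.
apply: (derive_le_linear (e := s / 2 * nsq (y - x))) => // t /andP[t0 t1].
have := cg y x t; rewrite (ltW t0) (ltW t1) => /(_ isT).
have -> : t *: y + (1 - t) *: x = x + t *: (y - x).
  by apply/rowP => j; rewrite !mxE; ring.
lra.
Qed.

Lemma convex_grad_mono g x y :
  strongly_convex 0 (EFin \o g) -> differentiable g x -> differentiable g y ->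
  0 <= dot (grad g x - grad g y) (x - y).
Proof.
move=> cg dx dy.
have := strongly_convex_grad y cg dx; have := strongly_convex_grad x cg dy.
rewrite !dotE; lra.
Qed.

Lemma dot_le_enorm x y : dot x y <= enorm x * enorm y.
Proof.
rewrite leNgt; apply/negP => h; have := cauchy_schwarz x y.
have := mulr_ge0 (enorm_ge0 x) (enorm_ge0 y); rewrite -!enorm_sqr -exprMn.
by move: (dot x y) (_ * _) h => a b; nra.
Qed.

(* Convexity at [y] and Lipschitz continuity of the gradient give the upper
   bound with [L] in place of the optimal [L / 2]. *)
Lemma lsmooth_upper (L : R) g x y : strongly_convex 0 (EFin \o g) ->
  lsmooth L g -> differentiable g y ->
  g y <= g x + dot (grad g x) (y - x) + L * nsq (y - x).
Proof.
move=> cg Lg dy; have := strongly_convex_grad x cg dy.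
have := dot_le_enorm (grad g y - grad g x) (y - x).
have := Lg y x; have := enorm_ge0 (y - x).
have <- := enorm_sqr (y - x); move: (enorm (y - x)) => e e0 h1 h2.
have : enorm (grad g y - grad g x) * e <= L * e ^+ 2 by rewrite expr2 mulrA ler_wpM2r.
move: h2; rewrite !dotE; lra.
Qed.

(* [x - w] is the gradient step of length [1 / (l1 + l2)] for the convex function
   [g + l2 / 2 |.|^2]. *)
Lemma l12smooth_gradient_step (l1 l2 : R) g x y : 0 < l1 + l2 ->
  l12smooth l1 l2 g ->
  (2 * (l1 + l2))^-1 * nsq (grad g x - grad g y + l2 *: (x - y))
    - l2 / 2 * nsq (x - y) <= g x - g y - dot (grad g y) (x - y).
Proof.
move=> l0 lg.
have lgE a b : - (l2 / 2) * nsq (a - b) <= g a - g b - dot (grad g b) (a - b)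
      <= l1 / 2 * nsq (a - b).
  by have := lg a b; rewrite enorm_sqr innerE.
set H := _ + l2 *: (x - y); pose w := (l1 + l2)^-1 *: H.
have HE : H = (l1 + l2) *: w by rewrite scalerA mulfV ?gt_eqF// scale1r.
clearbody w.
(* [g (x - w)] is bounded below through [y] and above through [x]; eliminating it leaves an
   inequality between [g x] and [g y]. *)
have /andP[lo _] := lgE (x - w) y; have /andP[_ up] := lgE (x - w) x.
have xw : x - w - x = - w by rewrite addrC addrA addNr add0r.
have xwy : x - w - y = (x - y) - w by rewrite addrAC.
rewrite xw nsqN in up; rewrite xwy in lo.
have GE : grad g x - grad g y = (l1 + l2) *: w - l2 *: (x - y) by rewrite -HE addrK.
have Gw : dot (grad g x) w = dot (grad g y) w + (l1 + l2) * nsq w - l2 * dot (x - y) w.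
  have /(congr1 (dot ^~ w)) /= := GE; rewrite !dotDl !dotNl !dotZl /nsq dotDl dotNl. lra.
rewrite HE nsqZ [X in X - _](_ : _ = (l1 + l2) / 2 * nsq w); last by field; lra.
move: lo up Gw; rewrite /nsq; move: (x - y) => u.
by rewrite !dotE (dotC w u) => lo up Gw; lra.
Qed.

(** Sum of the gradient-step bounds for [(x, y)] and [(y, x)], in which the function values cancel.
    As [l1 - l2 <= 0] in the application, the inner product helps wherever it is nonnegative. *)
Lemma l12smooth_cocoercive (l1 l2 : R) g x y : 0 < l1 + l2 ->
  l12smooth l1 l2 g ->
  nsq (grad g x - grad g y) <=
    (l1 - l2) * dot (grad g x - grad g y) (x - y) + l1 * l2 * nsq (x - y).
Proof.
move=> l0 lg.
have h1 := l12smooth_gradient_step x y l0 lg.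
have h2 := l12smooth_gradient_step y x l0 lg.
have E : grad g y - grad g x + l2 *: (y - x) = - (grad g x - grad g y + l2 *: (x - y)).
  by apply/rowP => j; rewrite !mxE; ring.
rewrite E nsqN (nsqB y x) in h2.
have E2 : dot (grad g x) (y - x) = - dot (grad g x) (x - y) by rewrite -dotNr opprB.
have : dot (grad g x - grad g y) (x - y) =
  dot (grad g x) (x - y) - dot (grad g y) (x - y) by rewrite dotDl dotNl.
move: h1 h2; rewrite E2; move: (grad g x - grad g y) (x - y) => G u h1 h2 DE.
have {}h : nsq (G + l2 *: u) <= (l1 + l2) * (dot G u + l2 * nsq u).
  have : (l1 + l2)^-1 * nsq (G + l2 *: u) <= dot G u + l2 * nsq u.
    rewrite [X in X * _ <= _](_ : _ = 2 * (2 * (l1 + l2))^-1); first lra.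
    by field; lra.
  by rewrite ler_pdivrMl.
by move: h; rewrite /nsq !dotE (dotC u G); lra.
Qed.

(** With Cauchy-Schwarz, cocoercivity factors as [(|G| - l2 |u|) (|G| + l1 |u|) <= 0] for the
    gradient difference [G] and [u = x - y]. *)
Lemma l12smooth_lipschitz (l1 l2 : R) g x y : 0 < l1 -> l1 <= l2 ->
  l12smooth l1 l2 g -> nsq (grad g x - grad g y) <= l2 ^+ 2 * nsq (x - y).
Proof.
move=> l0 l12 lg; have := l12smooth_cocoercive x y (ltac:(lra) : 0 < l1 + l2) lg.
have := dot_le_enorm (- (grad g x - grad g y)) (x - y).
rewrite dotNl -!enorm_sqr.
have -> : enorm (- (grad g x - grad g y)) = enorm (grad g x - grad g y).
  by apply/eqP; rewrite -(eqrXn2 (n := 2)) ?enorm_ge0// !enorm_sqr nsqN.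
have := enorm_ge0 (grad g x - grad g y); have := enorm_ge0 (x - y).
move: (enorm (grad g x - grad g y)) (enorm (x - y)) (dot _ _) => G u D u0 G0 h1 h2.
have {h1 h2} : (G - l2 * u) * (G + l1 * u) <= 0 by nra.
have [|h] := leP G (l2 * u); first by move=> *; rewrite -exprMn ler_pXn2r// nnegrE mulr_ge0//; lra.
have b : 0 <= l1 * u by rewrite mulr_ge0// ltW.
have a : 0 <= l2 * u by rewrite mulr_ge0//; lra.
have : 0 < (G - l2 * u) * (G + l1 * u) by rewrite mulr_gt0//; lra.
lra.
Qed.

End Gradient.

(** * Averages over the components *)

Section Family.
Context {R : realType} {m n d : nat}.
Context (f : 'I_m -> 'I_n -> 'rV[R]_d -> R) (l1 l2 : R).
Hypotheses (m_gt0 : (0 < m)%N) (n_gt0 : (0 < n)%N).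
Hypothesis df : forall i j x, differentiable (f i j) x.
Hypothesis f_convex : strongly_convex 0 (EFin \o f_global f).
Hypotheses (l1_gt0 : 0 < l1) (l12 : l1 <= l2).
Hypothesis fl : forall i j, l12smooth l1 l2 (f i j).

Lemma nsq_avg_le {p : nat} (I : finType) (F : I -> 'rV[R]_p) :
  nsq (#|I|%:R^-1 *: \sum_i F i) <= #|I|%:R^-1 * \sum_i nsq (F i).
Proof.
rewrite nsqZ; have [->|I0] := eqVneq #|I| 0%N; first by rewrite invr0 expr0n !mul0r.
apply: le_trans (ler_wpM2l (sqr_ge0 _) (nsq_sum_le F)) _.
by rewrite mulrA expr2 -(mulrA _ _ #|I|%:R) mulVf ?mulr1// pnatr_eq0.
Qed.

Lemma nsq_avg_ord_le {p k : nat} (F : 'I_k -> 'rV[R]_p) :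
  nsq (k%:R^-1 *: \sum_i F i) <= k%:R^-1 * \sum_i nsq (F i).
Proof. by have := nsq_avg_le F; rewrite card_ord. Qed.

Lemma differentiable_local i x : differentiable (f_local f i) x.
Proof. exact: differentiable_avg. Qed.

Lemma differentiable_global x : differentiable (f_global f) x.
Proof. by apply: differentiable_avg => i; exact: differentiable_local. Qed.

Lemma grad_local i x : grad (f_local f i) x = n%:R^-1 *: \sum_j grad (f i j) x.
Proof. exact: grad_avg. Qed.

Lemma grad_global x :
  grad (f_global f) x = m%:R^-1 *: \sum_i grad (f_local f i) x.
Proof. by apply: grad_avg => i; exact: differentiable_local. Qed.

Definition grads (X : 'M[R]_(m, d)) : 'M[R]_(m, d) :=
  \matrix_(i < m) grad (f_local f i) (row i X).

Lemma mean_grads_bcast u : mean (grads (bcast u)) = grad (f_global f) u.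
Proof.
rewrite grad_global /mean; congr (_ *: _); apply: eq_bigr => i _.
by rewrite rowK row_bcast.
Qed.

Lemma component_lipschitz i j x y :
  nsq (grad (f i j) x - grad (f i j) y) <= l2 ^+ 2 * nsq (x - y).
Proof. exact: (l12smooth_lipschitz _ _ l1_gt0 l12 (fl i j)). Qed.

Lemma local_lipschitz i x y :
  nsq (grad (f_local f i) x - grad (f_local f i) y) <= l2 ^+ 2 * nsq (x - y).
Proof.
rewrite !grad_local -scalerBr -sumrB; apply: le_trans (nsq_avg_ord_le _) _.
rewrite ler_pdivrMl ?ltr0n//.
have : \sum_(j < n) nsq (grad (f i j) x - grad (f i j) y) <=
       \sum_(j < n) (l2 ^+ 2 * nsq (x - y)).
  by apply: ler_sum => j _; apply: component_lipschitz.
by rewrite sumr_const card_ord mulr_natl.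
Qed.

Lemma msq_grads X Y : msq (grads X - grads Y) <= l2 ^+ 2 * msq (X - Y).
Proof.
rewrite !msq_row mulrCA ler_wpM2l ?minv_ge0// mulr_sumr.
by apply: ler_sum => i _; rewrite !linearB /= !rowK; exact: local_lipschitz.
Qed.

(** The inner product of one component may be negative, but their average is the one of [f_global],
    nonnegative by convexity. The term with factor [l1 - l2] is therefore dropped. *)
Lemma avg_cocoercive x y :
  m%:R^-1 * \sum_i (n%:R^-1 * \sum_j nsq (grad (f i j) x - grad (f i j) y)) <=
  l1 * l2 * nsq (x - y).
Proof.
have h0 : 0 < l1 + l2 by rewrite addr_gt0 // (lt_le_trans l1_gt0).
pose G := grad (f_global f) x - grad (f_global f) y.
have GE : dot G (x - y) = m%:R^-1 * \sum_i (n%:R^-1 *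
    \sum_j dot (grad (f i j) x - grad (f i j) y) (x - y)).
  rewrite /G !grad_global -scalerBr -sumrB dotZl dot_suml; congr (_ * _).
  apply: eq_bigr => i _; rewrite !grad_local -scalerBr -sumrB dotZl dot_suml.
  by congr (_ * _).
have : m%:R^-1 * \sum_i (n%:R^-1 * \sum_j nsq (grad (f i j) x - grad (f i j) y)) <=
  m%:R^-1 * \sum_(i < m) (n%:R^-1 * \sum_(j < n) ((l1 - l2) *
    dot (grad (f i j) x - grad (f i j) y) (x - y) + l1 * l2 * nsq (x - y))).
  rewrite ler_wpM2l ?minv_ge0//; apply: ler_sum => i _.
  rewrite ler_wpM2l ?minv_ge0//; apply: ler_sum => j _.
  exact: l12smooth_cocoercive.
move/le_trans; apply.
rewrite [leLHS](_ : _ = (l1 - l2) * dot G (x - y) + l1 * l2 * nsq (x - y)).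
  have := convex_grad_mono f_convex (differentiable_global x) (differentiable_global y).
  by rewrite gerDr => h; rewrite mulr_le0_ge0 ?subr_le0.
have avgc (k : nat) (c : R) : (0 < k)%N -> k%:R^-1 * (c *+ k) = c.
  by move=> k0; rewrite -[c *+ k]mulr_natl mulKf// pnatr_eq0 -lt0n.
rewrite GE (eq_bigr (fun i => (l1 - l2) * (n%:R^-1 *
    \sum_j dot (grad (f i j) x - grad (f i j) y) (x - y)) + l1 * l2 * nsq (x - y))).
  by rewrite big_split /= sumr_const card_ord mulrDr avgc// -mulr_sumr mulrCA.
move=> i _; rewrite big_split /= sumr_const card_ord mulrDr avgc// -mulr_sumr.
by rewrite mulrCA.
Qed.

End Family.

(** Removes the factor [1 - t] that strong convexity on a segment leaves behind: an excess [e] is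
    contradicted by [t = e / (2 (e + k))]. *)
Lemma le_of_shrink {R : realFieldType} (a b k : R) : 0 <= k ->
  (forall t, 0 < t < 1 -> a <= b - (1 - t) * k) -> a <= b - k.
Proof.
move=> k0 H; rewrite leNgt; apply/negP => h.
pose e := a - b + k; have e0 : 0 < e by rewrite /e; lra.
have ek : 0 < e / (2 * (e + k)) < 1.
  rewrite divr_gt0 ?mulr_gt0//=; try lra.
  by rewrite ltr_pdivrMr ?mulr_gt0//; lra.
have := H _ ek; set t := e / _ => Ht.
have : t * k < e.
  rewrite /t mulrAC ltr_pdivrMr ?mulr_gt0//; try lra.
  by rewrite ltr_pM2l//; lra.
by move: Ht; rewrite /e; lra.
Qed.

(** * Proximal steps of one agent and of the whole network *)

Section Prox.
Context {R : realType} {d : nat} (psi : 'rV[R]_d -> \bar R) (s : R).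
Hypotheses (s_ge0 : 0 <= s) (psi_cvx : strongly_convex s psi).
Hypothesis psi_proper : proper_function psi.
Local Notation dom x := (psi x \is a fin_num).
Local Notation ps x := (fine (psi x)).

Lemma domE x : dom x = (psi x != +oo%E).
Proof. by rewrite fin_numE (psi_proper.1 x). Qed.

Lemma convex_dom x y t : 0 <= t <= 1 -> dom x -> dom y ->
  dom (t *: x + (1 - t) *: y) /\
  ps (t *: x + (1 - t) *: y) <=
    t * ps x + (1 - t) * ps y - s / 2 * (t * (1 - t)) * nsq (x - y).
Proof.
move=> t01 dx dy; have := psi_cvx x y t01.
rewrite -(fineK dx) -(fineK dy) enorm_sqr -!EFinM -!EFinD => h.
have dz : dom (t *: x + (1 - t) *: y).
  rewrite domE; apply/eqP => z; by move: h; rewrite z leye_eq.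
by split=> //; rewrite -lee_fin (fineK dz).
Qed.

Lemma argmin_dom eta x z : is_argmin (prox_obj eta psi x) z -> dom z.
Proof.
move=> H; have [u du] := psi_proper.2; rewrite -domE in du.
have := H u; rewrite /prox_obj domE -(fineK du) -EFinD; apply: contraL => /eqP ->.
by rewrite addye// leye_eq.
Qed.

Lemma argmin_prox_obj eta x z u : is_argmin (prox_obj eta psi x) z -> dom u ->
  ps z + (2 * eta)^-1 * nsq (z - x) <= ps u + (2 * eta)^-1 * nsq (u - x).
Proof.
move=> H du; have dz := argmin_dom H; have := H u.
by rewrite /prox_obj -(fineK du) -(fineK dz) -!EFinD lee_fin !enorm_sqr.
Qed.

(** The proximal objective is strongly convex with modulus [1 / eta + s], so it grows quadratically
    from its minimizer: compare [z] with [t u + (1 - t) z], divide by [t] and let [t] tend to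
    [0]. *)
Lemma argmin_variational eta x z u : 0 < eta ->
  is_argmin (prox_obj eta psi x) z -> dom u ->
  ps z + (2 * eta)^-1 * nsq (z - x) + ((2 * eta)^-1 + s / 2) * nsq (u - z) <=
  ps u + (2 * eta)^-1 * nsq (u - x).
Proof.
move=> eta0 H du; have dz := argmin_dom H; rewrite -lerBrDr.
have c0 : 0 < (2 * eta)^-1 by rewrite invr_gt0 mulr_gt0.
apply: le_of_shrink; first by rewrite mulr_ge0 ?nsq_ge0// addr_ge0 ?(ltW c0) ?divr_ge0.
move=> t /andP[t0 t1]; have t01 : 0 <= t <= 1 by rewrite !ltW.
have [dv hv] := convex_dom t01 du dz.
have := argmin_prox_obj H dv.
have -> : nsq (t *: u + (1 - t) *: z - x) =
  t * nsq (u - x) + (1 - t) * nsq (z - x) - t * (1 - t) * nsq (u - z).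
  by rewrite /nsq !dotE (dotC z u) (dotC x u) (dotC x z); ring.
move: (nsq (u - x)) (nsq (z - x)) (nsq (u - z)) hv => A B C hv h.
by rewrite -(ler_pM2l t0); move: (2 * eta)^-1 c0 h hv => c c0; nra.
Qed.

(** Adding the variational inequalities of the two minimizers, each tested at the other, gives firm
    nonexpansiveness [|z1 - z2|^2 <= <z1 - z2, x1 - x2>]. *)
Lemma argmin_nonexpansive eta x1 x2 z1 z2 : 0 < eta ->
  is_argmin (prox_obj eta psi x1) z1 -> is_argmin (prox_obj eta psi x2) z2 ->
  nsq (z1 - z2) <= nsq (x1 - x2).
Proof.
move=> eta0 H1 H2.
have := argmin_variational eta0 H1 (argmin_dom H2).
have := argmin_variational eta0 H2 (argmin_dom H1).
have c0 : 0 < (2 * eta)^-1 by rewrite invr_gt0 mulr_gt0.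
move: (2 * eta)^-1 c0 => c c0; rewrite (nsqB z2 z1) => h1 h2.
have h0 : 0 <= s / 2 * nsq (z1 - z2) by rewrite mulr_ge0 ?nsq_ge0// divr_ge0.
have h3 : c * (2 * nsq (z1 - z2)) <=
    c * (nsq (z2 - x1) + nsq (z1 - x2) - nsq (z1 - x1) - nsq (z2 - x2)) by lra.
move: h3; rewrite ler_pM2l//.
have := nsq_ge0 ((z1 - z2) - (x1 - x2)); rewrite /nsq !dotE.
rewrite (dotC z2 z1) (dotC x1 z1) (dotC x1 z2) (dotC x2 z1) (dotC x2 z2) (dotC x2 x1).
lra.
Qed.

Lemma jensen_seq (v : nat -> 'rV[R]_d) k : (forall i, dom (v i)) ->
  dom (k.+1%:R^-1 *: \sum_(i < k.+1) v i) /\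
  ps (k.+1%:R^-1 *: \sum_(i < k.+1) v i) <= k.+1%:R^-1 * \sum_(i < k.+1) ps (v i).
Proof.
move=> dv; elim: k => [|k [dk IH]].
  by rewrite !big_ord1 invr1 scale1r mul1r.
pose t : R := k.+2%:R^-1.
have k2 : k.+2%:R = k.+1%:R + 1 :> R by rewrite -natr1.
have k1 : 0 < k.+1%:R :> R by rewrite ltr0n.
have t01 : 0 <= t <= 1 by rewrite invr_ge0 ler0n invf_le1 ?ltr0n// ler1n.
have t1 : (1 - t) * k.+1%:R^-1 = t by rewrite /t k2; field; lra.
have := convex_dom t01 (dv k.+1) dk.
have -> : t *: v k.+1 + (1 - t) *: (k.+1%:R^-1 *: \sum_(i < k.+1) v i) =
          t *: \sum_(i < k.+2) v i.
  by rewrite scalerA t1 -scalerDr [in RHS]big_ord_recr /= addrC.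
move=> [dz hz]; split=> //; apply: le_trans hz _.
have : 0 <= s / 2 * (t * (1 - t)) * nsq (v k.+1 - k.+1%:R^-1 *: \sum_(i < k.+1) v i).
  by rewrite !mulr_ge0 ?nsq_ge0 ?invr_ge0//; lra.
have : (1 - t) * ps (k.+1%:R^-1 *: \sum_(i < k.+1) v i) <=
       (1 - t) * (k.+1%:R^-1 * \sum_(i < k.+1) ps (v i)) by rewrite ler_wpM2l//; lra.
rewrite [(1 - t) * (_ * _)]mulrA t1 => h1 h2.
rewrite -/t [X in _ <= t * X]big_ord_recr /= [X in _ <= X]mulrDr; lra.
Qed.

Lemma jensen_mean {m : nat} (X : 'M[R]_(m, d)) : (0 < m)%N ->
  (forall i, dom (row i X)) ->
  dom (mean X) /\ ps (mean X) <= m%:R^-1 * \sum_i ps (row i X).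
Proof.
case: m X => // k X _ dX; rewrite /mean.
have := @jensen_seq (fun i => row (inord i) X) k (fun i => dX _).
have -> : \sum_(i < k.+1) row (inord i) X = \sum_i row i X.
  by apply: eq_bigr => i _; rewrite inord_val.
suff -> : \sum_(i < k.+1) ps (row (inord i) X) = \sum_i ps (row i X) by [].
by apply: eq_bigr => i _; rewrite inord_val.
Qed.

Section MatrixProx.
Context {m : nat} (eta : R).
Hypotheses (m_gt0 : (0 < m)%N) (eta_gt0 : 0 < eta).
Hypothesis prox_ex : forall x, exists z, is_argmin (prox_obj eta psi x) z.
Implicit Types X Z : 'M[R]_(m, d).

(** The step [m * eta] compensates the factor [1 / m] in [Psi], so the matrix problem separates into
    row problems with step [eta]. *)
Lemma prox_obj_rows X Z : prox_obj (m%:R * eta) (Psi psi) X Z =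
  ((m%:R^-1)%:E * \sum_(i < m) prox_obj eta psi (row i X) (row i Z))%E.
Proof.
rewrite /prox_obj /Psi big_split /= sumEFin muleDr ?fin_num_adde_defl//.
congr (_ + _)%E; rewrite -EFinM -mulr_sumr; congr EFin.
rewrite enorm_sqr nsq_row; under [in RHS]eq_bigr do rewrite enorm_sqr -linearB /=.
by rewrite !mulrA -invfM (mulrC 2 m%:R) -mulrA.
Qed.

(** Row minimizers assemble to a matrix minimizer, so [xget] does not fall back on its default [X].
    Optimality of one row is tested by exchanging that row alone. *)
Lemma prox_rows X i :
  is_argmin (prox_obj eta psi (row i X)) (row i (prox (m%:R * eta) (Psi psi) X)).
Proof.
have : exists Z, is_argmin (prox_obj (m%:R * eta) (Psi psi) X) Z.
  have /choice[p pP] := prox_ex; exists (\matrix_(i < m) p (row i X)) => Z.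
  rewrite !prox_obj_rows lee_wpmul2l ?lee_fin ?minv_ge0//.
  by apply: lee_sum => k _; rewrite rowK; exact: pP.
rewrite /prox => -[Z0 HZ0]; have := @xgetI _ X _ Z0 HZ0.
set Z := xget _ _ => /= HZ u.
have HZr Y : (\sum_(k < m) prox_obj eta psi (row k X) (row k Z) <=
              \sum_(k < m) prox_obj eta psi (row k X) (row k Y))%E.
  by have := HZ Y; rewrite !prox_obj_rows lee_pmul2l ?lte_fin ?invr_gt0 ?ltr0n.
have po_fin x z : (prox_obj eta psi x z \is a fin_num) = dom z.
  by rewrite /prox_obj fin_numD andbT.
(* Finiteness of every row term allows the unchanged rows to be cancelled in [\bar R]. *)
have Zfin k : dom (row k Z).
  have [u0] := psi_proper.2; rewrite -domE => du0.
  have : \sum_(k < m) prox_obj eta psi (row k X) (row k Z) \is a fin_num.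
    rewrite fin_numE; apply/andP; split.
      apply/negP => /eqP/esum_eqNyP[l [_ _]] /eqP; apply/negP.
      by rewrite /prox_obj adde_eq_ninfty negb_or /= (psi_proper.1 _).
    have := HZr (bcast u0); apply: contraTN => /eqP ->; rewrite leye_eq.
    have /sum_fin_numP : forall l, l \in index_enum 'I_m -> true ->
      prox_obj eta psi (row l X) (row l (bcast u0)) \is a fin_num.
      by move=> l _ _; rewrite po_fin row_bcast.
    by rewrite fin_numE => /andP[].
  by move/sum_fin_numP/(_ k (mem_index_enum _) isT); rewrite po_fin.
pose Y := \matrix_(k < m) (if k == i then u else row k Z).
have := HZr Y; rewrite (bigD1 i)//= [leRHS](bigD1 i)//= rowK eqxx.
rewrite (eq_bigr (fun k => prox_obj eta psi (row k X) (row k Y))); last first.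
  by move=> k /negPf ki; rewrite rowK ki.
rewrite leeD2rE//; apply/sum_fin_numP => k _ /negPf ki.
by rewrite po_fin rowK ki.
Qed.
End MatrixProx.
End Prox.

Lemma sum_pair (V : nmodType) (I J : finType) (F : I * J -> V) :
  \sum_p F p = \sum_i \sum_j F (i, j).
Proof. by rewrite pair_bigA; apply: eq_bigr => -[]. Qed.

(** * Uniform averages over finite types; minibatch noise *)

Section Average.
Context {R : realType}.

Definition avg {B : finType} (g : B -> R) : R := #|B|%:R^-1 * \sum_x g x.

Lemma eq_avg {B : finType} (g h : B -> R) : g =1 h -> avg g = avg h.
Proof. by move=> gh; congr (_ * _); apply: eq_bigr. Qed.

Lemma avgD {B : finType} (g h : B -> R) : avg (fun x => g x + h x) = avg g + avg h.
Proof. by rewrite /avg big_split /= mulrDr. Qed.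

Lemma avgZ {B : finType} c (g : B -> R) : avg (fun x => c * g x) = c * avg g.
Proof. by rewrite /avg -mulr_sumr mulrCA. Qed.

Lemma avg_sum {B : finType} (I : Type) (r : seq I) (P : pred I) (g : I -> B -> R) :
  avg (fun x => \sum_(i <- r | P i) g i x) = \sum_(i <- r | P i) avg (g i).
Proof. by rewrite /avg exchange_big mulr_sumr. Qed.

Lemma avg_cst {B : finType} c : (0 < #|B|)%N -> avg (fun _ : B => c) = c.
Proof.
by move=> B0; rewrite /avg sumr_const -[c *+ _]mulr_natl mulKf// pnatr_eq0 -lt0n.
Qed.

Lemma ler_avg {B : finType} (g h : B -> R) :
  (forall x, g x <= h x) -> avg g <= avg h.
Proof.
by move=> gh; rewrite ler_wpM2l ?invr_ge0 ?ler0n//; apply: ler_sum => x _.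
Qed.

Lemma avg_ge0 {B : finType} (g : B -> R) : (forall x, 0 <= g x) -> 0 <= avg g.
Proof.
by move=> g0; rewrite mulr_ge0 ?invr_ge0 ?ler0n//; apply: sumr_ge0 => x _.
Qed.

Section Coordinates.
Context {I J : finType}.
Hypothesis J_gt0 : (0 < #|J|)%N.
Implicit Types (a b : J -> R).

Lemma card_ffun_gt0 : (0 < #|{ffun I -> J}|)%N.
Proof. by rewrite card_ffun expn_gt0 J_gt0. Qed.

(** Independence of the coordinates under the uniform law, as distributivity of products over
    sums. *)
Lemma avg_prod (F : I -> J -> R) :
  avg (fun x : {ffun I -> J} => \prod_i F i (x i)) = \prod_i avg (F i).
Proof.
by rewrite /avg -bigA_distr_bigA /= big_split /= prodr_const card_ffun natrX exprVn.
Qed.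

Lemma avg_coord a i : avg (fun x : {ffun I -> J} => a (x i)) = avg a.
Proof.
pose F k := if k == i then a else fun=> 1.
rewrite (@eq_avg _ _ (fun x : {ffun I -> J} => \prod_k F k (x k))) ?avg_prod.
  rewrite (bigD1 i)//= {1}/F eqxx big1 ?mulr1// => k /negPf ki.
  by rewrite /F ki avg_cst.
move=> x; rewrite (bigD1 i)//= {1}/F eqxx big1 ?mulr1// => k /negPf ki.
by rewrite /F ki.
Qed.

Lemma avg_coord2 a b i k : i != k ->
  avg (fun x : {ffun I -> J} => a (x i) * b (x k)) = avg a * avg b.
Proof.
move=> ik; pose F l := if l == i then a else if l == k then b else fun=> 1.
have ki : (k == i) = false by rewrite eq_sym (negPf ik).
rewrite (@eq_avg _ _ (fun x : {ffun I -> J} => \prod_k F k (x k))) ?avg_prod.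
  rewrite (bigD1 i)//= (bigD1 k) /= ?ki// {1 2}/F eqxx ki eqxx.
  rewrite big1 ?mulr1// => l /andP[/negPf li /negPf lk].
  by rewrite /F li lk avg_cst.
move=> x; rewrite (bigD1 i)//= (bigD1 k) /= ?ki// {1 2}/F eqxx ki eqxx.
rewrite big1 ?mulr1// => l /andP[/negPf li /negPf lk].
by rewrite /F li lk.
Qed.

Context {d : nat} (h : I -> J -> 'rV[R]_d).
Hypothesis h0 : forall i, \sum_j h i j = 0.

Lemma avg_dot_h i v : avg (fun j => dot (h i j) v) = 0.
Proof. by rewrite /avg -dot_suml h0 dot0l mulr0. Qed.

Lemma avg_noise v : avg (fun x : {ffun I -> J} => dot (\sum_i h i (x i)) v) = 0.
Proof.
rewrite (@eq_avg _ _ (fun x : {ffun I -> J} => \sum_i dot (h i (x i)) v)); last first.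
  by move=> x; rewrite dot_suml.
by rewrite avg_sum big1// => i _; rewrite (avg_coord (fun j => dot (h i j) v)) avg_dot_h.
Qed.

(** Variance of a sum of independent centred vectors: the cross terms vanish, entry by entry. *)
Lemma avg_noise_sq : avg (fun x : {ffun I -> J} => nsq (\sum_i h i (x i))) =
  \sum_i avg (fun j => nsq (h i j)).
Proof.
rewrite (@eq_avg _ _ (fun x : {ffun I -> J} => \sum_i \sum_k dot (h i (x i)) (h k (x k)))); last first.
  by move=> x; rewrite /nsq dot_suml; under eq_bigr do rewrite dot_sumr.
rewrite avg_sum; apply: eq_bigr => i _; rewrite avg_sum (bigD1 i)//= big1 ?addr0.
  by rewrite (avg_coord (fun j => dot (h i j) (h i j))).
move=> k ki; rewrite (@eq_avg _ _ (fun x : {ffun I -> J} => \sum_c h i (x i) 0 c * h k (x k) 0 c)).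
  rewrite avg_sum big1// => c _.
  rewrite (avg_coord2 (fun j => h i j 0 c) (fun j => h k j 0 c)) 1?eq_sym//.
  by rewrite /avg -summxE h0 mxE mulr0 mul0r.
by move=> x; rewrite /dot big_ord1.
Qed.

End Coordinates.

Section Minibatch.
Context {m n b d : nat} (g : 'I_m -> 'I_n -> 'rV[R]_d).
Hypotheses (m_gt0 : (0 < m)%N) (n_gt0 : (0 < n)%N) (b_gt0 : (0 < b)%N).
Local Notation batch := {ffun 'I_m * 'I_b -> 'I_n}.

(** A [batch] collects the draws of all agents in one inner step. In the application [g i j] is the
    gradient difference of a component between the current point and the start of the epoch. *)
Definition batch_grad (x : batch) : 'M[R]_(m, d) :=
  \matrix_(i < m) (b%:R^-1 *: \sum_(l < b) g i (x (i, l))).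

Definition full_grad : 'M[R]_(m, d) :=
  \matrix_(i < m) (n%:R^-1 *: \sum_(j < n) g i j).

Let h (p : 'I_m * 'I_b) (j : 'I_n) : 'rV[R]_d :=
  (m%:R^-1 * b%:R^-1) *: (g p.1 j - row p.1 full_grad).

Let h0 p : \sum_j h p j = 0.
Proof.
rewrite -scaler_sumr sumrB sumr_const card_ord -[row _ _ *+ n]scaler_nat rowK scalerA.
by rewrite mulfV ?pnatr_eq0 -?lt0n// scale1r subrr scaler0.
Qed.

Let noiseE x : mean (batch_grad x) - mean full_grad = \sum_p h p (x p).
Proof.
rewrite -meanB /mean sum_pair scaler_sumr.
apply: eq_bigr => i _; rewrite linearB /= [row i (batch_grad x)]rowK.
rewrite /h /= -scaler_sumr sumrB sumr_const card_ord -scalerA -[row _ _ *+ b]scaler_nat.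
rewrite [in RHS]scalerBr [b%:R^-1 *: (b%:R *: _)]scalerA.
by rewrite mulVf ?scale1r// pnatr_eq0 -lt0n.
Qed.

Let J0 : (0 < #|'I_n|)%N. Proof. by rewrite card_ord. Qed.

Lemma card_batch : (0 < #|{: batch}|)%N.
Proof. exact: card_ffun_gt0. Qed.

Lemma avg_batch_dot v :
  avg (fun x : batch => dot (mean (batch_grad x) - mean full_grad) v) = 0.
Proof. by under eq_avg do rewrite noiseE; exact: avg_noise. Qed.

Lemma avg_batch_sq :
  avg (fun x : batch => nsq (mean (batch_grad x) - mean full_grad)) <=
  b%:R^-1 * (m%:R^-1 * \sum_i (n%:R^-1 * \sum_j nsq (g i j))).
Proof.
under eq_avg do rewrite noiseE.
rewrite avg_noise_sq// sum_pair.
rewrite mulrA mulr_sumr; apply: ler_sum => i _.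
rewrite /h /= sumr_const card_ord.
have -> : avg (fun j => nsq ((m%:R^-1 * b%:R^-1) *: (g i j - row i full_grad))) =
  (m%:R^-1 * b%:R^-1) ^+ 2 * avg (fun j => nsq (g i j - row i full_grad)).
  by rewrite -avgZ; apply: eq_avg => j; rewrite nsqZ.
have var : avg (fun j => nsq (g i j - row i full_grad)) <= n%:R^-1 * \sum_j nsq (g i j).
  rewrite rowK; have [u uE] : {u | u = n%:R^-1 *: \sum_j g i j} by exists (n%:R^-1 *: \sum_j g i j).
  rewrite -uE.
  have -> : avg (fun j => nsq (g i j - u)) = n%:R^-1 * \sum_j nsq (g i j) - nsq u.
    rewrite (@eq_avg _ _ (fun j => nsq (g i j) + (- 2 * dot (g i j) u + nsq u))); last first.
      by move=> j; rewrite /nsq !dotE (dotC u); ring.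
    have avu : avg (fun j => dot (g i j) u) = nsq u.
      by rewrite /avg card_ord -dot_suml -dotZl -uE.
    by rewrite !avgD avg_cst// avgZ avu /avg card_ord; ring.
  by rewrite gerBl nsq_ge0.
rewrite -[leLHS]mulr_natl [leLHS]mulrA.
(* Independence across agents gains a further factor [1 / m], which is discarded here. *)
have m1 : m%:R^-1 <= 1 :> R by rewrite invf_le1 ?ltr0n// ler1n.
apply: le_trans (_ : _ <= (b%:R^-1 * m%:R^-1) * avg (fun j => nsq (g i j - row i full_grad))) _; last first.
  by rewrite ler_wpM2l// mulr_ge0 ?invr_ge0.
rewrite ler_wpM2r ?avg_ge0// => [j|]; first exact: nsq_ge0.
rewrite exprMn expr2 expr2 [X in X <= _](_ : _ = m%:R^-1 * (b%:R^-1 * m%:R^-1)).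
  by rewrite ler_piMl// mulr_ge0 ?invr_ge0.
by field; rewrite !pnatr_eq0 -!lt0n b_gt0 m_gt0.
Qed.

End Minibatch.
End Average.

(** * Inner steps and epochs *)

Lemma strongly_convexW {R : realType} {d : nat} (s t : R) (g : 'rV[R]_d -> \bar R) :
  t <= s -> strongly_convex s g -> strongly_convex t g.
Proof.
move=> ts cg x y k k01; apply: le_trans (cg x y k k01) _.
rewrite leeB// lee_fin !ler_wpM2r ?exprn_ge0 ?enorm_ge0 ?mulr_ge0//; lra.
Qed.

Section Setting.
Context {R : realType} {m n d : nat}.
Context (f : 'I_m -> 'I_n -> 'rV[R]_d -> R) (psi : 'rV[R]_d -> \bar R).
Context (W : 'M[R]_m) (lam2 : R) (b : nat) (eta : R) (M : nat).
Context (L l1 l2 sf sp delta gam : R).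

Definition Lam : R := eta * l2.

(** Weight of [in_v st - mu] in the consensus error [cerr]. Mixing does not shrink this deviation,
    and it responds to the other errors with a gain of order [Lam ^+ 2]; the weight is of order
    [gam] over that gain. *)
Definition eps0 : R := gam / (8 * (1 + Lam ^+ 2)).

(** [delta] is the factor by which a FastMix call shrinks [nvar], and [gam] the rate demanded of the
    consensus error in an inner step. The analysis of a setting uses FastMix only through [set_mean]
    and [set_nvar]. *)
Record setting : Prop := Setting {
  set_m : (0 < m)%N;
  set_n : (0 < n)%N;
  set_b : (0 < b)%N;
  set_diff : forall i j x, differentiable (f i j) x;
  set_lsmooth : lsmooth L (f_global f);
  set_sf : 0 <= sf;
  set_sp : 0 <= sp;
  set_s : 0 < sf + sp;
  set_fcvx : strongly_convex sf (EFin \o f_global f);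
  set_pcvx : strongly_convex sp psi;
  set_proper : proper_function psi;
  set_prox : forall (t : R) x, 0 < t -> exists z, is_argmin (prox_obj t psi x) z;
  set_l1 : 0 < l1;
  set_l12 : l1 <= l2;
  set_l12smooth : forall i j, l12smooth l1 l2 (f i j);
  set_mean : forall A : 'M[R]_(m, d), mean (fastmix W lam2 M A) = mean A;
  set_nvar : forall A : 'M[R]_(m, d),
    nvar (fastmix W lam2 M A) <= delta * nvar A;
  set_eta : 0 < eta;
  set_etaL : 4 * eta * L + 2 * eta * sf <= 1;
  set_delta : 0 <= delta;
  set_gam0 : 0 < gam;
  set_gam : gam <= 1 / 2;
  set_delta_small : 12 * delta <= eps0 * gam }.

End Setting.

(** [w], [s], [v] are the parts of the consensus error before the step, primes mark them after it,
    [D] is the squared distance from the epoch start, [a0] the consensus error there and [X] that of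
    the prox argument. The part [v'] is small only through [ep], while [s'] contains a multiple of
    [delta * v] that [gam * ep * v] must beat; hence [12 * delta <= ep * gam]. *)
Lemma consensus_step_arith {R : realFieldType} (delta gam ep l w' s' v' w s v D a0 X : R) :
  0 <= delta -> 0 < gam -> gam <= 1 / 2 -> 12 * delta <= ep * gam -> 0 < ep -> 0 <= l ->
  ep * (8 * (1 + l)) = gam ->
  s' <= 3 * delta * (s + v + l * (D + 2 * w + 2 * a0)) ->
  v' <= l * (D + 2 * w + 2 * a0) -> X <= 2 * w + 2 * s' ->
  w' <= delta * (2 * w + 2 * s') ->
  0 <= w -> 0 <= a0 -> 0 <= D -> 0 <= s -> 0 <= v -> 0 <= s' ->
  w' + s' + ep * v' <= gam * (w + s + ep * v + a0 + D) /\
  X <= 4 * (w + s + ep * v) + 2 * a0 + 2 * gam * D.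
Proof.
move=> d0 g0 g1 ds e0 l0 eE hs hv hX hw w_ge0 a0_ge0 D_ge0 s_ge0 v_ge0 s'_ge0.
have epl : 8 * (ep * l) <= gam by nra.
have de : 6 * delta <= ep by nra.
have dg : 6 * delta <= gam / 32 by nra.
have B_ge0 : 0 <= D + 2 * w + 2 * a0 by lra.
set B := D + 2 * w + 2 * a0 in B_ge0 hs hv.
have elB : ep * (l * B) <= gam / 8 * B by nra.
have dlB : 6 * delta * (l * B) <= ep * (l * B).
  by rewrite ler_wpM2r// mulr_ge0.
have dv : 6 * delta * v <= gam / 2 * (ep * v) by nra.
have ds' : 6 * delta * s <= gam / 32 * s by nra.
have hs2 : 2 * s' <= gam / 2 * (ep * v) + gam / 32 * s + gam / 8 * B by lra.
have evB : ep * v' <= gam / 8 * B by apply: le_trans elB; rewrite ler_wpM2l// ltW.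
have ev0 : 0 <= ep * v by rewrite mulr_ge0// ltW.
have g0' : 0 <= gam * B by rewrite mulr_ge0// ltW.
have half y : 0 <= y -> 0 <= gam * y /\ gam * y <= y / 2.
  by move=> y0; split; [rewrite mulr_ge0// ltW|nra].
have [gw gw'] := half _ w_ge0; have [gs gs'] := half _ s_ge0.
have [gv gv'] := half _ ev0; have [ga ga'] := half _ a0_ge0.
have [gD gD'] := half _ D_ge0.
have dw : delta * (2 * w + 2 * s') <= gam / 96 * w + s' by nra.
by rewrite /B in hs2 evB *; split; lra.
Qed.

(** * Consensus errors in one inner step *)

Section Step.
Context {R : realType} {m n d : nat}.
Context (f : 'I_m -> 'I_n -> 'rV[R]_d -> R) (psi : 'rV[R]_d -> \bar R).
Context (W : 'M[R]_m) (lam2 : R) (b : nat) (eta : R) (M : nat).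
Context (L l1 l2 sf sp delta gam : R).
Hypothesis H : setting f psi W lam2 b eta M L l1 l2 sf sp delta gam.
Context (mu w0 : 'M[R]_(m, d)).

Local Notation mix := (fastmix W lam2 M).
Local Notation batch := {ffun 'I_m * 'I_b -> 'I_n}.
Local Notation istate := (@inner_state R m d).
Local Notation Lam := (Lam eta l2).
Local Notation eps0 := (eps0 eta l2 gam).
Implicit Types (st : istate) (x : batch).

Definition istep (x : batch) (st : istate) : istate :=
  inner_step f psi W lam2 eta M mu w0 (fun i l => x (i, l)) st.

Definition objr (x : 'rV[R]_d) : R := f_global f x + fine (psi x).

Definition sqd st : R := nsq (mean (in_w st) - mean w0).

Definition cerr st : R := nvar (in_w st) + eta ^+ 2 * nvar (in_s st)
  + eps0 * (eta ^+ 2 * msq (in_v st - mu)).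

Let g st i j := grad (f i j) (row i (in_w st)) - grad (f i j) (row i w0).

Lemma eta2_ge0 : 0 <= eta ^+ 2. Proof. exact: sqr_ge0. Qed.

Lemma Lam2_gt0 : 0 < 1 + Lam ^+ 2.
Proof. by rewrite ltr_wpDr ?sqr_ge0. Qed.

Lemma eps0_gt0 : 0 < eps0.
Proof. by rewrite divr_gt0 ?mulr_gt0 ?Lam2_gt0 ?(set_gam0 H). Qed.

Lemma istep_v x st : in_v (istep x st) = mu + batch_grad (g st) x.
Proof. by apply/row_matrixP => i; rewrite [RHS]linearD /= !rowK. Qed.

Lemma istep_s x st : in_s (istep x st) = mix (in_s st + in_v (istep x st) - in_v st).
Proof. by []. Qed.

Lemma istep_w x st : in_w (istep x st) =
  mix (prox (m%:R * eta) (Psi psi) (in_w st - eta *: in_s (istep x st))).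
Proof. by []. Qed.

(** Gradient tracking: mixing preserves averages, so the average of [in_s] follows that of the
    estimator. *)
Lemma istep_mean x st : mean (in_s st) = mean (in_v st) ->
  mean (in_s (istep x st)) = mean (in_v (istep x st)).
Proof. by move=> e; rewrite istep_s (set_mean H) meanB meanD e addrAC subrr add0r. Qed.

Lemma sqd_msq st : msq (in_w st - w0) <= sqd st + 2 * nvar (in_w st) + 2 * nvar w0.
Proof.
rewrite msq_mean ?(set_m H)// meanB -addrA lerD2l; exact: nvarB_le.
Qed.

Lemma istep_v_msq x st :
  msq (in_v (istep x st) - mu) <= l2 ^+ 2 * (sqd st + 2 * nvar (in_w st) + 2 * nvar w0).
Proof.
apply: le_trans (ler_wpM2l (sqr_ge0 l2) (sqd_msq st)).
rewrite istep_v addrC addKr !msq_row mulrCA ler_wpM2l ?minv_ge0// mulr_sumr.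
apply: ler_sum => i _; rewrite rowK linearB /=.
apply: le_trans (nsq_avg_ord_le _) _.
rewrite ler_pdivrMl ?ltr0n ?(set_b H)//.
have -> : b%:R * (l2 ^+ 2 * nsq (row i (in_w st) - row i w0)) =
    \sum_(l < b) l2 ^+ 2 * nsq (row i (in_w st) - row i w0).
  by rewrite sumr_const card_ord mulr_natl.
apply: ler_sum => l _.
exact: (component_lipschitz (set_l1 H) (set_l12 H) (set_l12smooth H)).
Qed.

Lemma istep_s_nvar x st :
  eta ^+ 2 * nvar (in_s (istep x st)) <= 3 * delta *
   (eta ^+ 2 * nvar (in_s st) + eta ^+ 2 * msq (in_v st - mu) +
    Lam ^+ 2 * (sqd st + 2 * nvar (in_w st) + 2 * nvar w0)).
Proof.
have key : nvar (in_s (istep x st)) <= delta * (3 * (nvar (in_s st) +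
    msq (in_v st - mu) + l2 ^+ 2 * (sqd st + 2 * nvar (in_w st) + 2 * nvar w0))).
  rewrite istep_s; apply: le_trans (set_nvar H _) _.
  rewrite ler_wpM2l ?(set_delta H)//.
  have -> : in_s st + in_v (istep x st) - in_v st =
     in_s st + (in_v (istep x st) - mu) + - (in_v st - mu).
    by apply/matrixP => i j; rewrite !mxE; ring.
  apply: le_trans (nvarD3_le _ _ _) _; rewrite ler_wpM2l// nvarN.
  have h1 := nvar_le_msq (set_m H) (in_v (istep x st) - mu).
  have h2 := nvar_le_msq (set_m H) (in_v st - mu).
  have h3 := istep_v_msq x st; lra.
apply: le_trans (ler_wpM2l eta2_ge0 key) _.
by rewrite le_eqVlt; apply/orP; left; apply/eqP; rewrite /Lam; ring.
Qed.

Lemma prox_argmin (X : 'M[R]_(m, d)) i :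
  is_argmin (prox_obj eta psi (row i X)) (row i (prox (m%:R * eta) (Psi psi) X)).
Proof.
exact (prox_rows (eta := eta) (set_proper H) (set_m H)
  (fun v : 'rV[R]_d => set_prox H v (set_eta H)) X i).
Qed.

(** Each row is compared with the prox of the average row by nonexpansiveness; the variance is at
    most the mean square around any point. *)
Lemma prox_nvar (X : 'M[R]_(m, d)) :
  nvar (prox (m%:R * eta) (Psi psi) X) <= nvar X.
Proof.
have [z Hz] := set_prox H (mean X) (set_eta H).
apply: le_trans (nvar_le_msqB (set_m H) _ z) _.
rewrite /nvar !msq_row ler_wpM2l ?minv_ge0//; apply: ler_sum => i _.
rewrite !linearB /= !row_bcast.
exact: (argmin_nonexpansive (set_sp H) (set_pcvx H) (set_proper H) (set_eta H)
  (prox_argmin X i) Hz).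
Qed.

(** The second bound concerns the argument of the prox, whose disagreement enters the descent
    inequality. *)
Lemma istep_consensus x st :
  cerr (istep x st) <= gam * (cerr st + nvar w0 + sqd st) /\
  nvar (in_w st - eta *: in_s (istep x st)) <=
    4 * cerr st + 2 * nvar w0 + 2 * gam * sqd st.
Proof.
have hs := istep_s_nvar x st; have hv := istep_v_msq x st.
have hX : nvar (in_w st - eta *: in_s (istep x st)) <=
    2 * nvar (in_w st) + 2 * (eta ^+ 2 * nvar (in_s (istep x st))).
  by have := nvarB_le (in_w st) (eta *: in_s (istep x st)); rewrite nvarZ.
have hw : nvar (in_w (istep x st)) <=
    delta * (2 * nvar (in_w st) + 2 * (eta ^+ 2 * nvar (in_s (istep x st)))).
  rewrite istep_w; apply: le_trans (set_nvar H _) _.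
  rewrite ler_wpM2l ?(set_delta H)//; apply: le_trans (prox_nvar _) hX.
have {}hv : eta ^+ 2 * msq (in_v (istep x st) - mu) <=
    Lam ^+ 2 * (sqd st + 2 * nvar (in_w st) + 2 * nvar w0).
  by rewrite /Lam exprMn -[leRHS]mulrA ler_wpM2l ?eta2_ge0.
have a_ge0 : 0 <= nvar (in_w st) by exact: nvar_ge0.
have a0_ge0 : 0 <= nvar w0 by exact: nvar_ge0.
have D_ge0 : 0 <= sqd st by exact: nsq_ge0.
have S_ge0 : 0 <= eta ^+ 2 * nvar (in_s st) by rewrite mulr_ge0 ?eta2_ge0 ?nvar_ge0.
have G_ge0 : 0 <= eta ^+ 2 * msq (in_v st - mu) by rewrite mulr_ge0 ?eta2_ge0 ?msq_ge0.
have s'_ge0 : 0 <= eta ^+ 2 * nvar (in_s (istep x st)).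
  by rewrite mulr_ge0 ?eta2_ge0 ?nvar_ge0.
have d0 := set_delta H; have g0 := set_gam0 H; have g1 := set_gam H.
have ds := set_delta_small H; have e0 := eps0_gt0; have L0 := sqr_ge0 Lam.
have eE : eps0 * (8 * (1 + Lam ^+ 2)) = gam.
  by rewrite divfK// mulf_neq0 ?gt_eqF ?Lam2_gt0.
rewrite /cerr.
move: (nvar (in_w (istep x st))) (eta ^+ 2 * nvar (in_s (istep x st)))
  (eta ^+ 2 * msq (in_v (istep x st) - mu)) (nvar (in_w st))
  (eta ^+ 2 * nvar (in_s st)) (eta ^+ 2 * msq (in_v st - mu)) (sqd st) (nvar w0)
  (nvar (in_w st - eta *: in_s (istep x st)))
  hs hv hX hw a_ge0 a0_ge0 D_ge0 S_ge0 G_ge0 s'_ge0.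
move: eps0 (Lam ^+ 2) ds e0 L0 eE => ep l ds e0 l0 eE.
move=> w' s' v' w s v D a0 X hs hv hX hw w_ge0 a0_ge0 D_ge0 s_ge0 v_ge0 s'_ge0.
exact: consensus_step_arith d0 g0 g1 ds e0 l0 eE hs hv hX hw w_ge0 a0_ge0 D_ge0 s_ge0
  v_ge0 s'_ge0.
Qed.

End Step.

(** For the current average [w], the next one [p] and a comparison point [u]: [x = u - w],
    [r = p - w], [gr] is the gradient at [w], [e] the drift caused by disagreement, [z] the noise,
    [V] the consensus error of the prox argument. Of [dot z (x - r)], the part with [x] averages to
    zero later and is kept; the part with [r] costs [eta * nsq z] and half of the available [nsq r],
    whose other half absorbs the smoothness term. Strong convexity absorbs [e]. *)
Lemma descent_algebra {R : realType} {d : nat} (eta L sf sp V fu fw fp pu pp : R)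
    (x r gr e z : 'rV[R]_d) :
  0 < eta -> 4 * eta * L + 2 * eta * sf <= 1 -> 0 <= sf -> 0 <= sp ->
  0 < sf + sp ->
  pp <= pu + (2 * eta)^-1 * (nsq (x + eta *: (gr + e + z)) + V
     - nsq (r + eta *: (gr + e + z))) - ((2 * eta)^-1 + sp / 2) * nsq (x - r) ->
  fp <= fw + dot gr r + L * nsq r ->
  fw + dot gr x + sf / 2 * nsq x <= fu ->
  fp + pp + ((2 * eta)^-1 + (sf + sp) / 8) * nsq (x - r) <=
  fu + pu + (2 * eta)^-1 * nsq x + dot z x + eta * nsq z
    + 2 / (sf + sp) * nsq e + (2 * eta)^-1 * V.
Proof.
move=> eta0 etaL sf0 sp0 s0; set c := (2 * eta)^-1.
have ce : c * eta = 1 / 2 by rewrite /c; field; lra.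
have c0 : 0 < c by rewrite invr_gt0 mulr_gt0.
have -> : nsq (x + eta *: (gr + e + z)) + V - nsq (r + eta *: (gr + e + z)) =
   nsq x - nsq r + 2 * eta * dot (gr + e + z) (x - r) + V.
  move: (gr + e + z) => s.
  by rewrite /nsq !dotE (dotC s x) (dotC s r); ring.
have -> : c * (nsq x - nsq r + 2 * eta * dot (gr + e + z) (x - r) + V) =
  c * (nsq x - nsq r + V) + dot (gr + e + z) (x - r).
  rewrite mulrDr mulrDr addrAC -mulrDr; congr (_ + _).
  by rewrite mulrA mulrCA ce; field.
have e2 : 0 < 2 * eta by lra.
have s4 : 0 < (sf + sp) / 4 by lra.
have yz := dot_young z (- r) e2; have ye := dot_young (x - r) e s4.
have yr := nsqD_le (x - r) r; rewrite subrK in yr.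
have Lc : L + sf / 2 <= c / 2.
  have := ler_wpM2l (ltW c0) etaL.
  have -> : c * (4 * eta * L + 2 * eta * sf) = (c * eta) * (4 * L + 2 * sf) by ring.
  by rewrite ce; lra.
have nr := nsq_ge0 r; have nx := nsq_ge0 x; have nxr := nsq_ge0 (x - r).
have Lr : (L + sf / 2) * nsq r <= c / 2 * nsq r by rewrite ler_wpM2r.
have sx : sf / 4 * nsq (x - r) <= sf / 2 * nsq x + sf / 2 * nsq r.
  have : nsq (x - r) <= 2 * nsq x + 2 * nsq r by rewrite nsqB_le.
  by nra.
move: yz ye; rewrite nsqN.
have -> : (2 * (2 * eta))^-1 = c / 2 by rewrite /c; field; lra.
have -> : (2 * ((sf + sp) / 4))^-1 = 2 / (sf + sp) by field; lra.
have -> : 2 * eta / 2 = eta by field.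
rewrite (dotC _ e); move: nxr sx.
rewrite !(dotDl, dotDr, dotNl, dotNr) (dotC z x).
move: (nsq (x - r)) (2 / (sf + sp) * nsq e) => N E N0 sx yz ye hp hf hg.
have spN : 0 <= sp * N by rewrite mulr_ge0.
have sfN : 0 <= sf * N by rewrite mulr_ge0.
lra.
Qed.

(** * Expected descent of the averaged iterate in one inner step *)

Section StepDescent.
Context {R : realType} {m n d : nat}.
Context (f : 'I_m -> 'I_n -> 'rV[R]_d -> R) (psi : 'rV[R]_d -> \bar R).
Context (W : 'M[R]_m) (lam2 : R) (b : nat) (eta : R) (M : nat).
Context (L l1 l2 sf sp delta gam : R).
Hypothesis H : setting f psi W lam2 b eta M L l1 l2 sf sp delta gam.
Context (mu w0 : 'M[R]_(m, d)).
Hypothesis mean_mu : mean mu = mean (grads f w0).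

Local Notation batch := {ffun 'I_m * 'I_b -> 'I_n}.
Local Notation istate := (@inner_state R m d).
Local Notation Lam := (Lam eta l2).
Local Notation istep := (istep f psi W lam2 eta M mu w0).
Local Notation objr := (objr f psi).
Local Notation sqd := (sqd w0).
Local Notation cerr := (cerr eta l2 gam mu).
Implicit Types (st : istate) (x : batch).

Let g st i j := grad (f i j) (row i (in_w st)) - grad (f i j) (row i w0).

Definition noise st x := mean (batch_grad (g st) x) - mean (full_grad (g st)).

Lemma mean_full_grad st :
  mean (full_grad (g st)) = mean (grads f (in_w st)) - mean (grads f w0).
Proof.
rewrite -meanB; congr mean; apply/row_matrixP => i.
rewrite rowK linearB /= !rowK !grad_local; try exact: (set_diff H).
by rewrite -scalerBr -sumrB.
Qed.

Lemma istep_mean_s x st : mean (in_s st) = mean (in_v st) ->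
  mean (in_s (istep x st)) = mean (grads f (in_w st)) + noise st x.
Proof.
move=> e; rewrite (istep_mean H _ _ _ e) istep_v meanD mean_mu /noise mean_full_grad.
by rewrite [RHS]addrC opprB addrA subrK addrC.
Qed.

Lemma istep_mean_w x st : mean (in_w (istep x st)) =
  mean (prox (m%:R * eta) (Psi psi) (in_w st - eta *: in_s (istep x st))).
Proof. by rewrite istep_w (set_mean H). Qed.

Lemma prox_dom (X : 'M[R]_(m, d)) i :
  psi (row i (prox (m%:R * eta) (Psi psi) X)) \is a fin_num.
Proof. exact: (argmin_dom (set_proper H) (prox_argmin H X i)). Qed.

Lemma istep_dom x st : psi (mean (in_w (istep x st))) \is a fin_num.
Proof.
rewrite istep_mean_w.
by case: (jensen_mean (set_sp H) (set_pcvx H) (set_proper H) (set_m H)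
  (prox_dom (in_w st - eta *: in_s (istep x st)))).
Qed.

(** Average of the row inequalities, followed by Jensen for [psi]. The mean squared distance of the
    rows to [u] is that of their average plus [nvar X], the price of disagreement. *)
Lemma prox_mean_variational (X : 'M[R]_(m, d)) (u : 'rV[R]_d) :
  psi u \is a fin_num ->
  let P := prox (m%:R * eta) (Psi psi) X in
  fine (psi (mean P)) <= fine (psi u)
    + (2 * eta)^-1 * (nsq (mean X - u) + nvar X - nsq (mean P - mean X))
    - ((2 * eta)^-1 + sp / 2) * nsq (u - mean P).
Proof.
move=> du /=; set P := prox _ _ _.
have [_ hJ] := jensen_mean (set_sp H) (set_pcvx H) (set_proper H) (set_m H) (prox_dom X).
rewrite -/P in hJ.
have m0 := set_m H; have eta0 := set_eta H.
have c0 : 0 < (2 * eta)^-1 by rewrite invr_gt0 mulr_gt0.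
have avgc (c : R) : m%:R^-1 * \sum_(i < m) c = c.
  by rewrite sumr_const card_ord -[c *+ m]mulr_natl mulKf// mR_neq0.
have : m%:R^-1 * \sum_i (fine (psi (row i P)) + (2 * eta)^-1 * nsq (row i P - row i X)
       + ((2 * eta)^-1 + sp / 2) * nsq (u - row i P)) <=
    m%:R^-1 * \sum_(i < m) (fine (psi u) + (2 * eta)^-1 * nsq (u - row i X)).
  rewrite ler_wpM2l ?minv_ge0//; apply: ler_sum => i _.
  exact: (argmin_variational (set_sp H) (set_pcvx H) (set_proper H) eta0 (prox_argmin H X i)).
rewrite !big_split /= !mulrDr avgc -!mulr_sumr.
rewrite (mulrCA _ (2 * eta)^-1) (mulrCA _ ((2 * eta)^-1 + _)) (mulrCA _ (2 * eta)^-1).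
have -> : m%:R^-1 * \sum_i nsq (row i P - row i X) = msq (P - X).
  by rewrite msq_row; congr (_ * _); apply: eq_bigr => i _; rewrite linearB.
have -> : m%:R^-1 * \sum_i nsq (u - row i P) = msq (P - bcast u).
  rewrite msq_row; congr (_ * _); apply: eq_bigr => i _.
  by rewrite linearB /= row_bcast nsqB.
have -> : m%:R^-1 * \sum_i nsq (u - row i X) = msq (X - bcast u).
  rewrite msq_row; congr (_ * _); apply: eq_bigr => i _.
  by rewrite linearB /= row_bcast nsqB.
rewrite (msq_split m0 X) => h.
have h1 := nsq_mean_le m0 (P - X); rewrite meanB in h1.
have h2 : nsq (u - mean P) <= msq (P - bcast u).
  by rewrite msq_split// nsqB lerDl nvar_ge0.
have h1' := ler_wpM2l (ltW c0) h1.
have h2' : ((2 * eta)^-1 + sp / 2) * nsq (u - mean P) <=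
    ((2 * eta)^-1 + sp / 2) * msq (P - bcast u).
  by rewrite ler_wpM2l// addr_ge0 ?(ltW c0)// divr_ge0// (set_sp H).
lra.
Qed.

Lemma convex_global : strongly_convex 0 (EFin \o f_global f).
Proof. exact: strongly_convexW (set_sf H) (set_fcvx H). Qed.

Lemma grad_drift (X : 'M[R]_(m, d)) :
  nsq (mean (grads f X) - grad (f_global f) (mean X)) <= l2 ^+ 2 * nvar X.
Proof.
rewrite -(mean_grads_bcast (set_diff H)) -meanB.
apply: le_trans (nsq_mean_le (set_m H) _) _.
exact: (msq_grads (set_n H) (set_diff H) (set_l1 H) (set_l12 H) (set_l12smooth H)).
Qed.

Lemma istep_descent x st u : mean (in_s st) = mean (in_v st) ->
  psi u \is a fin_num ->
  objr (mean (in_w (istep x st)))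
    + ((2 * eta)^-1 + (sf + sp) / 8) * nsq (u - mean (in_w (istep x st))) <=
  objr u + (2 * eta)^-1 * nsq (u - mean (in_w st))
    + dot (noise st x) (u - mean (in_w st)) + eta * nsq (noise st x)
    + 2 / (sf + sp) * (l2 ^+ 2 * nvar (in_w st))
    + (2 * eta)^-1 * nvar (in_w st - eta *: in_s (istep x st)).
Proof.
move=> es du.
have := prox_mean_variational (in_w st - eta *: in_s (istep x st)) du.
rewrite /= -istep_mean_w meanB meanZ (istep_mean_s _ es).
set p := mean (in_w (istep x st)); set w := mean (in_w st).
set V := nvar _; set z := noise st x.
pose gr := grad (f_global f) w; pose e := mean (grads f (in_w st)) - gr.
have -> : mean (grads f (in_w st)) + z = gr + e + z by rewrite [gr + e]addrC subrK.
have -> : nsq (w - eta *: (gr + e + z) - u) = nsq ((u - w) + eta *: (gr + e + z)).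
  by rewrite nsqB; congr nsq; apply/rowP => j; rewrite !mxE; ring.
have -> : p - (w - eta *: (gr + e + z)) = (p - w) + eta *: (gr + e + z).
  by apply/rowP => j; rewrite !mxE; ring.
have up : u - p = (u - w) - (p - w) by apply/rowP => j; rewrite !mxE; ring.
rewrite up => hp.
have dw v := differentiable_global (set_diff H) v.
have hf := lsmooth_upper w convex_global (set_lsmooth H) (dw p).
have hg := strongly_convex_grad u (set_fcvx H) (dw w).
have := descent_algebra (set_eta H) (set_etaL H) (set_sf H) (set_sp H) (set_s H) hp hf hg.
have he : 2 / (sf + sp) * nsq e <= 2 / (sf + sp) * (l2 ^+ 2 * nvar (in_w st)).
  by rewrite ler_wpM2l ?grad_drift// divr_ge0// ltW// (set_s H).
by rewrite /objr; move: he; lra.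
Qed.

(** [avg_cocoercive] needs one pair of points common to all agents, so the gradients are compared at
    the averages [w] and [u]; the correction costs [l2 ^+ 2] times consensus errors. *)
Lemma noise_sq st : avg (fun x => nsq (noise st x)) <=
  b%:R^-1 * (2 * (l1 * l2) * sqd st + 4 * l2 ^+ 2 * (nvar (in_w st) + nvar w0)).
Proof.
apply: le_trans (avg_batch_sq (g st) (set_m H) (set_n H) (set_b H)) _.
rewrite ler_wpM2l ?minv_ge0//.
set w := mean (in_w st); set u := mean w0.
have arith (X Y Z A B : R) : X <= A -> Y <= B -> Z <= 2 * X + 2 * Y ->
    2 * Z <= 4 * (A + B) by lra.
have pt i j : nsq (g st i j) <= 2 * nsq (grad (f i j) w - grad (f i j) u)
   + 4 * l2 ^+ 2 * (nsq (row i (in_w st) - w) + nsq (row i w0 - u)).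
  have lip := component_lipschitz (set_l1 H) (set_l12 H) (set_l12smooth H) i j.
  have h1 := lip (row i (in_w st)) w; have h2 := lip (row i w0) u.
  have -> : g st i j = (grad (f i j) w - grad (f i j) u) +
     ((grad (f i j) (row i (in_w st)) - grad (f i j) w) -
      (grad (f i j) (row i w0) - grad (f i j) u)).
    by rewrite /g; apply/rowP => k; rewrite !mxE; ring.
  apply: le_trans (nsqD_le _ _) _.
  have := nsqB_le (grad (f i j) (row i (in_w st)) - grad (f i j) w)
     (grad (f i j) (row i w0) - grad (f i j) u).
  by move=> h3; rewrite lerD2l -[leRHS]mulrA mulrDr; exact: arith h1 h2 h3.
have avgc (k : nat) (c : R) : (0 < k)%N -> k%:R^-1 * (c *+ k) = c.
  by move=> k0; rewrite -[c *+ k]mulr_natl mulKf// pnatr_eq0 -lt0n.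
apply: le_trans (_ : _ <= m%:R^-1 * \sum_i (n%:R^-1 * \sum_j
   (2 * nsq (grad (f i j) w - grad (f i j) u)
   + 4 * l2 ^+ 2 * (nsq (row i (in_w st) - w) + nsq (row i w0 - u))))) _.
  rewrite ler_wpM2l ?minv_ge0//; apply: ler_sum => i _.
  by rewrite ler_wpM2l ?minv_ge0//; apply: ler_sum.
have hC := avg_cocoercive (set_m H) (set_n H) (set_diff H) convex_global (set_l1 H)
  (set_l12 H) (set_l12smooth H) w u.
rewrite (eq_bigr (fun i => 2 * (n%:R^-1 * \sum_j nsq (grad (f i j) w - grad (f i j) u))
   + (4 * l2 ^+ 2 * nsq (row i (in_w st) - w) + 4 * l2 ^+ 2 * nsq (row i w0 - u)))); last first.
  move=> i _; rewrite big_split /= sumr_const card_ord mulrDr avgc ?(set_n H)//.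
  by rewrite -mulr_sumr; ring.
rewrite !big_split /= -!mulr_sumr !mulrDr (mulrCA _ 2) !(mulrCA _ (4 * _)).
have nvE (X : 'M[R]_(m, d)) : m%:R^-1 * \sum_i nsq (row i X - mean X) = nvar X.
  rewrite /nvar msq_row; congr (_ * _); apply: eq_bigr => i _.
  by rewrite linearB /= row_bcast.
by rewrite -mulr_sumr in hC; rewrite !nvE /sqd -/w -/u; lra.
Qed.

(** [c1] and [c2] are the coefficients of the squared distance from the epoch start and of the
    consensus errors in [avg_descent]. *)
Definition c1 : R := 2 * eta * (l1 * l2) / b%:R + gam / eta.
Definition c2 : R := (2 * Lam ^+ 2 / (eta * (sf + sp)) + 4 * Lam ^+ 2 + 2) / eta.

Lemma avg_descent st u : mean (in_s st) = mean (in_v st) ->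
  psi u \is a fin_num ->
  avg (fun x => objr (mean (in_w (istep x st)))
    + ((2 * eta)^-1 + (sf + sp) / 8) * nsq (u - mean (in_w (istep x st)))) <=
  objr u + (2 * eta)^-1 * nsq (u - mean (in_w st))
    + c1 * sqd st + c2 * (cerr st + nvar w0).
Proof.
move=> es du.
have eta0 := set_eta H; have s0 := set_s H.
have card_b : (0 < #|{: batch}|)%N by exact: card_batch (set_n H).
pose K := objr u + (2 * eta)^-1 * nsq (u - mean (in_w st))
  + 2 / (sf + sp) * (l2 ^+ 2 * nvar (in_w st))
  + (2 * eta)^-1 * (4 * cerr st + 2 * nvar w0 + 2 * gam * sqd st).
apply: le_trans (_ : _ <= avg (fun x => K +
    (dot (noise st x) (u - mean (in_w st)) + eta * nsq (noise st x)))) _.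
  apply: ler_avg => x; apply: le_trans (istep_descent x es du) _.
  have [_ hV] := istep_consensus H mu w0 x st.
  have c0 : 0 <= (2 * eta)^-1 by rewrite invr_ge0 mulr_ge0// ltW.
  by have := ler_wpM2l c0 hV; rewrite /K; lra.
rewrite avgD avg_cst// avgD avgZ /noise avg_batch_dot ?(set_m H) ?(set_n H) ?(set_b H)//.
rewrite add0r.
have := noise_sq st; rewrite /noise; set N := avg _ => hN.
have a0 : 0 <= nvar (in_w st) by exact: nvar_ge0.
have a00 : 0 <= nvar w0 by exact: nvar_ge0.
have az : nvar (in_w st) <= cerr st.
  rewrite /cerr -addrA lerDl; apply: addr_ge0.
    exact: mulr_ge0 (eta2_ge0 _) (nvar_ge0 _).
  exact: mulr_ge0 (ltW (eps0_gt0 H)) (mulr_ge0 (eta2_ge0 _) (msq_ge0 _)).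
have b1 : b%:R^-1 <= 1 :> R by rewrite invf_le1 ?ltr0n ?(set_b H)// ler1n (set_b H).
have b0 : 0 <= b%:R^-1 :> R by rewrite invr_ge0.
have l20 : 0 <= l2 by have := set_l1 H; have := set_l12 H; lra.
have hN2 : eta * N <= 2 * eta * (l1 * l2) / b%:R * sqd st
    + eta * (4 * l2 ^+ 2 * (nvar (in_w st) + nvar w0)).
  apply: le_trans (ler_wpM2l (ltW eta0) hN) _.
  rewrite [leLHS](_ : _ = 2 * eta * (l1 * l2) / b%:R * sqd st +
    b%:R^-1 * (eta * (4 * l2 ^+ 2 * (nvar (in_w st) + nvar w0)))); last by ring.
  rewrite lerD2l ler_piMl//; apply: mulr_ge0 (ltW eta0) _.
  by apply: mulr_ge0 (mulr_ge0 _ (sqr_ge0 _)) (addr_ge0 a0 a00).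
have E1 : 2 / (sf + sp) * (l2 ^+ 2 * nvar (in_w st)) =
   2 * Lam ^+ 2 / (eta * (sf + sp)) / eta * nvar (in_w st).
  by rewrite /Lam; field; rewrite !gt_eqF.
have E2 : eta * (4 * l2 ^+ 2 * (nvar (in_w st) + nvar w0)) =
   4 * Lam ^+ 2 / eta * (nvar (in_w st) + nvar w0).
  by rewrite /Lam; field; rewrite gt_eqF.
have E3 : (2 * eta)^-1 * (4 * cerr st + 2 * nvar w0 + 2 * gam * sqd st) =
   2 / eta * cerr st + 1 / eta * nvar w0 + gam / eta * sqd st.
  by field; rewrite gt_eqF.
rewrite /K /c1 /c2 E3 E1; rewrite E2 in hN2.
have -> : (2 * Lam ^+ 2 / (eta * (sf + sp)) + 4 * Lam ^+ 2 + 2) / eta =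
  2 * Lam ^+ 2 / (eta * (sf + sp)) / eta + 4 * Lam ^+ 2 / eta + 2 / eta.
  by rewrite !mulrDl.
have k1 : 0 <= 2 * Lam ^+ 2 / (eta * (sf + sp)) / eta.
  by rewrite !(mulr_ge0, invr_ge0) ?sqr_ge0// ltW.
have k2 : 0 <= 4 * Lam ^+ 2 / eta by rewrite !(mulr_ge0, invr_ge0) ?sqr_ge0// ltW.
have k3 : 1 / eta = 2 / eta / 2 by field; rewrite gt_eqF.
have k4 : 0 <= 2 / eta by rewrite divr_ge0// ltW.
rewrite k3; move: hN2 k1 k2 k4.
move: (_ / (eta * (sf + sp)) / eta) (4 * Lam ^+ 2 / eta) (2 / eta) => A B C hN2 k1 k2 k4.
have h1 := ler_wpM2l k1 az; have h2 := ler_wpM2l k2 az.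
have h3 : 0 <= A * nvar w0 by rewrite mulr_ge0.
have h4 : 0 <= C * nvar w0 by rewrite mulr_ge0.
lra.
Qed.

End StepDescent.

(** * Truncated geometric sums *)

Section GeometricSums.
Context {R : realType} (p : R).
Hypotheses (p_gt0 : 0 < p) (p_le1 : p <= 1).
Implicit Types (g : nat -> R) (N : nat).

Let q := 1 - p.
Let q_ge0 : 0 <= q. Proof. by rewrite subr_ge0. Qed.

(** For geometric [T], [E[g T - g (T + 1)] = p (g 0 - E[g (T + 1)])]: a decrease per step becomes a
    comparison of the start and the end of the epoch. Truncation adds the last term. *)
Lemma geom_telescope g N :
  \sum_(t < N) q ^+ t * p * (g t - g t.+1) =
  p * g 0 - p * (\sum_(t < N) q ^+ t * p * g t.+1) - p * q ^+ N * g N.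
Proof.
elim: N => [|N IH]; first by rewrite !big_ord0; ring.
rewrite !big_ord_recr /= IH exprSr /q; ring.
Qed.

Lemma geom_mass N : \sum_(t < N) q ^+ t * p = 1 - q ^+ N.
Proof.
elim: N => [|N IH]; first by rewrite big_ord0; ring.
by rewrite big_ord_recr /= IH exprSr /q; ring.
Qed.

Lemma geom_shift g N : (forall t, 0 <= g t) ->
  \sum_(t < N) q ^+ t * p * g t <= p * g 0 + \sum_(t < N) q ^+ t * p * g t.+1.
Proof.
move=> g0; rewrite -lerBlDr -sumrB.
under eq_bigr do rewrite -mulrBr.
rewrite geom_telescope.
have h1 : 0 <= p * \sum_(t < N) q ^+ t * p * g t.+1.
  apply: mulr_ge0; first exact: ltW.
  by apply: sumr_ge0 => t _; rewrite !mulr_ge0 ?exprn_ge0// ltW.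
have h2 : 0 <= p * q ^+ N * g N by rewrite !mulr_ge0 ?exprn_ge0// ltW.
lra.
Qed.

(** [E[T + 1] = 1 / p], from the telescoping identity with [g t = t]. *)
Lemma geom_mean_le N : \sum_(t < N) q ^+ t * p * t.+1%:R <= p^-1.
Proof.
have := @geom_shift (fun t => t%:R) N (fun t => ler0n _ t).
rewrite mulr0 add0r => h.
have : p * \sum_(t < N) q ^+ t * p * t.+1%:R <= 1.
  have := geom_telescope (fun t => t%:R) N; rewrite mulr0 add0r.
  have -> : \sum_(t < N) q ^+ t * p * (t%:R - t.+1%:R) = - (1 - q ^+ N).
    rewrite -geom_mass -sumrN; apply: eq_bigr => t _.
    by rewrite -natr1; ring.
  move=> e; have : 0 <= p * q ^+ N * N%:R by rewrite !mulr_ge0 ?exprn_ge0// ltW.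
  have : 0 <= q ^+ N by rewrite exprn_ge0.
  lra.
by rewrite -ler_pdivlMl// mulr1.
Qed.

(** A nondecreasing sequence obeys at every index the bound it obeys in the limit, where the
    remainder has vanished. *)
Lemma geom_limit (s : nat -> R) (B K : R) : (forall N, s N <= s N.+1) ->
  (forall N, s N <= B + q ^+ N * K) -> forall N, s N <= B.
Proof.
move=> s_mono sB N; rewrite leNgt; apply/negP => h.
have mono k : s N <= s (N + k)%N.
  by elim: k => [|k IH]; rewrite ?addn0// addnS; apply: le_trans IH _.
have qK : (fun k => q ^+ k * K) @ \oo --> (0 : R).
  rewrite -(mul0r K); apply: cvgMl; apply: cvg_expr.
  by rewrite ger0_norm ?q_ge0// ltrBlDr ltrDl.
have : \forall k \near \oo, q ^+ k * K < s N - B.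
  by apply: cvgr_lt qK _ _; rewrite subr_gt0.
case=> k0 _ /(_ (N + k0)%N (leq_addl _ _)) /= hk.
by have := mono k0; have := sB (N + k0)%N; lra.
Qed.

End GeometricSums.

(** * A Markov chain stopped at a geometric time *)

Section Run.
Context {R : realType} {B : finType} {St : Type} (stp : B -> St -> St).
Context (p : R) (st0 : St) (Inv : St -> Prop).
Hypotheses (B_gt0 : (0 < #|B|)%N) (p_gt0 : 0 < p) (p_le1 : p <= 1).
Hypotheses (inv0 : Inv st0) (inv_stp : forall x st, Inv st -> Inv (stp x st)).
Implicit Types (h : St -> R) (st : St) (N t : nat).

(** [avg_step] is the transition operator on functions, so [run t h st] is the expectation of [h]
    after [t] steps from [st]. *)
Definition avg_step h st : R := avg (fun x => h (stp x st)).
Definition run t h st : R := iter t avg_step h st.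

Lemma run_le h1 h2 t st : Inv st -> (forall st, Inv st -> h1 st <= h2 st) ->
  run t h1 st <= run t h2 st.
Proof.
move=> + h12; rewrite /run; elim: t st => [|t IH] st ist /=; first exact: h12.
by apply: ler_avg => x; apply: IH; exact: inv_stp.
Qed.

Lemma runD h1 h2 t st : run t (fun s => h1 s + h2 s) st = run t h1 st + run t h2 st.
Proof.
rewrite /run; elim: t st => [|t IH] st //=.
by rewrite {1}/avg_step; under eq_avg do rewrite IH; rewrite avgD.
Qed.

Lemma runZ c h t st : run t (fun s => c * h s) st = c * run t h st.
Proof.
rewrite /run; elim: t st => [|t IH] st //=.
by rewrite {1}/avg_step; under eq_avg do rewrite IH; rewrite avgZ.
Qed.

Lemma run_cst c t st : run t (fun _ => c) st = c.
Proof.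
rewrite /run; elim: t st => [|t IH] st //=.
by rewrite {1}/avg_step; under eq_avg do rewrite IH; rewrite avg_cst.
Qed.

Lemma runS t h st : run t.+1 h st = run t (avg_step h) st.
Proof. by rewrite /run iterSr. Qed.

Lemma run_ge0 h t st : Inv st -> (forall st, Inv st -> 0 <= h st) -> 0 <= run t h st.
Proof. by move=> ist h0; rewrite -(run_cst 0 t st); exact: run_le. Qed.

Let q := 1 - p.
Let w t := q ^+ t * p.
Let w_ge0 t : 0 <= w t.
Proof. by rewrite mulr_ge0 ?exprn_ge0 ?subr_ge0// ltW. Qed.

(* Truncated expectations of [h] after [T + 1], respectively [T], steps, for a
   geometric [T]. *)
Definition Sm N h : R := \sum_(t < N) q ^+ t * p * run t.+1 h st0.
Definition Tm N h : R := \sum_(t < N) q ^+ t * p * run t h st0.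

Lemma SmD N h1 h2 : Sm N (fun s => h1 s + h2 s) = Sm N h1 + Sm N h2.
Proof. by rewrite -big_split; apply: eq_bigr => t _; rewrite runD mulrDr. Qed.

Lemma SmZ N c h : Sm N (fun s => c * h s) = c * Sm N h.
Proof. by rewrite mulr_sumr; apply: eq_bigr => t _; rewrite runZ mulrCA. Qed.

Lemma Sm_cst N c : Sm N (fun _ => c) = (1 - q ^+ N) * c.
Proof.
rewrite -geom_mass mulr_suml; apply: eq_bigr => t _; by rewrite run_cst.
Qed.

Lemma TmD N h1 h2 : Tm N (fun s => h1 s + h2 s) = Tm N h1 + Tm N h2.
Proof. by rewrite -big_split; apply: eq_bigr => t _; rewrite runD mulrDr. Qed.

Lemma TmZ N c h : Tm N (fun s => c * h s) = c * Tm N h.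
Proof. by rewrite mulr_sumr; apply: eq_bigr => t _; rewrite runZ mulrCA. Qed.

Lemma Tm_cst N c : Tm N (fun _ => c) = (1 - q ^+ N) * c.
Proof.
rewrite -geom_mass mulr_suml; apply: eq_bigr => t _; by rewrite run_cst.
Qed.

(** Linearity in a fixed shape of four slots; callers fill the spare ones with coefficient [0]. *)
Lemma Sm_lin N K a1 a2 a3 a4 h1 h2 h3 h4 :
  Sm N (fun s => K + (a1 * h1 s + (a2 * h2 s + (a3 * h3 s + a4 * h4 s)))) =
  (1 - q ^+ N) * K + (a1 * Sm N h1 + (a2 * Sm N h2 + (a3 * Sm N h3 + a4 * Sm N h4))).
Proof. by rewrite !(SmD, SmZ) Sm_cst. Qed.

Lemma Tm_lin N K a1 a2 a3 h1 h2 h3 :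
  Tm N (fun s => K + (a1 * h1 s + (a2 * h2 s + a3 * h3 s))) =
  (1 - q ^+ N) * K + (a1 * Tm N h1 + (a2 * Tm N h2 + a3 * Tm N h3)).
Proof. by rewrite !(TmD, TmZ) Tm_cst. Qed.

Lemma eq_Sm N h1 h2 : h1 =1 h2 -> Sm N h1 = Sm N h2.
Proof. by move=> /funext ->. Qed.

Lemma Sm_le_Tm N h1 h2 : (forall st, Inv st -> avg_step h1 st <= h2 st) ->
  Sm N h1 <= Tm N h2.
Proof.
move=> h12; apply: ler_sum => t _; rewrite ler_wpM2l ?w_ge0// runS.
exact: run_le.
Qed.

Lemma Sm_le N h1 h2 : (forall st, Inv st -> h1 st <= h2 st) -> Sm N h1 <= Sm N h2.
Proof. by move=> h12; apply: ler_sum => t _; rewrite ler_wpM2l ?w_ge0//; exact: run_le. Qed.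

Lemma Sm_ge0 N h : (forall st, Inv st -> 0 <= h st) -> 0 <= Sm N h.
Proof. by move=> h0; apply: sumr_ge0 => t _; exact: mulr_ge0 (w_ge0 t) (run_ge0 _ inv0 h0). Qed.

Lemma Sm_mono N h : (forall st, Inv st -> 0 <= avg_step h st) ->
  Sm N h <= Sm N.+1 h.
Proof.
move=> h0; rewrite /Sm big_ord_recr lerDl; apply: mulr_ge0 (w_ge0 N) _.
by rewrite runS; exact: run_ge0.
Qed.

Lemma Tm_shift N h : (forall st, Inv st -> 0 <= h st) -> Tm N h <= p * h st0 + Sm N h.
Proof.
move=> h0; apply: (geom_shift p_gt0 p_le1 (g := fun t => run t h st0)) => t.
exact: run_ge0.
Qed.

Lemma Tm_telescope N h : (forall st, Inv st -> 0 <= h st) ->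
  Tm N h - Sm N h <= p * h st0 - p * Sm N h.
Proof.
move=> h0; rewrite -sumrB; under eq_bigr do rewrite -mulrBr.
rewrite (geom_telescope p (fun t => run t h st0)).
rewrite lerBlDr lerDl; apply: mulr_ge0 (run_ge0 _ inv0 h0).
by rewrite mulr_ge0 ?(ltW p_gt0) ?exprn_ge0 ?subr_ge0.
Qed.

End Run.

(** With [q - xs] written through [q' - xs], [xs - w] and [x - w], the two sides differ by a
    nonnegative multiple of [nsq (q' - w)]. *)
Lemma momentum_algebra {R : realType} {d : nat} (tau : R) (x w q xs q' : 'rV[R]_d) :
  0 < tau ->
  q' = (1 + tau / 2)^-1 *: (q + (tau / 2) *: w - (2 * tau)^-1 *: (x - w)) ->
  tau * dot (x - w) (q - xs) <= nsq (x - w) / 4 + tau ^+ 2 * nsq (q - xs)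
    + tau ^+ 3 / 2 * nsq (xs - w) - tau ^+ 2 * (1 + tau / 2) * nsq (q' - xs).
Proof.
move=> tau0 q'E.
have vE : q - xs = (1 + tau / 2) *: (q' - xs) + (tau / 2) *: (xs - w)
    + (2 * tau)^-1 *: (x - w).
  have : (1 + tau / 2) *: q' = q + (tau / 2) *: w - (2 * tau)^-1 *: (x - w).
    by rewrite q'E scalerA mulfV ?scale1r//; lra.
  move=> E; apply/rowP => j; have /rowP/(_ j) := E; rewrite !mxE => Ej.
  by rewrite mulrBr Ej; ring.
rewrite vE; move: (q' - xs) (xs - w) (x - w) => v u e {vE q'E}.
rewrite -subr_ge0.
set rhs := (X in 0 <= X).
have -> : rhs = 2 * tau ^+ 2 * (nsq ((- (tau / 2)) *: (v + u)) / 2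
    + tau / 4 * nsq (v + u)).
  rewrite /rhs /nsq !(dotDl, dotDr, dotNl, dotNr, dotZl, dotZr).
  rewrite (dotC u v) (dotC e v) (dotC e u).
  by field; lra.
apply: mulr_ge0; first by rewrite mulr_ge0 ?sqr_ge0.
by rewrite addr_ge0// ?mulr_ge0 ?nsq_ge0 ?invr_ge0//; lra.
Qed.

(** * Progress of the averages over one epoch *)

Section EpochMean.
Context {R : realType} {m n d : nat}.
Context (f : 'I_m -> 'I_n -> 'rV[R]_d -> R) (psi : 'rV[R]_d -> \bar R).
Context (W : 'M[R]_m) (lam2 : R) (b : nat) (eta : R) (M : nat).
Context (L l1 l2 sf sp delta gam : R).
Hypothesis H : setting f psi W lam2 b eta M L l1 l2 sf sp delta gam.
Context (mu w0 : 'M[R]_(m, d)) (sfo comm : nat).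
Hypothesis mean_mu : mean mu = mean (grads f w0).
Context (p tau : R) (ybar qbar xs : 'rV[R]_d).
Hypotheses (p_gt0 : 0 < p) (p_le1 : p <= 1) (tau_gt0 : 0 < tau) (tau_le1 : tau <= 1).
Hypothesis mean_w0 : mean w0 = tau *: qbar + (1 - tau) *: ybar.
Hypotheses (dom_y : psi ybar \is a fin_num) (dom_xs : psi xs \is a fin_num).

Local Notation batch := {ffun 'I_m * 'I_b -> 'I_n}.
Local Notation istate := (@inner_state R m d).
Local Notation istep := (istep (b := b) f psi W lam2 eta M mu w0).
Local Notation objr := (objr f psi).
Local Notation sqd := (sqd w0).
Local Notation cerr := (cerr eta l2 gam mu).
Local Notation sigma := (sf + sp).
Local Notation theta := (p / eta).
Local Notation c1 := (c1 b eta l1 l2 gam).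
Local Notation c2 := (c2 eta l2 sf sp).
Hypothesis tauE : tau ^+ 2 * theta = sigma / 4.
Hypothesis xs_min : forall x, psi x \is a fin_num -> objr xs <= objr x.

Definition ist0 : istate := InnerState w0 mu mu sfo comm.
Definition iInv (st : istate) : Prop := mean (in_s st) = mean (in_v st).

Local Notation Sm := (Sm istep p ist0).
Local Notation Tm := (Tm istep p ist0).

Definition qnext (w : 'rV[R]_d) : 'rV[R]_d :=
  (1 + tau / 2)^-1 *: (qbar + (tau / 2) *: w - (2 * tau)^-1 *: (mean w0 - w)).

Let Asq u (st : istate) := nsq (u - mean (in_w st)).
Let Bsq (st : istate) := (1 - tau) * Asq ybar st + tau * Asq xs st.
Let c := (2 * eta)^-1.
Let q := 1 - p.

Lemma iInv0 : iInv ist0. Proof. by []. Qed.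

Lemma iInv_step (x : batch) st : iInv st -> iInv (istep x st).
Proof. exact: istep_mean H _ _ _ _. Qed.

Lemma batch_gt0 : (0 < #|{: batch}|)%N.
Proof. by apply: card_batch; exact: set_n H. Qed.

Lemma sqd0 : sqd ist0 = 0.
Proof. by rewrite /sqd /= subrr nsq0. Qed.

Lemma cerr0 : cerr ist0 = nvar w0 + eta ^+ 2 * nvar mu.
Proof. by rewrite /cerr /= subrr /msq nsq0 !mulr0 addr0. Qed.

Lemma cerr_ge0 (st : istate) : 0 <= cerr st.
Proof.
rewrite /cerr; apply: addr_ge0.
  exact: addr_ge0 (nvar_ge0 _) (mulr_ge0 (eta2_ge0 _) (nvar_ge0 _)).
exact: mulr_ge0 (ltW (eps0_gt0 H)) (mulr_ge0 (eta2_ge0 _) (msq_ge0 _)).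
Qed.

Lemma sqd_ge0 (st : istate) : 0 <= sqd st.
Proof. exact: nsq_ge0. Qed.

Lemma Tm_sqd N : Tm N sqd <= Sm N sqd.
Proof.
have := Tm_shift batch_gt0 p_gt0 p_le1 iInv0 iInv_step N (fun st _ => sqd_ge0 st).
by rewrite sqd0 mulr0 add0r.
Qed.

Lemma Tm_cerr N : Tm N cerr <= cerr ist0 + Sm N cerr.
Proof.
have := Tm_shift batch_gt0 p_gt0 p_le1 iInv0 iInv_step N (fun st _ => cerr_ge0 st).
by move=> /le_trans; apply; rewrite lerD2r ler_piMl ?cerr_ge0.
Qed.

Lemma Sm_sqd_ge0 N : 0 <= Sm N sqd.
Proof.
exact: (Sm_ge0 batch_gt0 p_gt0 p_le1 iInv0 iInv_step N (fun st _ => sqd_ge0 st)).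
Qed.

Lemma mass_le1 N : 0 <= 1 - q ^+ N <= 1.
Proof.
have q0 : 0 <= q by rewrite subr_ge0.
by rewrite gerBl exprn_ge0// andbT subr_ge0 exprn_ile1// /q gerBl ltW.
Qed.

(** The one-step contraction summed over the epoch; the sum reappears on the right through [Tm] and
    is absorbed because [gam <= 1 / 2]. *)
Lemma Sm_cerr N : Sm N cerr <= 2 * gam * (2 * cerr ist0 + Sm N sqd).
Proof.
have h : Sm N cerr <= Tm N (fun st => gam * nvar w0 + (gam * cerr st + (gam * sqd st + 0 * sqd st))).
  apply: (Sm_le_Tm p_gt0 p_le1 iInv0 iInv_step) => st ist.
  rewrite -(avg_cst (gam * nvar w0 + _) batch_gt0).
  apply: ler_avg => x; have [+ _] := istep_consensus H mu w0 x st.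
  move: (cerr _) (cerr st) (sqd st) => A B C; lra.
rewrite (Tm_lin _ _ _ batch_gt0) in h.
have := Tm_sqd N; have := Tm_cerr N; have := mass_le1 N.
have Z0 := cerr_ge0 ist0.
have a0 : nvar w0 <= cerr ist0.
  by rewrite cerr0 lerDl; exact: mulr_ge0 (eta2_ge0 _) (nvar_ge0 _).
have a00 : 0 <= nvar w0 by exact: nvar_ge0.
have := Sm_sqd_ge0 N; have g0 := set_gam0 H; have g1 := set_gam H.
move: h Z0 a0 a00; rewrite -/q.
move: (Sm N cerr) (Tm N cerr) (Sm N sqd) (Tm N sqd) (cerr ist0) (nvar w0) (1 - q ^+ N).
move=> Z Z' D D' z a w h z0 az a0 D0 /andP[w0' w1] hZ hD.
have wa : w * a <= z by nra.
have {}h : Z <= gam * (Z' + (w * a + D')) by lra.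
have : gam * (Z' + (w * a + D')) <= gam * (2 * z + Z + D).
  by rewrite ler_wpM2l ?(ltW g0)//; lra.
have Zc : gam * Z <= Z / 2 \/ Z < 0 by case: (leP 0 Z) => Z0; [left; have := ler_wpM2l Z0 g1; lra|right].
have zD : 0 <= gam * (2 * z + D) by rewrite mulr_ge0 ?addr_ge0 ?mulr_ge0// ltW.
by case: Zc => Zc; lra.
Qed.

Lemma momentum_step (st : istate) :
  theta / 2 * (Bsq ist0 - Bsq st) <= - (theta / 4) * sqd st
    + sigma / 4 * nsq (qbar - xs) + tau * (sigma / 8) * Asq xs st
    - sigma / 4 * (1 + tau / 2) * nsq (qnext (mean (in_w st)) - xs).
Proof.
have th0 : 0 < theta by rewrite divr_gt0// (set_eta H).
(* Since [mean w0] combines [qbar] and [ybar], the telescoped distances reduce to the inner product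
   treated by [momentum_algebra]. *)
have -> : Bsq ist0 - Bsq st = - sqd st +
    2 * (tau * dot (mean w0 - mean (in_w st)) (qbar - xs)).
  rewrite /Bsq /Asq /sqd /= mean_w0; move: (mean (in_w st)) => w.
  rewrite /nsq !dotE.
  rewrite (dotC w ybar) (dotC w xs) (dotC w qbar) (dotC ybar qbar) (dotC xs qbar) (dotC xs ybar).
  ring.
have := momentum_algebra xs tau_gt0 (erefl (qnext (mean (in_w st)))).
move=> /(ler_wpM2l (ltW th0)).
have -> : sigma / 8 = tau ^+ 2 * theta / 2 by rewrite tauE; field.
rewrite -tauE nsqB -/(sqd st) -/(Asq xs st) => h.
move: h; set T := dot _ _; move: (nsq (qbar - xs)) (Asq xs st) (sqd st) (nsq _).
move: theta th0 => th th0 Q A D Q'; lra.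
Qed.

Lemma c2_ge0 : 0 <= c2.
Proof.
have L0 : 0 <= Lam eta l2 ^+ 2 by exact: sqr_ge0.
have L1 : 0 <= 2 * Lam eta l2 ^+ 2 / (eta * sigma).
  exact: divr_ge0 (mulr_ge0 (ler0n _ 2) L0) (mulr_ge0 (ltW (set_eta H)) (ltW (set_s H))).
by rewrite /c2 divr_ge0 ?(ltW (set_eta H))//; lra.
Qed.

(** The descent inequality is taken at [ybar] with weight [1 - tau] and at [xs] with weight [tau],
    then telescoped. By [tauE], the strong convexity gain at [xs] is exactly the [nsq (xs - w)] term
    lost in the momentum step. *)
Lemma epoch_mean N :
  Sm N (fun st => objr (mean (in_w st)) - objr xs
     + sigma / 4 * (1 + tau / 2) * nsq (qnext (mean (in_w st)) - xs)) <=
  (1 - tau) * (objr ybar - objr xs) + sigma / 4 * nsq (qbar - xs)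
    + (c1 - theta / 4) * Sm N sqd + c2 * (nvar w0 + Tm N cerr)
    + q ^+ N * (theta / 2 * Bsq ist0).
Proof.
have eta0 := set_eta H; have s0 := set_s H; have B0 := batch_gt0.
pose K0 := (1 - tau) * objr ybar + tau * objr xs + c2 * nvar w0.
have th0 : 0 < theta by rewrite divr_gt0// (set_eta H).
have cp : c * p = theta / 2 by rewrite /c; field; rewrite gt_eqF.
have c0 : 0 < c by rewrite invr_gt0 mulr_gt0.
have BN st : 0 <= Bsq st.
  by rewrite addr_ge0// mulr_ge0 ?nsq_ge0 ?subr_ge0// ltW.
have h : Sm N (fun st => 0 + (1 * objr (mean (in_w st)) +
      (c * Bsq st + (tau * (sigma / 8) * Asq xs st + 0 * sqd st)))) <=
    Tm N (fun st => K0 + (c * Bsq st + (c1 * sqd st + c2 * cerr st))).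
  apply: (Sm_le_Tm p_gt0 p_le1 iInv0 iInv_step) => st ist.
  have hy := avg_descent H mean_mu ist dom_y.
  have hx := avg_descent H mean_mu ist dom_xs.
  have t1 : 0 <= 1 - tau by rewrite subr_ge0.
  have := lerD (ler_wpM2l t1 hy) (ler_wpM2l (ltW tau_gt0) hx).
  rewrite -!avgZ -avgD => h1.
  apply: le_trans (_ : _ <= _) (le_trans h1 _).
    apply: ler_avg => x; rewrite /Bsq -/(Asq _ _).
    have : 0 <= (1 - tau) * (sigma / 8 * Asq ybar (istep x st)).
      by rewrite !mulr_ge0 ?nsq_ge0 ?divr_ge0// ltW.
    rewrite -/c /Asq; lra.
  rewrite /K0 /Bsq /Asq -/c; lra.
rewrite Sm_lin// Tm_lin// -/q in h.
have tel := Tm_telescope B0 p_gt0 p_le1 iInv0 iInv_step N (fun st _ => BN st).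
have mom : Sm N (fun st => 0 + (0 * sqd st + (0 * sqd st + (0 * sqd st + 0 * sqd st)))) <=
   Sm N (fun st => (sigma / 4 * nsq (qbar - xs) - theta / 2 * Bsq ist0) +
     (theta / 2 * Bsq st + (- (theta / 4) * sqd st + (tau * (sigma / 8) * Asq xs st
    + - (sigma / 4 * (1 + tau / 2)) * nsq (qnext (mean (in_w st)) - xs))))).
  apply: (Sm_le p_gt0 p_le1 iInv0 iInv_step) => st _.
  have := momentum_step st; move: (nsq _) (nsq _) (Bsq _) (Bsq _) (sqd _) (Asq _ _).
  by move=> *; lra.
rewrite !Sm_lin// -/q in mom.
have -> : Sm N (fun st => objr (mean (in_w st)) - objr xs
     + sigma / 4 * (1 + tau / 2) * nsq (qnext (mean (in_w st)) - xs)) =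
  Sm N (fun st => - objr xs + (1 * objr (mean (in_w st))
     + (sigma / 4 * (1 + tau / 2) * nsq (qnext (mean (in_w st)) - xs)
     + (0 * sqd st + 0 * sqd st)))) by apply: eq_Sm => st; ring.
rewrite Sm_lin// -/q.
have hD := Tm_sqd N.
have [w0' w1] := andP (mass_le1 N).
have c10 : 0 <= c1.
  have l20 : 0 <= l2 by have := set_l1 H; have := set_l12 H; lra.
  have g0 := set_gam0 H; have l10 := set_l1 H.
  by rewrite addr_ge0// ?divr_ge0 ?mulr_ge0// ltW.
have hD' := ler_wpM2l c10 hD.
have tel' := ler_wpM2l (ltW c0) tel.
have dF : 0 <= objr ybar - objr xs by rewrite subr_ge0 xs_min.
have wF : (1 - q ^+ N) * ((1 - tau) * (objr ybar - objr xs)) <=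
    (1 - tau) * (objr ybar - objr xs).
  by rewrite ler_piMl// mulr_ge0// subr_ge0.
have Q0 : 0 <= sigma / 4 * nsq (qbar - xs) by rewrite mulr_ge0 ?nsq_ge0 ?divr_ge0// ltW.
have wQ : (1 - q ^+ N) * (sigma / 4 * nsq (qbar - xs)) <= sigma / 4 * nsq (qbar - xs).
  by rewrite ler_piMl.
have c20 : 0 <= c2 * nvar w0 by apply: mulr_ge0 c2_ge0 (nvar_ge0 _).
have wc : (1 - q ^+ N) * (c2 * nvar w0) <= c2 * nvar w0 by rewrite ler_piMl.
have cpB : c * (p * Bsq ist0 - p * Sm N Bsq) =
  theta / 2 * (Bsq ist0 - Sm N Bsq) by rewrite -mulrBr mulrA cp.
rewrite cpB in tel'; rewrite /K0 in h.
(* The truncated weights have mass [1 - q ^+ N]; the missing share of the initial distance is the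
   remainder. *)
have th2 : (1 - q ^+ N) * (theta / 2 * Bsq ist0) = theta / 2 * Bsq ist0 - q ^+ N * (theta / 2 * Bsq ist0).
  by rewrite mulrBl mul1r.
move: h mom hD' tel' wF wQ wc th2.
move: (Sm N (fun st => objr (mean (in_w st)))) (Sm N Bsq) (Tm N Bsq)
  (Sm N (Asq xs)) (Sm N sqd) (Tm N sqd) (Tm N cerr)
  (Sm N (fun st => nsq (qnext (mean (in_w st)) - xs))).
move: (objr ybar) (objr xs) (Bsq ist0) (nsq (qbar - xs)) (nvar w0) (1 - q ^+ N).
move: (q ^+ N) c1 c2 theta; intros; lra.
Qed.

End EpochMean.

(** * Contraction of the potential over one epoch *)

Section OuterAlgebra.
Context {R : realType}.

(* [Fy], [Qs]: suboptimality of [y] and squared distance of [q] to the minimizer;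
   [E], [Rk], [Rn]: consensus error, squared distance of the old and the new [x];
   [Z0], [Zs], [Tc], [D], [S]: truncated epoch expectations. *)
Lemma outer_arith (tau theta sigma h c1 c2 gam delta l Fy Qs E Q Rk Rn Z0 a0 Zs Tc D S bd : R) :
  0 < tau -> tau <= 1 -> 0 < sigma -> h = sigma * tau / 96 -> 0 <= c2 ->
  0 < gam -> gam <= 1 / 2 -> 0 <= delta -> 12 * delta <= 1 ->
  c1 + 2 * gam * c2 + 4 * gam * h <= theta / 4 ->
  (4 * c2 + 6 * h) * (delta * (2 + 8 * l)) <= h / 4 ->
  0 <= Fy -> 0 <= Qs -> 0 <= Q -> Q <= E -> 0 <= Rk -> 0 <= Rn -> 0 <= Z0 ->
  a0 <= Z0 -> 0 <= D ->
  Zs <= 2 * gam * (2 * Z0 + D) -> Tc <= Z0 + Zs ->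
  Z0 <= delta * (2 + 8 * l) * (E + Rk + Rn) ->
  sigma / 4 * Rn <= Fy + sigma / 4 * (1 + tau / 2) * Qs ->
  S <= (1 - tau) * Fy + sigma / 4 * Qs + (c1 - theta / 4) * D + c2 * (a0 + Tc) + bd
     + h * (2 * Zs + (2 * Z0 + 3 * delta * Q + Rn)) ->
  S <= (1 - tau / 4) * (Fy + sigma / 4 * (1 + tau / 2) * Qs + h * (E + Rk)) + bd.
Proof.
move=> tau0 tau1 s0 hE c20 g0 g1 d0 d12 R1 R4 Fy0 Qs0 Q0 QE Rk0 Rn0 Z00 az D0 hZs hTc hZ0 hRn hS.
have h0 : 0 < h by rewrite hE divr_gt0// mulr_gt0.
set Phi := Fy + _ in hRn *.
have Phi0 : 0 <= Phi.
  apply: addr_ge0 Fy0 (mulr_ge0 _ Qs0); apply: mulr_ge0; clear -tau0 s0; lra.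
(* The factor [1 + tau / 2] on [Qs] yields the contraction, because
   [1 <= (1 - tau / 3) * (1 + tau / 2)]. *)
have P1 : (1 - tau) * Fy + sigma / 4 * Qs <= (1 - tau / 3) * Phi.
  have e1 : 1 <= (1 - tau / 3) * (1 + tau / 2) by clear -tau0 tau1; nra.
  have : sigma / 4 * Qs <= sigma / 4 * Qs * ((1 - tau / 3) * (1 + tau / 2)).
    by rewrite ler_peMr// mulr_ge0// divr_ge0// ltW.
  have : tau * Fy >= 0 by rewrite mulr_ge0// ltW.
  by rewrite /Phi; clear; lra.
(* Origin of the [96] in [h]: the new distance [Rn] costs [5 tau / 96] of [Phi], within the
   [tau / 12] between [1 - tau / 3] and [1 - tau / 4]. *)
have P2 : 5 / 4 * h * Rn <= 5 * tau / 96 * Phi.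
  have -> : 5 / 4 * h * Rn = 5 * tau / 96 * (sigma / 4 * Rn) by rewrite hE; field.
  by rewrite ler_wpM2l// divr_ge0// mulr_ge0// ltW.
have P3 : c2 * (a0 + Tc) + 2 * h * Zs <= (4 * c2 + 4 * h) * Z0 + 2 * gam * (c2 + 2 * h) * D.
  have e1 : c2 * (a0 + Tc) <= c2 * (2 * Z0 + Zs).
    by rewrite ler_wpM2l//; clear -az hTc; lra.
  have e2 : (c2 + 2 * h) * Zs <= (c2 + 2 * h) * (2 * gam * (2 * Z0 + D)).
    by rewrite ler_wpM2l//; clear -c20 h0; lra.
  have e3 : (c2 + 2 * h) * Z0 * (4 * gam) <= (c2 + 2 * h) * Z0 * 2.
    by rewrite ler_wpM2l// ?mulr_ge0//; clear -c20 h0 g1; lra.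
  by clear -e1 e2 e3; lra.
have P4 : (c1 - theta / 4) * D + 2 * gam * (c2 + 2 * h) * D <= 0.
  by rewrite -mulrDl mulr_le0_ge0//; clear -R1; lra.
have P5 : (4 * c2 + 6 * h) * Z0 <= h / 4 * (E + Rk + Rn).
  apply: le_trans (_ : _ <= (4 * c2 + 6 * h) * (delta * (2 + 8 * l) * (E + Rk + Rn))) _.
    by rewrite ler_wpM2l//; clear -c20 h0; lra.
  by rewrite mulrA ler_wpM2r//; clear -Rk0 Rn0 Q0 QE; lra.
have P6 : h * (3 * delta * Q) <= h / 4 * E.
  have : 3 * delta * Q <= E / 4.
    have : 12 * delta * Q <= Q by rewrite ler_piMl.
    by move: QE; clear; lra.
  by move/(ler_wpM2l (ltW h0)); clear; lra.
have P7 : 0 <= tau * Phi by rewrite mulr_ge0// ltW.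
have P8 : h / 2 * (E + Rk) <= (1 - tau / 4) * (h * (E + Rk)).
  have x0 : 0 <= h * (E + Rk) by rewrite mulr_ge0 ?(ltW h0)//; clear -Q0 QE Rk0; lra.
  have : tau * (h * (E + Rk)) <= h * (E + Rk) by rewrite ler_piMl.
  by move: x0; clear; lra.
have P9 : 0 <= h * Rk by rewrite mulr_ge0 ?(ltW h0).
move: P1 P2 P3 P4 P5 P6 P7 P8 P9 hS; clear; lra.
Qed.

Lemma oerr_arith (l X X' Y Q S Rk Rn : R) : 0 <= l -> l * X <= l * (Q + Y) ->
  0 <= X' -> 0 <= Y -> 0 <= Q -> 0 <= S -> 0 <= Rk -> 0 <= Rn ->
  2 * (Q + Y) + (2 * S + 4 * l * (Rn + Rk + X + X')) <=
  (2 + 8 * l) * (X' + Y + Q + S + Rk + Rn).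
Proof.
move=> l0 lX X'0 Y0 Q0 S0 Rk0 Rn0.
have := mulr_ge0 l0 X'0; have := mulr_ge0 l0 Y0; have := mulr_ge0 l0 Q0.
have := mulr_ge0 l0 S0; have := mulr_ge0 l0 Rk0; have := mulr_ge0 l0 Rn0.
lra.
Qed.

Lemma potential_arith (u v w c z E x y : R) : v <= E -> u <= w * c ->
  u + (1 * v + (2 * w * z + (0 * x + 0 * y))) <= E + w * (2 * z + c).
Proof. lra. Qed.

End OuterAlgebra.

Section Outer.
Context {R : realType} {m n d : nat}.
Context (f : 'I_m -> 'I_n -> 'rV[R]_d -> R) (psi : 'rV[R]_d -> \bar R).
Context (W : 'M[R]_m) (lam2 : R) (b : nat) (eta : R) (M : nat).
Context (L l1 l2 sf sp delta gam : R).
Hypothesis H : setting f psi W lam2 b eta M L l1 l2 sf sp delta gam.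
Context (p tau : R) (xs : 'rV[R]_d).
Hypotheses (p_gt0 : 0 < p) (p_le1 : p <= 1) (tau_gt0 : 0 < tau) (tau_le1 : tau <= 1).
Hypothesis dom_xs : psi xs \is a fin_num.

Local Notation mix := (fastmix W lam2 M).
Local Notation batch := {ffun 'I_m * 'I_b -> 'I_n}.
Local Notation istate := (@inner_state R m d).
Local Notation ostate := (@outer_state R m d).
Local Notation objr := (objr f psi).
Local Notation sigma := (sf + sp).
Local Notation theta := (p / eta).
Local Notation c1 := (c1 b eta l1 l2 gam).
Local Notation c2 := (c2 eta l2 sf sp).
Local Notation Lam := (Lam eta l2).
Hypothesis tauE : tau ^+ 2 * theta = sigma / 4.
Hypothesis xs_min : forall x, psi x \is a fin_num -> objr xs <= objr x.

(** [xs] is compared with the points of the segment towards [y]; the moduli of [f] and [psi] add up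
    to [sigma]. *)
Lemma objr_growth y : psi y \is a fin_num ->
  sigma / 2 * nsq (y - xs) <= objr y - objr xs.
Proof.
move=> dy; suff : objr xs <= objr y - sigma / 2 * nsq (y - xs) by lra.
apply: le_of_shrink; first by rewrite mulr_ge0 ?nsq_ge0// divr_ge0// ltW// (set_s H).
move=> t /andP[t0 t1]; have t01 : 0 <= t <= 1 by rewrite !ltW.
have [dz hz] := convex_dom (set_pcvx H) (set_proper H) t01 dy dom_xs.
have hf := strongly_convex_fin (set_fcvx H) y xs t01.
have := xs_min dz; rewrite /objr => hm; rewrite -(ler_pM2l t0).
move: hz hf hm; move: (nsq (y - xs)) => N; lra.
Qed.

Definition xnew (o : ostate) := mix (tau *: out_q o + (1 - tau) *: out_y o).

Definition snew (o : ostate) := mix (\matrix_(i < m)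
    (row i (out_s o) + grad (f_local f i) (row i (xnew o))
       - grad (f_local f i) (row i (out_x o)))).

(** Closing part of an epoch. Together with [xnew] and [snew], which the outer state determines, it
    isolates the inner loop as a chain with fixed parameters. *)
Definition finish (o : ostate) (st : istate) : ostate :=
  OuterState (xnew o) (in_w st)
    (mix ((1 + tau / 2)^-1 *: (out_q o + (tau / 2) *: in_w st
       - (2 * tau)^-1 *: (xnew o - in_w st))))
    (snew o) (in_sfo st) (in_comm st + M).

Lemma epochE (T : nat) (bt : nat -> 'I_m -> 'I_b -> 'I_n) (o : ostate) :
  epoch f psi W lam2 eta tau M T bt o =
  finish o (inner_loop f psi W lam2 eta M (snew o) (xnew o) bt
    (out_sfo o + 2 * n) (out_comm o + 2 * M) T.+1).
Proof. by []. Qed.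

Definition oInv (o : ostate) : Prop :=
  psi (mean (out_y o)) \is a fin_num /\ mean (out_s o) = mean (grads f (out_x o)).

Definition weight : R := sigma * tau / 96.

Definition oerr (o : ostate) : R :=
  nvar (out_x o) + nvar (out_y o) + nvar (out_q o) + eta ^+ 2 * nvar (out_s o).

(** The distance of [out_x] is included because [snew] moves by a gradient difference between
    successive [x], which is bounded through [xs]. *)
Definition pot (o : ostate) : R :=
  objr (mean (out_y o)) - objr xs
  + sigma / 4 * (1 + tau / 2) * nsq (mean (out_q o) - xs)
  + weight * (oerr o + nsq (mean (out_x o) - xs)).

Local Notation istep o := (istep (b := b) f psi W lam2 eta M (snew o) (xnew o)).

Lemma mean_xnew o :
  mean (xnew o) = tau *: mean (out_q o) + (1 - tau) *: mean (out_y o).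
Proof. by rewrite (set_mean H) meanD !meanZ. Qed.

Lemma snewE o :
  snew o = mix (out_s o + (grads f (xnew o) - grads f (out_x o))).
Proof.
by congr mix; apply/row_matrixP => i; rewrite rowK linearD /= linearB /= !rowK addrA.
Qed.

Lemma mean_snew o : oInv o -> mean (snew o) = mean (grads f (xnew o)).
Proof. by move=> [_ e]; rewrite snewE (set_mean H) meanD meanB e addrC subrK. Qed.

Lemma weight_gt0 : 0 < weight.
Proof. by rewrite divr_gt0// mulr_gt0// (set_s H). Qed.

Lemma oerr_ge0 o : 0 <= oerr o.
Proof.
rewrite /oerr; apply: addr_ge0; last exact: mulr_ge0 (eta2_ge0 _) (nvar_ge0 _).
by rewrite !addr_ge0 ?nvar_ge0.
Qed.

Lemma pot_gap o : objr (mean (out_y o)) - objr xs <= pot o.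
Proof.
rewrite /pot; move: (objr _ - objr xs) => g; rewrite -addrA lerDl; apply: addr_ge0.
  apply: mulr_ge0 (nsq_ge0 _); apply: mulr_ge0; first by rewrite divr_ge0// ltW// (set_s H).
  by rewrite addr_ge0// divr_ge0// ltW.
exact: mulr_ge0 (ltW weight_gt0) (addr_ge0 (oerr_ge0 o) (nsq_ge0 _)).
Qed.

Lemma pot_ge0 o : psi (mean (out_y o)) \is a fin_num -> 0 <= pot o.
Proof. by move=> dy; apply: le_trans (pot_gap o); rewrite subr_ge0 xs_min. Qed.

Lemma pot_bcast x g sfo comm : psi x \is a fin_num -> tau <= 1 ->
  pot (OuterState (bcast x) (bcast x) (bcast x) (bcast g) sfo comm) <=
  2 * (objr x - objr xs).
Proof.
move=> dx t1; have hg := objr_growth dx.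
rewrite /pot /oerr /weight /= !(nvar_bcast (set_m H)) !(mean_bcast (set_m H)).
rewrite mulr0 !addr0 add0r.
have s0 := set_s H; have t0 := tau_gt0.
have N0 : 0 <= sigma * nsq (x - xs) by apply: mulr_ge0 (ltW s0) (nsq_ge0 _).
have tN : tau * (sigma * nsq (x - xs)) <= sigma * nsq (x - xs) by rewrite ler_piMl.
move: hg N0 tN; move: (objr x - _) (nsq _) => G N; lra.
Qed.

Lemma nvar_xnew o : nvar (xnew o) <= delta * (2 * (nvar (out_q o) + nvar (out_y o))).
Proof.
apply: le_trans (set_nvar H _) _; rewrite ler_wpM2l ?(set_delta H)//.
apply: le_trans (nvarD_le _ _) _; rewrite !nvarZ.
have := nvar_ge0 (out_q o); have := nvar_ge0 (out_y o).
have := tau_gt0; have := tau_le1.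
move: (nvar _) (nvar _) => a c t1 t0 c0 a0.
have h1 : tau ^+ 2 * a <= a by rewrite ler_piMl// exprn_ile1// ltW.
have h2 : (1 - tau) ^+ 2 * c <= c by rewrite ler_piMl// exprn_ile1//; lra.
lra.
Qed.

Lemma nvar_snew o : eta ^+ 2 * nvar (snew o) <= delta *
  (2 * (eta ^+ 2 * nvar (out_s o)) + 4 * Lam ^+ 2 *
    (nsq (mean (xnew o) - xs) + nsq (mean (out_x o) - xs)
     + nvar (xnew o) + nvar (out_x o))).
Proof.
have key : nvar (snew o) <= delta * (2 * nvar (out_s o) + 4 * (l2 ^+ 2 *
    (nsq (mean (xnew o) - xs) + nsq (mean (out_x o) - xs)
     + nvar (xnew o) + nvar (out_x o)))).
  rewrite snewE; apply: le_trans (set_nvar H _) _.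
  rewrite ler_wpM2l ?(set_delta H)//; apply: le_trans (nvarD_le _ _) _.
  have h1 := nvar_le_msq (set_m H) (grads f (xnew o) - grads f (out_x o)).
  have h2 := msq_grads (set_n H) (set_diff H) (set_l1 H) (set_l12 H)
    (set_l12smooth H) (xnew o) (out_x o).
  have h3 : msq (xnew o - out_x o) <= 2 * (nsq (mean (xnew o) - xs) +
     nsq (mean (out_x o) - xs) + nvar (xnew o) + nvar (out_x o)).
    rewrite (msq_mean (set_m H)) meanB.
    have := nvarB_le (xnew o) (out_x o).
    have := nsqB_le (mean (xnew o) - xs) (mean (out_x o) - xs).
    have -> : mean (xnew o) - xs - (mean (out_x o) - xs) = mean (xnew o) - mean (out_x o).
      by apply/rowP => j; rewrite !mxE; ring.
    lra.
  have := ler_wpM2l (sqr_ge0 l2) h3; lra.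
apply: le_trans (ler_wpM2l (eta2_ge0 _) key) _.
by rewrite le_eqVlt; apply/orP; left; apply/eqP; rewrite /Lam; ring.
Qed.

Lemma mean_finish_q o st :
  mean (out_q (finish o st)) = qnext (xnew o) tau (mean (out_q o)) (mean (in_w st)).
Proof. by rewrite /= (set_mean H) meanZ !(meanD, meanN, meanZ). Qed.

(** Before mixing, the coefficients of order [1 / tau] amplify the disagreement of [in_w] and [xnew]
    by up to [1 / tau^2]; the condition on [delta] undoes this. *)
Lemma nvar_finish_q o st : 3 * delta <= tau ^+ 2 ->
  nvar (out_q (finish o st)) <=
    3 * delta * nvar (out_q o) + (nvar (in_w st) + nvar (xnew o)).
Proof.
move=> dt; rewrite /=; apply: le_trans (set_nvar H _) _; rewrite nvarZ.
have t0 := tau_gt0; have t1 := tau_le1; have d0 := set_delta H.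
have -> : out_q o + (tau / 2) *: in_w st - (2 * tau)^-1 *: (xnew o - in_w st) =
  out_q o + (tau / 2 + (2 * tau)^-1) *: in_w st + (- (2 * tau)^-1) *: xnew o.
  by apply/matrixP => i j; rewrite !mxE; ring.
have := nvarD3_le (out_q o) ((tau / 2 + (2 * tau)^-1) *: in_w st) ((- (2 * tau)^-1) *: xnew o).
rewrite !nvarZ; set V := nvar (_ + _ + _).
have V0 : 0 <= V by exact: nvar_ge0.
have := nvar_ge0 (out_q o); have := nvar_ge0 (in_w st); have := nvar_ge0 (xnew o).
move: (nvar (out_q o)) (nvar (in_w st)) (nvar (xnew o)) V V0 => Q Y X V V0 X0 Y0 Q0 hV.
have i0 : 0 < tau^-1 by rewrite invr_gt0.
have it : tau * tau^-1 = 1 by rewrite mulfV// gt_eqF.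
have iE : (2 * tau)^-1 = tau^-1 / 2 by rewrite invfM mulrC.
have kV : (1 + tau / 2)^-1 ^+ 2 * V <= V.
  by rewrite ler_piMl// exprn_ile1// ?invr_ge0 ?invf_le1//; lra.
have a1 : (tau / 2 + (2 * tau)^-1) ^+ 2 <= tau^-1 ^+ 2.
  rewrite ler_sqr ?nnegrE ?addr_ge0 ?divr_ge0 ?invr_ge0 ?mulr_ge0 ?(ltW t0) ?(ltW i0)//.
  by rewrite iE; nra.
have a2 : (- (2 * tau)^-1) ^+ 2 <= tau^-1 ^+ 2.
  by rewrite sqrrN ler_sqr ?nnegrE ?invr_ge0 ?mulr_ge0 ?(ltW t0) ?(ltW i0)// iE; lra.
have b1 : V <= 3 * (Q + tau^-1 ^+ 2 * (Y + X)).
  have := ler_wpM2r Y0 a1; have := ler_wpM2r X0 a2; lra.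
have dti : 3 * delta * tau^-1 ^+ 2 <= 1.
  by rewrite -ler_pdivlMr ?exprn_gt0// div1r exprVn invrK.
have : delta * ((1 + tau / 2)^-1 ^+ 2 * V) <= delta * (3 * (Q + tau^-1 ^+ 2 * (Y + X))).
  by rewrite ler_wpM2l//; apply: le_trans kV b1.
have : (3 * delta * tau^-1 ^+ 2) * (Y + X) <= Y + X by rewrite ler_piMl// addr_ge0.
lra.
Qed.

Hypothesis R1 : c1 + 2 * gam * c2 + 4 * gam * weight <= theta / 4.
Hypothesis R3 : 3 * delta <= tau ^+ 2.
Hypothesis R3' : 12 * delta <= 1.
Hypothesis R4 : (4 * c2 + 6 * weight) * (delta * (2 + 8 * Lam ^+ 2)) <= weight / 4.

Lemma pot_contract o sfo comm N : oInv o ->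
  Sm (istep o) p (ist0 (snew o) (xnew o) sfo comm) N (fun st => pot (finish o st)) <=
  (1 - tau / 4) * pot o.
Proof.
move=> io; have [dy es] := io.
have B0 := batch_gt0 H.
have mmu := mean_snew io.
set st0 := ist0 _ _ _ _.
pose K : R := theta / 2 * ((1 - tau) * nsq (mean (out_y o) - mean (xnew o))
   + tau * nsq (xs - mean (xnew o))).
pose inv := @iInv R m d.
have inv0 : inv st0 by exact: iInv0.
have invs (x : batch) st : inv st -> inv (istep o x st).
  by move=> h; apply: (iInv_step H).
have Rn_le : sigma / 4 * nsq (mean (xnew o) - xs) <=
    objr (mean (out_y o)) - objr xs + sigma / 4 * (1 + tau / 2) * nsq (mean (out_q o) - xs).
  have hg := objr_growth dy.
  have s0 := set_s H; have t0 := tau_gt0; have t1 := tau_le1.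
  have : nsq (mean (xnew o) - xs) <= 2 * nsq (mean (out_y o) - xs) + nsq (mean (out_q o) - xs).
    rewrite mean_xnew.
    have -> : tau *: mean (out_q o) + (1 - tau) *: mean (out_y o) - xs =
      tau *: (mean (out_q o) - xs) + (1 - tau) *: (mean (out_y o) - xs).
      by apply/rowP => j; rewrite !mxE; ring.
    move: (mean (out_q o) - xs) (mean (out_y o) - xs) => u v.
    have := nsq_ge0 (u - v); have := nsq_ge0 u; have := nsq_ge0 v.
    rewrite /nsq !dotE (dotC v u); move: (dot u u) (dot v v) (dot u v) => uu vv uv v0 u0 uv0.
    have : tau * (1 - tau) * (uu - uv + (- uv + vv)) >= 0.
      by rewrite mulr_ge0// ?mulr_ge0//; lra.
    have : tau * uu <= uu by rewrite ler_piMl.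
    have : (1 - tau) * vv <= vv by rewrite ler_piMl//; lra.
    lra.
  have := nsq_ge0 (mean (out_q o) - xs); have := nsq_ge0 (mean (out_y o) - xs).
  move: hg; move: (nsq _) (nsq _) (nsq _) => Ny Nq Nx hg Nq0 Ny0 hx.
  have h1 := ler_wpM2l (ltac:(lra) : 0 <= sigma / 4) hx.
  have h2 : 0 <= sigma / 4 * (tau / 2) * Nq by rewrite !mulr_ge0//; lra.
  lra.
have bound N' : Sm (istep o) p st0 N' (fun st => pot (finish o st)) <=
    (1 - tau / 4) * pot o + (1 - p) ^+ N' * K.
  have hE := epoch_mean H sfo comm mmu p_gt0 p_le1 tau_gt0 tau_le1 (mean_xnew o) dy
    dom_xs tauE xs_min N'.
  have hZ := Sm_cerr H (snew o) (xnew o) sfo comm p_gt0 p_le1 N'.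
  have hT := Tm_cerr H (snew o) (xnew o) sfo comm p_gt0 p_le1 N'.
  have hD := Sm_sqd_ge0 H (snew o) (xnew o) sfo comm p_gt0 p_le1 N'.
  have h0 := cerr0 eta l2 gam (snew o) (xnew o) sfo comm.
  have hX := nvar_xnew o; have hS := nvar_snew o.
  have X0 := nvar_ge0 (xnew o).
  have S0 : 0 <= eta ^+ 2 * nvar (snew o) by exact: mulr_ge0 (eta2_ge0 _) (nvar_ge0 _).
  pose cst := 2 * (nvar (xnew o) + eta ^+ 2 * nvar (snew o))
    + 3 * delta * nvar (out_q o) + nsq (mean (xnew o) - xs).
  have hP : Sm (istep o) p st0 N' (fun st => pot (finish o st)) <=
     Sm (istep o) p st0 N' (fun st => weight * cst + (1 *
      (objr (mean (in_w st)) - objr xs + sigma / 4 * (1 + tau / 2) *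
        nsq (qnext (xnew o) tau (mean (out_q o)) (mean (in_w st)) - xs)) +
      (2 * weight * cerr eta l2 gam (snew o) st + (0 * cerr eta l2 gam (snew o) st
        + 0 * cerr eta l2 gam (snew o) st)))).
    apply: (Sm_le p_gt0 p_le1 inv0 invs) => st _.
    rewrite /pot -mean_finish_q /=; set Q' := nsq _.
    have hq := nvar_finish_q o st R3; rewrite /= in hq.
    rewrite /oerr /= /cst.
    have hc : nvar (in_w st) <= cerr eta l2 gam (snew o) st.
      rewrite /cerr -addrA lerDl; apply: addr_ge0.
        exact: mulr_ge0 (eta2_ge0 _) (nvar_ge0 _).
      exact: mulr_ge0 (ltW (eps0_gt0 H)) (mulr_ge0 (eta2_ge0 _) (msq_ge0 _)).
    move: hq hc S0 X0; move: (nvar (mix _)) (nvar (in_w st)) (cerr _ _ _ _ _).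
    move: (nvar (xnew o)) (eta ^+ 2 * nvar (snew o)) (nvar (out_q o)) (nsq (mean (xnew o) - xs)).
    move=> X S Q Rn q' Y C hq hc S0 X0.
    have : weight * (X + Y + q' + S + Rn) <=
           weight * (2 * (X + S) + 3 * delta * Q + Rn + 2 * C).
      by rewrite ler_wpM2l ?(ltW weight_gt0)//; lra.
    lra.
  have w1 := mass_le1 p_gt0 p_le1 N'.
  rewrite Sm_lin// in hP.
  have h12 := set_gam0 H; have g1 := set_gam H; have d0 := set_delta H.
  have l0 : 0 <= Lam ^+ 2 by exact: sqr_ge0.
  have qk0 := nvar_ge0 (out_q o); have yk0 := nvar_ge0 (out_y o).
  have xk0 := nvar_ge0 (out_x o).
  have sk0 : 0 <= eta ^+ 2 * nvar (out_s o) by exact: mulr_ge0 (eta2_ge0 _) (nvar_ge0 _).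
  have Rk0 := nsq_ge0 (mean (out_x o) - xs); have Rn0 := nsq_ge0 (mean (xnew o) - xs).
  rewrite /pot; apply: (@outer_arith R tau theta sigma weight c1 c2 gam delta (Lam ^+ 2)
    (objr (mean (out_y o)) - objr xs) (nsq (mean (out_q o) - xs)) (oerr o)
    (nvar (out_q o)) (nsq (mean (out_x o) - xs)) (nsq (mean (xnew o) - xs))
    (nvar (xnew o) + eta ^+ 2 * nvar (snew o)) (nvar (xnew o))
    (Sm (istep o) p st0 N' (cerr eta l2 gam (snew o)))
    (Tm (istep o) p st0 N' (cerr eta l2 gam (snew o)))
    (Sm (istep o) p st0 N' (sqd (xnew o))) _ ((1 - p) ^+ N' * K) tau_gt0 tau_le1
    (set_s H) erefl (c2_ge0 H) h12 g1 d0 R3' R1 R4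
    _ (nsq_ge0 _) qk0 _ Rk0 Rn0 _ _ hD _ _ _ Rn_le _).
  - by rewrite subr_ge0 xs_min.
  - by rewrite /oerr ler_wpDr// ler_wpDl// addr_ge0.
  - exact: addr_ge0.
  - by rewrite lerDl.
  - by rewrite -h0.
  - by rewrite -h0.
  - have E0 : 0 <= nvar (out_q o) + nvar (out_y o) by exact: addr_ge0.
    have X_le : nvar (xnew o) <= nvar (out_q o) + nvar (out_y o).
      apply: le_trans hX _; rewrite mulrA ler_piMl//.
      by apply: le_trans R3'; rewrite mulrC ler_wpM2r// ler_nat.
    have LX := ler_wpM2l l0 X_le.
    apply: le_trans (lerD hX hS) _; rewrite -mulrDr -[leRHS]mulrA ler_wpM2l//.
    exact: oerr_arith l0 LX xk0 yk0 qk0 sk0 Rk0 Rn0.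
  - apply: le_trans hP _.
    have w_le : (1 - (1 - p) ^+ N') * (weight * cst) <= weight * cst.
      have /andP[w10 w11] := w1; rewrite ler_piMl// mulr_ge0 ?(ltW weight_gt0)//.
      apply: addr_ge0 _ Rn0; apply: addr_ge0.
        by apply: mulr_ge0 => //; exact: addr_ge0.
      by apply: mulr_ge0 _ qk0; exact: mulr_ge0.
    exact: potential_arith hE w_le.
(* Monotonicity in [N] needs a nonnegative potential: after at least one prox step the average
   iterate lies in the domain of [psi]. *)
apply: (geom_limit p_gt0 p_le1 (s := fun N => Sm (istep o) p st0 N (fun st => pot (finish o st))) _ bound).
move=> N'; apply: (Sm_mono B0 p_gt0 p_le1 inv0 invs) => st _.
apply: avg_ge0 => x; apply: pot_ge0.
exact: istep_dom H _ _ _ _.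
Qed.

End Outer.

(** * Random sampling and expectations *)

Section SamplingTheory.
Context {R : realType} {dO : measure_display} {Omega : measurableType dO}.
Context (P : probability Omega R) {m n b : nat}.
Context (T : nat -> Omega -> nat) (B : nat -> nat -> 'I_m -> 'I_b -> Omega -> 'I_n).
Hypothesis samp : sampling P T B.
Local Open Scope ereal_scope.
Local Notation I := (nat + nat * nat * 'I_m * 'I_b)%type.
Local Notation ev := (sample_events T B).
Local Notation batch := {ffun 'I_m * 'I_b -> 'I_n}.
Implicit Types (s : seq I) (A : I -> set Omega) (k t : nat).

Definition cyl s A : set Omega := \bigcap_(i in [set` s]) A i.

(** All sets of states count as measurable, so every function of the state is measurable. The
    iterates satisfy this because each is determined by countably many possible sample outcomes. *)
Definition discrete {St : Type} (X : Omega -> St) : Prop :=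
  forall U : set St, measurable (X @^-1` U).

(* The sampling variables not yet used at iteration [t] of epoch [k]. *)
Definition future k t (i : I) : bool :=
  match i with
  | inl k' => (k <= k')%N
  | inr (k', t', _, _) => (k < k')%N || ((k' == k) && (t <= t')%N)
  end.

(** Independence from the samples not yet used, phrased by integrals over cylinders so that it
    passes from one state to the next without conditional expectations. *)
Definition indep_future {St : Type} k t (X : Omega -> St) : Prop :=
  discrete X /\
  forall s A, uniq s -> {in s, forall i, future k t i} ->
    (forall i, i \in s -> ev i (A i)) ->
    forall phi : St -> \bar R, (forall x, 0 <= phi x) ->
    \int[P]_(w in cyl s A) phi (X w) = P (cyl s A) * \int[P]_w phi (X w).

Let PsetT : P [set: Omega] = 1.
Proof. exact: probability_setT. Qed.

Lemma cyl_nil A : cyl [::] A = setT.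
Proof. by rewrite /cyl -subTset => w _ i. Qed.

Lemma cyl_measurable s A : (forall i, i \in s -> ev i (A i)) -> measurable (cyl s A).
Proof.
move=> sA; rewrite /cyl bigcap_seq.
elim: s sA => [|i s IH] sA; first by rewrite big_nil; exact: measurableT.
rewrite big_cons; apply: measurableI.
  by apply: (sampling_measurable samp (idx := i)); apply: sA; rewrite mem_head.
by apply: IH => j js; apply: sA; rewrite inE js orbT.
Qed.

Lemma discrete_measurable_fun {St : Type} (X : Omega -> St) (phi : St -> \bar R) D :
  measurable D -> discrete X -> measurable_fun D (phi \o X : Omega -> \bar R).
Proof. by move=> mD dX _ Y mY; apply: measurableI => //; exact: dX (phi @^-1` Y). Qed.

Lemma integral_fibers_fin (J : finType) (Y : Omega -> J) (D : set Omega)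
    (h : Omega -> \bar R) : measurable D -> discrete Y ->
  measurable_fun D h -> (forall w, 0 <= h w) ->
  \int[P]_(w in D) h w = \sum_(j : J) \int[P]_(w in D `&` Y @^-1` [set j]) h w.
Proof.
move=> mD dY mh h0.
have DE : D = \big[setU/set0]_(j <- index_enum J) (D `&` Y @^-1` [set j]).
  rewrite -bigcup_seq; apply/seteqP; split=> w.
    by move=> Dw; exists (Y w); rewrite /= ?mem_index_enum.
  by move=> [j _ []].
rewrite {1}DE; apply: ge0_integral_bigsetU => //.
- by move=> j; apply: measurableI => //; exact: dY.
- exact: index_enum_uniq.
- by move=> i j _ _ [w [[_ <-] [_ <-]]].
- by rewrite -DE.
Qed.

Lemma integral_fibers_nat (Y : Omega -> nat) (D : set Omega)
    (h : Omega -> \bar R) : measurable D -> discrete Y ->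
  measurable_fun D h -> (forall w, 0 <= h w) ->
  \int[P]_(w in D) h w = \sum_(j <oo) \int[P]_(w in D `&` Y @^-1` [set j]) h w.
Proof.
move=> mD dY mh h0.
have DE : D = \bigcup_j (D `&` Y @^-1` [set j]).
  apply/seteqP; split=> w; first by move=> Dw; exists (Y w).
  by move=> [j _ []].
rewrite {1}DE; apply: ge0_integral_bigcup => //.
- by move=> j; apply: measurableI => //; exact: dY.
- by rewrite -DE.
- by move=> i j _ _ [w [[_ <-] [_ <-]]].
Qed.

Definition override A1 s2 A2 : I -> set Omega :=
  fun i => if i \in s2 then A2 i else A1 i.

Lemma cyl_cat s1 s2 A1 A2 : {in s1, forall i, i \notin s2} ->
  cyl (s1 ++ s2) (override A1 s2 A2) = cyl s1 A1 `&` cyl s2 A2.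
Proof.
move=> s12; apply/seteqP; split=> w.
  move=> H; split=> i /= is_.
    by have := H i; rewrite /= mem_cat is_ /override (negPf (s12 _ is_)); apply.
  by have := H i; rewrite /= mem_cat is_ orbT /override is_; apply.
move=> [H1 H2] i /=; rewrite mem_cat /override; case: ifPn => [is2 _|is2].
  exact: H2.
by rewrite orbF => is1; exact: H1.
Qed.

Lemma cyl_indep s1 s2 A1 A2 : uniq s1 -> uniq s2 -> {in s1, forall i, i \notin s2} ->
  (forall i, i \in s1 -> ev i (A1 i)) -> (forall i, i \in s2 -> ev i (A2 i)) ->
  [/\ uniq (s1 ++ s2), (forall i, i \in s1 ++ s2 -> ev i (override A1 s2 A2 i)) &
  P (cyl s1 A1 `&` cyl s2 A2) = P (cyl s1 A1) * P (cyl s2 A2)].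
Proof.
move=> u1 u2 s12 e1 e2.
have u : uniq (s1 ++ s2).
  rewrite cat_uniq u1 u2 andbT /= ; apply/hasPn => i is2; apply/negP => is1.
  by move: (s12 _ is1); rewrite is2.
have e i : i \in s1 ++ s2 -> ev i (override A1 s2 A2 i).
  rewrite mem_cat /override; case: ifPn => [is2 _|is2]; first exact: e2.
  by rewrite orbF; exact: e1.
split=> //; rewrite -cyl_cat// /cyl !(sampling_indep samp)// big_cat /=.
congr (_ * _); rewrite big_seq [RHS]big_seq; apply: eq_bigr => i is_.
  by rewrite /override (negPf (s12 _ is_)).
by rewrite /override is_.
Qed.

Lemma indep_future_map {St St' : Type} k t (X : Omega -> St) (g : St -> St') :
  indep_future k t X -> indep_future k t (fun w => g (X w)).
Proof.
move=> [dX iX]; split=> [U|s A us fs es phi phi0]; first exact: dX (g @^-1` U).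
exact: (iX s A us fs es (fun x => phi (g x))).
Qed.

Lemma indep_future_cst {St : Type} k t (c : St) : indep_future k t (fun _ : Omega => c).
Proof.
split=> [U|s A us fs es phi phi0].
  have [cU|cU] := pselect (U c).
    by rewrite (_ : _ @^-1` U = setT) ?measurableT// -subTset.
  by rewrite (_ : _ @^-1` U = set0) ?measurable0// -subset0.
rewrite !integral_cst//; last exact: cyl_measurable.
by rewrite [X in _ = _ * (_ * X)]PsetT mule1 muleC.
Qed.

Definition draw k t w : batch := [ffun x => B k t x.1 x.2 w].

Let new k t : seq I := [seq inr (k, t, x.1, x.2) | x <- enum {: 'I_m * 'I_b}].
Let fib k t (x0 : batch) (i : I) : set Omega :=
  if i is inr (_, _, i', l) then B k t i' l @^-1` [set x0 (i', l)] else setT.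

Let new_uniq k t : uniq (new k t).
Proof. by rewrite map_inj_uniq ?enum_uniq// => -[? ?] [? ?] [-> ->]. Qed.

Let new_ev k t x0 i : i \in new k t -> ev i (fib k t x0 i).
Proof. by case/mapP => -[i' l] _ ->; exists [set x0 (i', l)]. Qed.

Let draw_fiber k t x0 : draw k t @^-1` [set x0] = cyl (new k t) (fib k t x0).
Proof.
apply/seteqP; split=> w.
  by move=> /= <- i /= /mapP[[i' l] _ ->] /=; rewrite ffunE.
move=> H /=; apply/ffunP => -[i l]; rewrite ffunE /=.
by have := H (inr (k, t, i, l)); apply; apply/mapP; exists (i, l); rewrite ?mem_enum.
Qed.

Let draw_prob k t x0 : P (draw k t @^-1` [set x0]) = (#|{: batch}|%:R^-1)%:E.
Proof.
rewrite draw_fiber (sampling_indep samp) ?new_uniq//; last exact: new_ev.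
rewrite big_map big_enum /=.
under eq_bigr do rewrite (sampling_unif samp).
rewrite prodEFin prodr_const card_ffun natrX exprVn card_ord.
by rewrite cardT.
Qed.

Lemma draw_discrete k t : discrete (draw k t).
Proof.
move=> U; rewrite (_ : _ @^-1` U =
    \bigcup_(x in U) draw k t @^-1` [set x]); last first.
  apply/seteqP; split=> w; first by move=> Uw; exists (draw k t w).
  by move=> [x Ux] /= ->.
apply: fin_bigcup_measurable; first exact: finite_finset.
by move=> x _; rewrite draw_fiber; apply: cyl_measurable; exact: new_ev.
Qed.

(** The fibres of the batch are cylinders over the samples of [(k, t)], disjoint from the future of
    [t.+1]. On a fibre the new state is a fixed function of the old one, to which the hypothesis
    applies with the joined cylinder. *)
Lemma indep_future_draw {St St' : Type} k t (X : Omega -> St) (g : batch -> St -> St') :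
  indep_future k t X ->
  indep_future k t.+1 (fun w => g (draw k t w) (X w)) /\
  forall phi : St' -> \bar R, (forall x, 0 <= phi x) ->
    \int[P]_w phi (g (draw k t w) (X w)) =
    \sum_(x : batch) (#|{: batch}|%:R^-1)%:E * \int[P]_w phi (g x (X w)).
Proof.
move=> [dX iX].
have dY : discrete (fun w => g (draw k t w) (X w)).
  move=> U; rewrite (_ : _ @^-1` U = \bigcup_(x in setT)
      (draw k t @^-1` [set x] `&` X @^-1` (g x @^-1` U))); last first.
    apply/seteqP; split=> w; first by move=> Uw; exists (draw k t w).
    by move=> [x _ [/= -> Ux]].
  apply: fin_bigcup_measurable; first exact: finite_finset.
  by move=> x _; apply: measurableI; [exact: draw_discrete|exact: dX].
have key s A : uniq s -> {in s, forall i, future k t.+1 i} ->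
    (forall i, i \in s -> ev i (A i)) ->
    forall phi : St' -> \bar R, (forall x, 0 <= phi x) ->
    \int[P]_(w in cyl s A) phi (g (draw k t w) (X w)) = P (cyl s A) *
      \sum_(x : batch) (#|{: batch}|%:R^-1)%:E * \int[P]_w phi (g x (X w)).
  move=> us fs es phi phi0; have mD := cyl_measurable es.
  rewrite (integral_fibers_fin mD (@draw_discrete k t)); last 2 first.
    exact: discrete_measurable_fun.
    by [].
  rewrite ge0_sume_distrr; last first.
    by move=> x _; rewrite mule_ge0 ?lee_fin ?invr_ge0//; exact: integral_ge0.
  apply: eq_bigr => x _.
  have sn : {in s, forall i, i \notin new k t}.
    move=> i /fs fi; apply/negP => /mapP[[i' l] _ iE].
    by move: fi; rewrite iE /= ltnn eqxx ltnn.
  have [u e PE] := cyl_indep us (new_uniq k t) sn es (@new_ev k t x).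
  transitivity (\int[P]_(w in cyl s A `&` draw k t @^-1` [set x]) phi (g x (X w))).
    by apply: eq_integral => w; rewrite inE => -[_ /= ->].
  rewrite draw_fiber -cyl_cat//.
  rewrite (iX _ _ u _ e (fun y => phi (g x y)))//; last first.
    move=> i; rewrite mem_cat => /orP[/fs|/mapP[[i' l] _ ->]] /=; last first.
      by rewrite ltnn eqxx leqnn.
    by case: i => [//|[[[k' t'] i'] l]] /= /orP[->//|/andP[-> /ltnW ->]]; rewrite orbT.
  by rewrite cyl_cat// PE -draw_fiber draw_prob muleA.
have key0 (phi : St' -> \bar R) : (forall x, 0 <= phi x) ->
    \int[P]_w phi (g (draw k t w) (X w)) =
    \sum_(x : batch) (#|{: batch}|%:R^-1)%:E * \int[P]_w phi (g x (X w)).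
  move=> phi0; have nilP (p : I -> Prop) : {in [::], forall i, p i} by [].
  have := key [::] (fun=> setT) isT (nilP _) (nilP _) phi phi0.
  by rewrite cyl_nil [X in _ = X * _]PsetT mul1e.
split=> //; split=> // s A us fs es phi phi0.
by rewrite key0// key.
Qed.

(** For [T k], [future] looks at the epoch only, so [T k] stays in the future of every inner
    iteration of epoch [k]; restricting to [T k = t] does not change the law of [X t]. *)
Lemma indep_future_epoch {St : Type} k (X : nat -> Omega -> St) :
  (forall t, indep_future k t.+1 (X t)) ->
  indep_future k.+1 0 (fun w => X (T k w) w) /\
  forall phi : St -> \bar R, (forall x, 0 <= phi x) ->
    \int[P]_w phi (X (T k w) w) =
    \sum_(t <oo) P (T k @^-1` [set t]) * \int[P]_w phi (X t w).
Proof.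
move=> iX.
have dT : discrete (T k).
  by move=> U; apply: (sampling_measurable samp (idx := inl k)); exists U.
have dY : discrete (fun w => X (T k w) w).
  move=> U; rewrite (_ : _ @^-1` U = \bigcup_t
      (T k @^-1` [set t] `&` X t @^-1` U)); last first.
    apply/seteqP; split=> w; first by move=> Uw; exists (T k w).
    by move=> [t _ [/= -> Ux]].
  by apply: bigcup_measurable => t _; apply: measurableI; [exact: dT|exact: (iX t).1].
have key s A : uniq s -> {in s, forall i, future k.+1 0 i} ->
    (forall i, i \in s -> ev i (A i)) ->
    forall phi : St -> \bar R, (forall x, 0 <= phi x) ->
    \int[P]_(w in cyl s A) phi (X (T k w) w) = P (cyl s A) *
      \sum_(t <oo) P (T k @^-1` [set t]) * \int[P]_w phi (X t w).
  move=> us fs es phi phi0; have mD := cyl_measurable es.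
  rewrite (integral_fibers_nat mD dT); last 2 first.
    exact: discrete_measurable_fun.
    by [].
  have PD : P (cyl s A) = (fine (P (cyl s A)))%:E by rewrite fineK//; exact: fin_num_measure.
  rewrite PD -nneseriesZl; last first.
    by move=> t _; apply: mule_ge0; [exact: measure_ge0|apply: integral_ge0].
  apply: eq_eseriesr => t _; rewrite -PD.
  have sn : {in s, forall i, i \notin [:: inl k]}.
    move=> i /fs fi; apply/negP; rewrite inE => /eqP iE.
    by move: fi; rewrite iE /= ltnn.
  have en i : i \in [:: inl k] -> ev i (T k @^-1` [set t]).
    by rewrite inE => /eqP ->; exists [set t].
  have [u e PE] := cyl_indep us (isT : uniq [:: inl k]) sn es en.
  have cE : cyl [:: inl k] (fun=> T k @^-1` [set t]) = T k @^-1` [set t].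
    by rewrite /cyl bigcap_seq big_seq1.
  transitivity (\int[P]_(w in cyl s A `&` T k @^-1` [set t]) phi (X t w)).
    by apply: eq_integral => w; rewrite inE => -[_ /= ->].
  rewrite -cE -cyl_cat//.
  rewrite ((iX t).2 _ _ u _ e phi)//; last first.
    move=> i; rewrite mem_cat => /orP[/fs|]; last by rewrite inE => /eqP -> /=.
    case: i => [k' /= /ltnW//|[[[k' t'] i'] l]] /= /orP[/ltnW ->//|/andP[/eqP -> _]].
    by rewrite ltnSn.
  by rewrite cyl_cat// PE cE muleA.
have key0 (phi : St -> \bar R) : (forall x, 0 <= phi x) ->
    \int[P]_w phi (X (T k w) w) =
    \sum_(t <oo) P (T k @^-1` [set t]) * \int[P]_w phi (X t w).
  move=> phi0; have nilP (p : I -> Prop) : {in [::], forall i, p i} by [].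
  have := key [::] (fun=> setT) isT (nilP _) (nilP _) phi phi0.
  by rewrite cyl_nil [X in _ = X * _]PsetT mul1e.
split=> //; split=> // s A us fs es phi phi0.
by rewrite key0// key.
Qed.

End SamplingTheory.

(** * Expectations along a run of the algorithm *)

Section Process.
Context {R : realType} {m n d : nat}.
Context (f : 'I_m -> 'I_n -> 'rV[R]_d -> R) (psi : 'rV[R]_d -> \bar R).
Context (W : 'M[R]_m) (lam2 : R) (b : nat) (eta : R) (M : nat).
Context (L l1 l2 sf sp delta gam : R).
Hypothesis H : setting f psi W lam2 b eta M L l1 l2 sf sp delta gam.
Context (tau : R) (x0 : 'rV[R]_d).
Context {dO : measure_display} {Omega : measurableType dO} (P : probability Omega R).
Context (T : nat -> Omega -> nat) (B : nat -> nat -> 'I_m -> 'I_b -> Omega -> 'I_n).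
Hypothesis samp : sampling P T B.

Local Notation istate := (@inner_state R m d).
Local Notation ostate := (@outer_state R m d).
Local Notation batch := {ffun 'I_m * 'I_b -> 'I_n}.
Local Notation xnew := (xnew W lam2 M tau).
Local Notation snew := (snew f W lam2 M tau).
Local Notation finish := (finish f W lam2 M tau).
Local Notation istep o := (istep (b := b) f psi W lam2 eta M (snew o) (xnew o)).
Local Notation oInv := (oInv f psi).
Local Notation p := ((ceil_div n b)%:R^-1 : R).

Definition outer_path (k : nat) (w : Omega) : ostate :=
  pmgt_katyushaX f psi W lam2 x0 eta tau M (T ^~ w) (fun k t i l => B k t i l w) k.

Definition istart (o : ostate) : istate :=
  ist0 (snew o) (xnew o) (out_sfo o + 2 * n) (out_comm o + 2 * M).

(** The inner loop is followed as if it never stopped, and the stopping time is inserted afterwards.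
    The outer state is carried along since it fixes the parameters of [istep]. *)
Definition ipath (k t : nat) (w : Omega) : ostate * istate :=
  (outer_path k w, inner_loop f psi W lam2 eta M (snew (outer_path k w)) (xnew (outer_path k w))
    (fun t i l => B k t i l w) (out_sfo (outer_path k w) + 2 * n)
    (out_comm (outer_path k w) + 2 * M) t).

Lemma ipathS k t w : ipath k t.+1 w =
  ((ipath k t w).1, istep (ipath k t w).1 (draw B k t w) (ipath k t w).2).
Proof.
have E : (fun i l => B k t i l w) = (fun i l => draw B k t w (i, l)).
  by apply/funext => i; apply/funext => l; rewrite ffunE.
transitivity (outer_path k w, inner_step f psi W lam2 eta M (snew (outer_path k w))
  (xnew (outer_path k w)) (fun i l => B k t i l w) (ipath k t w).2); first by [].
by rewrite E.
Qed.

Lemma ipath_indep k t : indep_future P T B k 0 (outer_path k) ->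
  indep_future P T B k t (ipath k t).
Proof.
move=> ik; elim: t => [|t IH].
  exact: (indep_future_map (fun o => (o, istart o)) ik).
have -> : ipath k t.+1 = (fun w => ((ipath k t w).1,
    istep (ipath k t w).1 (draw B k t w) (ipath k t w).2)).
  by apply/funext => w; rewrite ipathS.
exact: (indep_future_draw samp (fun x y => (y.1, istep y.1 x y.2)) IH).1.
Qed.

Lemma outer_path_indep k : indep_future P T B k 0 (outer_path k).
Proof.
elim: k => [|k IH]; first exact: indep_future_cst.
(* When [T k = t], the inner loop makes [t.+1] steps. *)
have iX t : indep_future P T B k t.+1 (fun w => finish (ipath k t.+1 w).1 (ipath k t.+1 w).2).
  exact: (indep_future_map (fun y => finish y.1 y.2) (ipath_indep t.+1 IH)).
exact: (indep_future_epoch samp iX).1.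
Qed.

Lemma outer_path_discrete k : discrete (outer_path k).
Proof. exact: (outer_path_indep k).1. Qed.

Lemma epoch_inv T' (bt : nat -> 'I_m -> 'I_b -> 'I_n) o :
  oInv o -> oInv (epoch f psi W lam2 eta tau M T' bt o).
Proof.
move=> io; split; last by rewrite /=; exact: (mean_snew H).
rewrite epochE /=.
set st := inner_loop _ _ _ _ _ _ _ _ _ _ _ _.
have -> : bt T' = (fun i l => [ffun x : 'I_m * 'I_b => bt T' x.1 x.2] (i, l)).
  by apply/funext => i; apply/funext => l; rewrite ffunE.
exact: (istep_dom H).
Qed.

Lemma outer_path_inv k w : psi x0 \is a fin_num -> oInv (outer_path k w).
Proof.
move=> dx0; elim: k => [|k IH]; last exact: epoch_inv.
split => /=.
  by rewrite (_ : \matrix_(i < m) x0 = bcast x0)// mean_bcast// (set_m H).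
by rewrite !(mean_bcast (set_m H)) (mean_grads_bcast (set_diff H)).
Qed.

Lemma expect_inner k t (h : ostate -> istate -> R) :
  (forall o st, 0 <= h o st) ->
  (\int[P]_w (h (ipath k t w).1 (ipath k t w).2)%:E =
   \int[P]_w (run (istep (outer_path k w)) t (h (outer_path k w)) (istart (outer_path k w)))%:E)%E.
Proof.
elim: t h => [//|t IH] h h0.
have [_ /(_ (fun y => (h y.1 y.2)%:E))] :=
  indep_future_draw samp (fun x y => (y.1, istep y.1 x y.2)) (ipath_indep t (outer_path_indep k)).
move=> E; transitivity (\int[P]_w
    (avg_step (istep (ipath k t w).1) (h (ipath k t w).1) (ipath k t w).2)%:E)%E; last first.
  rewrite (IH (fun o => avg_step (istep o) (h o))); last first.
    by move=> o st; apply: avg_ge0.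
  by apply: eq_integral => w _; rewrite runS.
under eq_integral do rewrite ipathS.
rewrite E; last by move=> y; rewrite lee_fin.
have mh (x : batch) : measurable_fun setT (fun w =>
    (h (ipath k t w).1 (istep (ipath k t w).1 x (ipath k t w).2))%:E).
  exact: (discrete_measurable_fun (fun y => (h y.1 (istep y.1 x y.2))%:E)
    measurableT (ipath_indep t (outer_path_indep k)).1).
have cE (x : batch) : ((#|{: batch}|%:R^-1)%:E * \int[P]_w (h (ipath k t w).1
      (istep (ipath k t w).1 x (ipath k t w).2))%:E =
    \int[P]_w ((#|{: batch}|%:R^-1)%:E * (h (ipath k t w).1
      (istep (ipath k t w).1 x (ipath k t w).2))%:E))%E.
  rewrite ge0_integralZl_EFin ?invr_ge0//; by move=> w _; rewrite lee_fin.
etransitivity; first by apply: eq_bigr => x _; exact: cE x.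
rewrite -ge0_integral_sum//; last 2 first.
- move=> x; apply: measurable_funeM; exact: mh.
- by move=> x w _; rewrite -EFinM lee_fin mulr_ge0// invr_ge0.
apply: eq_integral => w _; under eq_bigr do rewrite -EFinM.
by rewrite sumEFin -mulr_sumr.
Qed.

(** Lifts a bound on truncated sums, valid state by state, to expectations: the series over the
    values of [T k] is exchanged with the integral, and its partial sums are the [Sm]. *)
Lemma expect_epoch k (h : ostate -> R) (c e : R) : psi x0 \is a fin_num ->
  0 <= c -> 0 <= e -> (forall o, 0 <= h o) ->
  (forall o, oInv o -> forall N,
    Sm (istep o) p (istart o) N (fun st => h (finish o st)) <= c * h o + e) ->
  (\int[P]_w (h (outer_path k.+1 w))%:E <= c%:E * \int[P]_w (h (outer_path k w))%:E + e%:E)%E.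
Proof.
move=> dx0 c0 e0 h0 hS.
have iX t : indep_future P T B k t.+1 (fun w => finish (ipath k t.+1 w).1 (ipath k t.+1 w).2).
  exact: (indep_future_map (fun y => finish y.1 y.2) (ipath_indep t.+1 (outer_path_indep k))).
have [_ /(_ (fun o => (h o)%:E))] := indep_future_epoch samp iX.
move=> E.
have -> : (\int[P]_w (h (outer_path k.+1 w))%:E =
  \int[P]_w (h (finish (ipath k (T k w).+1 w).1 (ipath k (T k w).+1 w).2))%:E)%E by [].
rewrite E; last by move=> o; rewrite lee_fin.
pose u t (o : ostate) : R := (1 - p) ^+ t * p *
  run (istep o) t.+1 (fun st => h (finish o st)) (istart o).
have p0 : 0 <= p :> R by rewrite invr_ge0.
have p1 : p <= 1 :> R.
  have [->|/lt0n_neq0 t0] := posnP (ceil_div n b); first by rewrite invr0.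
  by rewrite invf_le1 ?ltr0n ?lt0n// ler1n lt0n.
have w0 t : 0 <= (1 - p) ^+ t * p by rewrite mulr_ge0// exprn_ge0// subr_ge0.
have u0 t o : 0 <= u t o.
  apply: mulr_ge0 (w0 t) _.
  apply: (run_ge0 (Inv := fun=> True) (batch_gt0 H)) => //.
have -> : (\sum_(t <oo) P (T k @^-1` [set t]) *
   \int[P]_w (h (finish (ipath k t.+1 w).1 (ipath k t.+1 w).2))%:E =
   \int[P]_w \sum_(t <oo) (u t (outer_path k w))%:E)%E.
  rewrite integral_nneseries//; last 2 first.
  - move=> t; exact: (discrete_measurable_fun (fun o => (u t o)%:E) measurableT (outer_path_discrete k)).
  - by move=> t w _; rewrite lee_fin.
  apply: eq_eseriesr => t _.
  rewrite (sampling_geom samp) (expect_inner k t.+1 (h := fun o st => h (finish o st)))//.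
  have mr : measurable_fun setT (fun w => (run (istep (outer_path k w)) t.+1
      (fun st => h (finish (outer_path k w) st)) (istart (outer_path k w)))%:E).
    exact: (discrete_measurable_fun (fun o => (run (istep o) t.+1
      (fun st => h (finish o st)) (istart o))%:E) measurableT (outer_path_discrete k)).
  rewrite -ge0_integralZl_EFin ?w0//.
  move=> w _; rewrite lee_fin.
  by apply: (run_ge0 (Inv := fun=> True) (batch_gt0 H)).
apply: (@le_trans _ _ (\int[P]_w (c * h (outer_path k w) + e)%:E)%E).
  have m1 : measurable_fun setT (fun w => \sum_(t <oo) (u t (outer_path k w))%:E)%E.
    exact: (discrete_measurable_fun (fun o => (\sum_(t <oo) (u t o)%:E)%E)
      measurableT (outer_path_discrete k)).
  have m2 : measurable_fun setT (fun w => (c * h (outer_path k w) + e)%:E).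
    exact: (discrete_measurable_fun (fun o => (c * h o + e)%:E) measurableT (outer_path_discrete k)).
  have u_le w : (\sum_(t <oo) (u t (outer_path k w))%:E <= (c * h (outer_path k w) + e)%:E)%E.
    apply: lime_le; first by apply: is_cvg_nneseries => t _ _; rewrite lee_fin.
    apply: nearW => N; rewrite big_mkord sumEFin lee_fin.
    exact: hS (outer_path_inv k w dx0) N.
  have g1 w : (0 <= \sum_(t <oo) (u t (outer_path k w))%:E)%E.
    by apply: nneseries_ge0 => t _ _; rewrite lee_fin.
  apply: (@ge0_le_integral _ _ _ P setT measurableT _ _ _ m1 m2).
  - by move=> w _; exact: g1.
  - by move=> w _; exact: u_le.
have mh : measurable_fun setT (fun w => (h (outer_path k w))%:E).
  exact: (discrete_measurable_fun (fun o => (h o)%:E) measurableT (outer_path_discrete k)).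
under eq_integral do rewrite EFinD EFinM.
rewrite ge0_integralD//; last 2 first.
- by move=> w _; rewrite mule_ge0// lee_fin.
- exact: measurable_funeM.
rewrite integral_cst// ge0_integralZl_EFin//; last by move=> w _; rewrite lee_fin.
by rewrite leeD2l// [X in (_ * X)%E]probability_setT mule1.
Qed.

End Process.

Lemma ceil_div_gt0 n b : (0 < n)%N -> (0 < b)%N -> (0 < ceil_div n b)%N.
Proof.
move=> n0 b0; rewrite /ceil_div; have [bn|] := boolP (b %| n)%N; last by rewrite addn1.
by rewrite addn0 divn_gt0// dvdn_leq.
Qed.

(** * Expected costs and expected suboptimality *)

Section Results.
Context {R : realType} {m n d : nat}.
Context (f : 'I_m -> 'I_n -> 'rV[R]_d -> R) (psi : 'rV[R]_d -> \bar R).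
Context (W : 'M[R]_m) (lam2 : R) (b : nat) (eta : R) (M : nat).
Context (L l1 l2 sf sp delta gam : R).
Hypothesis H : setting f psi W lam2 b eta M L l1 l2 sf sp delta gam.
Context (tau : R) (x0 xs : 'rV[R]_d).
Context {dO : measure_display} {Omega : measurableType dO} (P : probability Omega R).
Context (T : nat -> Omega -> nat) (B : nat -> nat -> 'I_m -> 'I_b -> Omega -> 'I_n).
Hypothesis samp : sampling P T B.
Hypotheses (dom_x0 : psi x0 \is a fin_num) (dom_xs : psi xs \is a fin_num).

Local Notation istate := (@inner_state R m d).
Local Notation ostate := (@outer_state R m d).
Local Notation batch := {ffun 'I_m * 'I_b -> 'I_n}.
Local Notation xnew := (xnew W lam2 M tau).
Local Notation snew := (snew f W lam2 M tau).
Local Notation finish := (finish f W lam2 M tau).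
Local Notation istep o := (istep (b := b) f psi W lam2 eta M (snew o) (xnew o)).
Local Notation istart := (istart f W lam2 M tau).
Local Notation oInv := (oInv f psi).
Local Notation objr := (objr f psi).
Local Notation sigma := (sf + sp).
Local Notation t0 := (ceil_div n b).
Local Notation p := (t0%:R^-1 : R).
Local Notation outer_path := (outer_path f psi W lam2 eta M tau x0 T B).
Local Notation pot := (pot f psi eta sf sp tau xs).
Local Notation weight := (weight sf sp tau).
Local Notation c1 := (c1 b eta l1 l2 gam).
Local Notation c2 := (c2 eta l2 sf sp).
Local Notation Lam := (Lam eta l2).

Hypothesis xs_min : forall x, psi x \is a fin_num -> objr xs <= objr x.

Lemma stop_prob : 0 < p /\ p <= 1.
Proof.
have t0 := ceil_div_gt0 (set_n H) (set_b H).
by rewrite invr_gt0 ltr0n t0 invf_le1 ?ltr0n// ler1n.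
Qed.

Lemma run_add {A : finType} {St : Type} (stp : A -> St -> St) (h : St -> R) (c : R) t st :
  (0 < #|A|)%N -> (forall x st, h (stp x st) = h st + c) ->
  run stp t h st = h st + t%:R * c.
Proof.
move=> A0 hc; rewrite /run; elim: t st => [|t IH] st; first by rewrite mul0r addr0.
rewrite iterS {1}/avg_step; under eq_avg do rewrite IH hc.
by rewrite avg_cst// -[in RHS]natr1; ring.
Qed.

(** The increments are constant, so only the mean number [t0] of inner steps matters. *)
Lemma Sm_add (h : istate -> R) (c : R) o N : 0 <= c -> (forall st, 0 <= h st) ->
  (forall x st, h (istep o x st) = h st + c) ->
  Sm (istep o) p (istart o) N h <= h (istart o) + t0%:R * c.
Proof.
move=> c0 h0 hc; have [p0 p1] := stop_prob.
have -> : Sm (istep o) p (istart o) N h =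
  (1 - (1 - p) ^+ N) * h (istart o) + (\sum_(t < N) (1 - p) ^+ t * p * t.+1%:R) * c.
  rewrite -geom_mass !mulr_suml -big_split; apply: eq_bigr => t _.
  by rewrite (run_add _ _ (batch_gt0 H) hc) mulrDr mulrA.
apply: lerD.
  by rewrite ler_piMl// gerBl exprn_ge0// subr_ge0.
by rewrite ler_wpM2r//; have := geom_mean_le p0 p1 N; rewrite invrK.
Qed.

Lemma expect_linear_cost (h : ostate -> R) (e : R) K : 0 <= e -> (forall o, 0 <= h o) ->
  (forall o N, Sm (istep o) p (istart o) N (fun st => h (finish o st)) <= h o + e) ->
  (\int[P]_w (h (outer_path K w))%:E <= (h (initial_state f x0) + K%:R * e)%:E)%E.
Proof.
move=> e0 h0 hS; elim: K => [|K IH].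
  rewrite /= mul0r addr0 [leLHS](_ : _ = \int[P]_w cst (h (initial_state f x0))%:E w)%E//.
  by rewrite integral_cst// [X in (_ * X)%E]probability_setT mule1.
apply: le_trans (expect_epoch H samp (h := h) (c := 1) (e := e) K dom_x0 ler01 e0 h0 _) _.
  by move=> o _ N; rewrite mul1r.
rewrite mul1e -natr1 mulrDl mul1r addrA [leRHS]EFinD leeD2r//.
Qed.

Lemma expect_sfo K :
  (\int[P]_w (out_sfo (outer_path K w))%:R%:E <=
   (n%:R + K%:R * (2 * n%:R + 2 * b%:R * t0%:R))%:E)%E.
Proof.
apply: (expect_linear_cost (h := fun o => (out_sfo o)%:R)) => //.
move=> o N; apply: le_trans (Sm_add (h := fun st => (in_sfo st)%:R) (c := (2 * b)%:R) _ _ _ _) _ => //.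
  by move=> x st; rewrite -natrD.
rewrite /= natrD !natrM; lra.
Qed.

Lemma expect_comm K :
  (\int[P]_w (out_comm (outer_path K w))%:R%:E <=
   (K%:R * (3 * M%:R + 2 * M%:R * t0%:R))%:E)%E.
Proof.
have := expect_linear_cost (h := fun o => (out_comm o)%:R) (e := 3 * M%:R + 2 * M%:R * t0%:R) K.
rewrite /= add0r; apply => //.
move=> o N.
(* The extra [M] is the last mixing, done by [finish]; the shifted count is additive along the inner
   loop. *)
have hc (x : batch) st : (in_comm (istep o x st) + M)%:R = (in_comm st + M)%:R + (2 * M)%:R :> R.
  by rewrite -natrD /= addnAC.
apply: le_trans (Sm_add (h := fun st => (in_comm st + M)%:R) (c := (2 * M)%:R) _ _ _ hc) _ => //.
rewrite [in_comm _]/= natrM (natrD _ _ M) (natrD _ _ (2 * M)) (natrM _ 2 M); lra.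
Qed.

Hypotheses (tau_gt0 : 0 < tau) (tau_le1 : tau <= 1).
Hypothesis tauE : tau ^+ 2 * (p / eta) = sigma / 4.
Hypothesis R1 : c1 + 2 * gam * c2 + 4 * gam * weight <= p / eta / 4.
Hypothesis R3 : 3 * delta <= tau ^+ 2.
Hypothesis R3' : 12 * delta <= 1.
Hypothesis R4 : (4 * c2 + 6 * weight) * (delta * (2 + 8 * Lam ^+ 2)) <= weight / 4.

(** [expect_epoch] asks for a function nonnegative on all states, while [pot] is known to be so only
    when the average of [out_y] is in the domain of [psi]. *)
Let potp (o : ostate) : R := Num.max 0 (pot o).

Lemma expect_pot K :
  (\int[P]_w (potp (outer_path K w))%:E <=
   ((1 - tau / 4) ^+ K * potp (initial_state f x0))%:E)%E.
Proof.
have [p0 p1] := stop_prob.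
have tau4 : 0 <= 1 - tau / 4 by have := tau_le1; lra.
have potpE o : psi (mean (out_y o)) \is a fin_num -> potp o = pot o.
  move=> dy; rewrite /potp; apply/max_idPr.
  exact: (pot_ge0 H tau_gt0 xs_min).
elim: K => [|K IH].
  rewrite /= mul1r [leLHS](_ : _ = \int[P]_w cst (potp (initial_state f x0))%:E w)%E//.
  by rewrite integral_cst// [X in (_ * X)%E]probability_setT mule1.
have hS o : oInv o -> forall N,
    Sm (istep o) p (istart o) N (fun st => potp (finish o st)) <=
    (1 - tau / 4) * potp o + 0.
  move=> io N; rewrite addr0 (potpE o io.1).
  have -> : Sm (istep o) p (istart o) N (fun st => potp (finish o st)) =
            Sm (istep o) p (istart o) N (fun st => pot (finish o st)).
    apply: eq_bigr => t _; rewrite !runS; congr (_ * run _ _ _ _).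
    apply/funext => st; apply: eq_avg => x; apply: potpE; exact: istep_dom H _ _ _ _.
  exact: (pot_contract H p0 p1 tau_gt0 tau_le1 dom_xs tauE xs_min R1 R3 R3' R4 _ _ N io).
have hp o : 0 <= potp o by rewrite /potp le_max lexx.
apply: le_trans (expect_epoch H samp K dom_x0 tau4 (lexx 0) hp hS) _.
rewrite adde0 exprS -mulrA [leRHS]EFinM lee_wpmul2l//.
Qed.

Lemma objective_gap x : psi x \is a fin_num ->
  (objective f psi x - objective f psi xs)%E = (objr x - objr xs)%:E.
Proof.
by move=> dx; rewrite /objective -(fineK dx) -(fineK dom_xs) -!EFinD.
Qed.

Lemma expect_gap K :
  (\int[P]_w (objective f psi (mean (out_y (outer_path K w))) - objective f psi xs) <=
   ((1 - tau / 4) ^+ K * (2 * (objr x0 - objr xs)))%:E)%E.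
Proof.
have [p0 p1] := stop_prob.
have gapE w : (objective f psi (mean (out_y (outer_path K w))) - objective f psi xs)%E =
    (objr (mean (out_y (outer_path K w))) - objr xs)%:E.
  by apply: objective_gap; have [] := outer_path_inv H tau T B K w dom_x0.
under eq_integral do rewrite gapE.
apply: (@le_trans _ _ (\int[P]_w (potp (outer_path K w))%:E)%E).
  have pd : discrete (outer_path K) by apply: outer_path_discrete; exact: samp.
  apply: (@ge0_le_integral _ _ _ P setT measurableT).
  - move=> w _; rewrite lee_fin subr_ge0; apply: xs_min.
    by have [] := outer_path_inv H tau T B K w dom_x0.
  - exact: (discrete_measurable_fun (fun o => (objr (mean (out_y o)) - objr xs)%:E) measurableT pd).
  - exact: (discrete_measurable_fun (fun o => (potp o)%:E) measurableT pd).
  - by move=> w _; rewrite lee_fin /potp le_max (pot_gap H _ tau_gt0) orbT.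
apply: le_trans (expect_pot K) _; rewrite lee_fin ler_wpM2l ?exprn_ge0//.
  by have := tau_le1; lra.
rewrite /potp ge_max mulr_ge0 ?subr_ge0 ?xs_min//=.
exact: (pot_bcast H tau_gt0 dom_xs xs_min _ _ _ dom_x0 tau_le1).
Qed.

(** The objective has no sign, so its integral is split only after integrability is derived from the
    bounded integral of the nonnegative gap. *)
Lemma expect_objective K :
  (\int[P]_w objective f psi (mean (out_y (outer_path K w))) - objective f psi xs <=
   ((1 - tau / 4) ^+ K * (2 * (objr x0 - objr xs)))%:E)%E.
Proof.
have dy w : psi (mean (out_y (outer_path K w))) \is a fin_num.
  by have [] := outer_path_inv H tau T B K w dom_x0.
have pd : discrete (outer_path K) by apply: outer_path_discrete; exact: samp.
pose g w := (objr (mean (out_y (outer_path K w))) - objr xs)%:E.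
have gE w : (objective f psi (mean (out_y (outer_path K w))) = g w + (objr xs)%:E)%E.
  by rewrite /g -EFinD subrK /objective -(fineK (dy w)) -EFinD.
have mg : measurable_fun setT g.
  exact: (discrete_measurable_fun (fun o => (objr (mean (out_y o)) - objr xs)%:E) measurableT pd).
have g0 w : (0 <= g w)%E by rewrite lee_fin subr_ge0; apply: xs_min.
have gle := expect_gap K.
have {}gle : (\int[P]_w g w <= ((1 - tau / 4) ^+ K * (2 * (objr x0 - objr xs)))%:E)%E.
  apply: le_trans gle; rewrite le_eqVlt; apply/orP; left; apply/eqP.
  by apply: eq_integral => w _; rewrite objective_gap.
have ig : P.-integrable setT g.
  apply/integrableP; split=> //; apply: le_lt_trans (ltry ((1 - tau / 4) ^+ K * (2 * (objr x0 - objr xs)))).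
  apply: le_trans gle; rewrite le_eqVlt; apply/orP; left; apply/eqP.
  by apply: eq_integral => w _; rewrite gee0_abs.
under eq_integral do rewrite gE.
rewrite integralD//; last exact: finite_measure_integrable_cst.
rewrite integral_cst// [X in (_ * X)%E]probability_setT mule1.
have -> : objective f psi xs = (objr xs)%:E by rewrite /objective -(fineK dom_xs) -EFinD.
by rewrite addeK.
Qed.

End Results.

(** * Choice of the parameters *)

Section BatchSize.
Context {R : realType} {n b : nat}.
Hypotheses (n_gt0 : (0 < n)%N) (b_gt0 : (0 < b)%N).
Local Notation t0 := (ceil_div n b).

Lemma ceil_div_bounds : [/\ (n <= t0 * b)%N, (t0 * b <= n + b)%N & (t0 <= n)%N].
Proof.
have e := divn_eq n b; have r := ltn_pmod n b_gt0.
rewrite /ceil_div; have [bn|nbn] := boolP (b %| n)%N.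
  rewrite addn0 divnK//; split=> //; last exact: leq_div.
  exact: leq_addr.
have b1 : (1 < b)%N.
  by case: b b_gt0 nbn {e r} => [|[|b']]//; rewrite dvd1n.
rewrite addn1 mulSn; split.
- by rewrite [X in (X <= _)%N]e addnC leq_add2r ltnW.
- by rewrite addnC leq_add2r leq_divM.
- exact: ltn_Pdiv.
Qed.

Local Notation rt := (Num.sqrt n%:R : R).
Hypothesis b_sqrt : `|b%:R - rt| < 1.

(** [t0 <= 5 b] serves the variance term, the bound on [b * t0] the oracle calls of an inner loop,
    and the two-sided bound the momentum and the communication rounds. *)
Lemma batch_size_bounds : [/\ 1 <= rt, rt ^+ 2 = n%:R, (t0%:R : R) <= 5 * b%:R,
  (b%:R : R) * t0%:R <= 3 * n%:R & rt / 2 <= t0%:R <= 3 * rt].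
Proof.
have [h1 h2 _] := ceil_div_bounds.
have r2 : rt ^+ 2 = n%:R by rewrite sqr_sqrtr.
have r1 : 1 <= rt by rewrite -[leLHS]sqrtr1 ler_wsqrtr ?ler1n.
have b1 : 1 <= b%:R :> R by rewrite ler1n.
move: h1 h2 b_sqrt; rewrite -(ler_nat R n) -(ler_nat R (_ * _)) natrM natrD ltr_norml => h1 h2 /andP[b2 b3].
move: r1 b1 h1 h2 b2 b3 r2; move: (t0%:R) (b%:R) rt => t c r r1 c1 + + b2 b3 r2.
rewrite -r2 => h1 h2.
have rc : r <= 2 * c by lra.
have cr : c <= 2 * r by lra.
have rr : r ^+ 2 <= (2 * c) ^+ 2 by rewrite ler_pXn2r ?nnegrE//; lra.
have c0 : 0 < c by lra.
have r0 : 0 < r by lra.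
split=> //.
- rewrite -(ler_pM2r c0); apply: le_trans h2 _; have : c * 1 <= c * c by rewrite ler_pM2l.
  by rewrite expr2 in rr; rewrite expr2; lra.
- rewrite mulrC; apply: le_trans h2 _; have : r * 1 <= r * r by rewrite ler_pM2l.
  rewrite expr2; lra.
- apply/andP; split; rewrite -(ler_pM2r c0).
    apply: le_trans h1; have : r * c <= r * (2 * r) by rewrite ler_pM2l.
    by rewrite expr2; lra.
  apply: le_trans h2 _; have : r * r <= r * (2 * c) by rewrite ler_pM2l.
  have : 1 * c <= r * c by rewrite ler_pM2r.
  by rewrite expr2; lra.
Qed.

End BatchSize.

(** [e] stands for [eta * s], [l] for the squared [Lam], [X] for [cond]. As [gam] is at least of
    order [X^-4] and [1 + l] at most of order [X^2], [delta] has to be of order [X^-10]; three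
    further powers, each at most [1 / (14 * 14)], absorb the constants. *)
Lemma consensus_arith {R : realType} (X e l t B gam delta : R) :
  14 * 14 <= X -> 0 < e -> e^-1 <= X -> 0 <= l -> l <= X ^+ 2 -> 1 <= t -> t <= X ->
  B = 2 * l / e + 4 * l + 2 -> gam = (8 * t * (5 + 2 * B))^-1 ->
  delta = (X ^+ 13)^-1 ->
  [/\ 0 < gam, gam <= 1 / 2, gam * t * (5 + 2 * B) = 1 / 8,
     12 * delta <= gam / (8 * (1 + l)) * gam
   & [/\ 0 < delta, 12 * delta <= e
     & (16 * 96 * B / e ^+ 2 + 6) * (delta * (2 + 8 * l)) <= 1 / 4]].
Proof.
move=> X_ge e0 eX l0 lX t1 tX BE gE dE.
have X1 : 1 <= X by lra.
have X0 : 0 < X by lra.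
have Xk k : 1 <= X ^+ k by rewrite exprn_ege1.
have Xm j k : (j <= k)%N -> X ^+ j <= X ^+ k by move=> jk; rewrite ler_weXn2l.
have ei0 : 0 < e^-1 by rewrite invr_gt0.
have B0 : 0 <= B by rewrite BE -mulrA; have := mulr_ge0 l0 (ltW ei0); lra.
have BX : B <= 8 * X ^+ 3.
  have : l / e <= X ^+ 3 by rewrite exprSr ler_pM// ltW.
  by rewrite BE -mulrA; have := Xm 2%N 3%N isT; have := Xk 3%N; lra.
have t0 : 0 < t by lra.
have tB : 0 < 8 * t * (5 + 2 * B) by rewrite !mulr_gt0//; lra.
have g0 : 0 < gam by rewrite gE invr_gt0.
have gK : gam * (8 * t * (5 + 2 * B)) = 1 by rewrite gE mulVf// gt_eqF.
have gX : 1 <= gam * (12 * 14 * X ^+ 4).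
  rewrite -[leLHS]gK ler_pM2l//.
  have : t * (5 + 2 * B) <= X * (21 * X ^+ 3) by rewrite ler_pM//; have := Xk 3%N; lra.
  by rewrite (exprS X 3); lra.
have d0 : 0 < delta by rewrite dE invr_gt0 exprn_gt0.
pose c := X^-1; have c0 : 0 < c by rewrite invr_gt0.
have cX : c * X = 1 by rewrite mulVf// gt_eqF.
have c_le : 14 * 14 * c <= 1 by rewrite -[leRHS]cX mulrC ler_pM2l.
have dX : delta * X ^+ 10 = c ^+ 3.
  by rewrite dE (exprD X 3 10) invfM exprVn divfK// gt_eqF// exprn_gt0.
have c3 : c ^+ 3 <= c.
  by rewrite (exprS c 2) ler_piMr ?(ltW c0)// exprn_ile1 ?(ltW c0)//; lra.
have dk k : (k <= 10)%N -> delta * X ^+ k <= c ^+ 3.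
  by move=> k10; rewrite -dX ler_pM2l// Xm.
split=> //; last split=> //.
- rewrite -(ler_pM2r tB) gK.
  have : 1 * 5 <= t * (5 + 2 * B) by rewrite ler_pM//; lra.
  lra.
- by move: gK; clear; lra.
- have l8 : 0 < 8 * (1 + l) by lra.
  rewrite mulrAC ler_pdivlMr//.
  have : 1 <= gam * gam * ((12 * 14) ^+ 2 * X ^+ 8).
    have -> : gam * gam * ((12 * 14) ^+ 2 * X ^+ 8) =
      (gam * (12 * 14 * X ^+ 4)) * (gam * (12 * 14 * X ^+ 4)) by ring.
    by rewrite -[leLHS]mulr1 ler_pM.
  move=> h; have X8 : 0 < (12 * 14) ^+ 2 * X ^+ 8 by rewrite mulr_gt0 ?exprn_gt0.
  rewrite -(ler_pM2r X8); apply: le_trans h.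
  have l2X : 1 + l <= 2 * X ^+ 2 by have := Xk 2%N; lra.
  apply: le_trans (_ : _ <= 12 * delta * (8 * (2 * X ^+ 2)) * ((12 * 14) ^+ 2 * X ^+ 8)) _.
    by rewrite ler_pM2r// ler_pM2l ?mulr_gt0//; lra.
  have -> : 12 * delta * (8 * (2 * X ^+ 2)) * ((12 * 14) ^+ 2 * X ^+ 8) =
    12 * 16 * (12 * 14) ^+ 2 * (delta * X ^+ 10) by ring.
  have -> : 12 * 16 * (12 * 14) ^+ 2 * (delta * X ^+ 10) = (12 * 16 * c) * ((12 * 14 * c) * (12 * 14 * c)).
    by rewrite dX; ring.
  have a0 : 0 <= 12 * 14 * c by lra.
  have a1 : 12 * 14 * c <= 1 by lra.
  have a2 := mulr_ile1 a0 a0 a1 a1.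
  have b1 : 12 * 16 * c <= 1 by lra.
  apply: mulr_ile1 _ _ b1 a2; [lra|exact: mulr_ge0].
- rewrite -(ler_pM2r X0); have := dk 1%N isT; rewrite expr1.
  have : 1 <= e * X by rewrite -(mulfV (lt0r_neq0 e0)) ler_pM2l.
  lra.
- have h1 : 16 * 96 * B / e ^+ 2 + 6 <= 10 * 10 * X ^+ 6.
    have : B / e ^+ 2 <= (8 * X ^+ 3) * X ^+ 2.
      rewrite -exprVn ler_pM// ?exprn_ge0 ?(ltW ei0)//.
      by rewrite ler_pXn2r// nnegrE ltW.
    rewrite -[leRHS]mulrA -exprD => hB.
    have : 14 * 14 * X ^+ 5 <= X ^+ 6 by rewrite (exprS X 5) ler_pM2r// exprn_gt0.
    by have := Xk 5%N; rewrite -[16 * 96 * B / _]mulrA; lra.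
  have h2 : 2 + 8 * l <= 10 * X ^+ 2 by have := Xk 2%N; lra.
  have h3 : delta * (2 + 8 * l) <= delta * (10 * X ^+ 2) by rewrite ler_pM2l.
  have h4 : 0 <= delta * (2 + 8 * l) by apply: mulr_ge0 (ltW d0) _; lra.
  have h5 : 0 <= 10 * 10 * X ^+ 6 by have := Xk 6%N; lra.
  apply: le_trans (ler_wpM2r h4 h1) _; apply: le_trans (ler_wpM2l h5 h3) _.
  have -> : 10 * 10 * X ^+ 6 * (delta * (10 * X ^+ 2)) = 10 * 10 * 10 * (delta * X ^+ 8) by ring.
  have c23 : 14 * 14 * c ^+ 3 <= c.
    rewrite (exprS c 2) mulrA; apply: le_trans (_ : _ <= c ^+ 2) _.
      by rewrite ler_piMl ?exprn_ge0// ltW.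
    by rewrite expr2 ler_piMr// ?(ltW c0)//; lra.
  by have := dk 8%N isT; lra.
Qed.

Section StepSizeChoice.
Context {R : realType}.
Context (L l1 l2 s t N : R).
Hypotheses (L_ge0 : 0 <= L) (l1_gt0 : 0 < l1) (l12 : l1 <= l2) (s_gt0 : 0 < s).
Hypotheses (t_ge1 : 1 <= t) (t_leN : t <= N).

Local Notation r := (Num.sqrt (l1 * l2)).

Definition step_size : R := (16 * (L + r + s * t))^-1.
Local Notation eta := step_size.

(** Solves [tau ^+ 2 * (p / eta) = s / 4] for [p = 1 / t], the relation assumed in the epoch
    analysis. *)
Definition momentum : R := Num.sqrt (eta * s * t) / 2.
Local Notation tau := momentum.

(* Dominates [t], [1 / (eta s)] and [eta l2]; the factor [14 * 14] absorbs the
   numerical constants of [consensus_arith]. *)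
Definition cond : R := 14 * 14 * ((1 + L / s) * (1 + l2 / s) * N).
Local Notation X := cond.

Definition mixing_acc : R := (X ^+ 13)^-1.
Local Notation delta := mixing_acc.

Local Notation lam := ((eta * l2) ^+ 2).
Local Notation B1 := (2 * lam / (eta * s) + 4 * lam + 2).

(** [B1] is [eta * c2]. After multiplication by [eta * t], the condition on [c1] has the budget
    [1 / 4], and this choice spends half of it: [gam * t * (5 + 2 * B1) = 1 / 8]. *)
Definition consensus_rate : R := (8 * t * (5 + 2 * B1))^-1.
Local Notation gam := consensus_rate.

Lemma step_size_gt0 : 0 < eta.
Proof.
have := sqrtr_ge0 (l1 * l2); have : 0 < s * t by rewrite mulr_gt0//; have := t_ge1; lra.
by have := L_ge0; move=> ? ? ?; rewrite invr_gt0 mulr_gt0//; lra.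
Qed.

Lemma step_size_le : [/\ eta * L <= 1 / 16, eta * r <= 1 / 16 & eta * (s * t) <= 1 / 16].
Proof.
have e0 := step_size_gt0; have r0 := sqrtr_ge0 (l1 * l2).
have st : 0 < s * t by rewrite mulr_gt0//; have := t_ge1; lra.
have S : eta * (L + r + s * t) = 1 / 16.
  by rewrite /step_size; field; have := L_ge0; apply: contraPN => /eqP; lra.
move: S; have := mulr_ge0 (ltW e0) L_ge0; have := mulr_ge0 (ltW e0) r0.
have := mulr_ge0 (ltW e0) (ltW st); move: eta r (s * t) => e q u.
by rewrite !mulrDr => ? ? ? ?; split; lra.
Qed.

Lemma sqrt_l12_le : 0 < r /\ r <= l2.
Proof.
split; first by rewrite sqrtr_gt0 mulr_gt0//; have := l1_gt0; have := l12; lra.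
have l20 : 0 <= l2 by have := l1_gt0; have := l12; lra.
apply: le_trans (_ : _ <= Num.sqrt (l2 ^+ 2)) _; last by rewrite sqrtr_sqr ger0_norm.
by rewrite ler_wsqrtr// expr2 ler_wpM2r.
Qed.

Lemma cond_bounds : [/\ 14 * 14 <= X, t <= X, (eta * s)^-1 <= X & eta * l2 <= X].
Proof.
have [r0 rl] := sqrt_l12_le; have e0 := step_size_gt0; have [_ _ es] := step_size_le.
have t1 := t_ge1; have tN := t_leN; have l20 : 0 < l2 by lra.
have Ls : 0 <= L / s by rewrite divr_ge0// ltW.
have ls : 0 <= l2 / s by rewrite divr_ge0// ltW.
have XE : 14 * 14 * (L / s + l2 / s + N) <= X.
  rewrite /cond ler_pM2l//; have := mulr_ge0 Ls ls.
  have N1 : 0 <= N - 1 by lra.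
  have := mulr_ge0 Ls N1; have := mulr_ge0 ls N1.
  have := mulr_ge0 (mulr_ge0 Ls ls) (ltac:(lra) : 0 <= N).
  by move: (L / s) (l2 / s) => x y *; lra.
split; try lra.
- have -> : (eta * s)^-1 = 16 * (L / s + r / s + t).
    by rewrite invfM /step_size invrK; field; rewrite gt_eqF.
  have : r / s <= l2 / s by rewrite ler_pM2r// invr_gt0.
  lra.
- have -> : eta * l2 = (eta * s) * (l2 / s) by field; rewrite gt_eqF.
  have : eta * s <= 1.
    have : eta * s * 1 <= eta * s * t by rewrite ler_pM2l// mulr_gt0.
    by rewrite -!mulrA; lra.
  have es0 : 0 <= eta * s by rewrite mulr_ge0// ltW.
  move=> es1; have : eta * s * (l2 / s) <= l2 / s by rewrite ler_piMl.
  lra.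
Qed.

Lemma momentum_sqr : tau ^+ 2 * (t^-1 / eta) = s / 4.
Proof.
have e0 := step_size_gt0.
rewrite /momentum exprMn sqr_sqrtr; last by rewrite !mulr_ge0// ltW//; have := t_ge1; lra.
field; have := t_ge1; lra.
Qed.

Lemma momentum_sqrE : 4 * tau ^+ 2 = eta * (s * t).
Proof.
have e0 := step_size_gt0.
rewrite /momentum exprMn sqr_sqrtr; last by rewrite !mulr_ge0// ltW//; have := t_ge1; lra.
by field.
Qed.

Lemma momentum_gt0_le1 : 0 < tau /\ tau <= 1.
Proof.
have e0 := step_size_gt0; have [_ _ est] := step_size_le; have t1 := t_ge1.
have tau0 : 0 < tau by rewrite divr_gt0// sqrtr_gt0 !mulr_gt0//; lra.
split=> //; rewrite -(@ler_pXn2r _ 2)// ?nnegrE ?(ltW tau0)// expr1n.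
by have := momentum_sqrE; lra.
Qed.

(** [beta] is the batch size; [t <= 5 * beta] bounds the variance term
    [eta ^+ 2 * (l1 * l2) * (t / beta)]. *)
Lemma parameter_facts (beta : R) : t <= 5 * beta ->
  let h := s * tau / 96 in let c := B1 / eta in
  [/\ 0 < gam, gam <= 1 / 2, 12 * delta <= gam / (8 * (1 + lam)) * gam,
      2 * eta * (l1 * l2) / beta + gam / eta + 2 * gam * c + 4 * gam * h
        <= t^-1 / eta / 4
   & [/\ 0 < delta, 3 * delta <= tau ^+ 2, 12 * delta <= 1
     & (4 * c + 6 * h) * (delta * (2 + 8 * lam)) <= h / 4]].
Proof.
move=> tb h c; have e0 := step_size_gt0; have t1 := t_ge1.
have [_ er est] := step_size_le; have [r0 rl] := sqrt_l12_le.
have [X_ge tX eX lX] := cond_bounds; have [tau0 tau1] := momentum_gt0_le1.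
have es0 : 0 < eta * s by rewrite mulr_gt0.
have L0 : 0 <= lam by exact: sqr_ge0.
have l20 : 0 <= l2 by lra.
have X0 : 0 <= X by lra.
have lX2 : lam <= X ^+ 2.
  by rewrite ler_pXn2r// nnegrE ?(mulr_ge0 (ltW e0) l20).
have [g0 g1 gE gd [d0 de dB]] : [/\ 0 < gam, gam <= 1 / 2, gam * t * (5 + 2 * B1) = 1 / 8,
    12 * delta <= gam / (8 * (1 + lam)) * gam
  & [/\ 0 < delta, 12 * delta <= eta * s
    & (16 * 96 * B1 / (eta * s) ^+ 2 + 6) * (delta * (2 + 8 * lam)) <= 1 / 4]].
  exact: consensus_arith X_ge es0 eX L0 lX2 t1 tX erefl erefl erefl.
clear X_ge X0 lX2 tX eX lX.
have t0 : 0 < t by lra.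
have beta0 : 0 < beta by lra.
have es_le : eta * s <= eta * (s * t) by rewrite mulrA ler_peMr// ltW.
have tauE := momentum_sqrE.
have tau2 : tau ^+ 2 <= tau by rewrite expr2 ler_piMr// ltW.
have h0 : 0 < h by rewrite divr_gt0// mulr_gt0.
have B0 : 0 <= B1.
  rewrite -mulrA; have := mulr_ge0 L0 (ltac:(rewrite invr_ge0 ltW) : 0 <= (eta * s)^-1); lra.
have tau2d : 12 * delta <= 4 * tau ^+ 2 by rewrite tauE; exact: le_trans de es_le.
have d1 : 12 * delta <= 1.
  by apply: le_trans de (le_trans es_le (le_trans est _)); lra.
split=> //; last split=> //.
- have l120 : 0 <= l1 * l2 by rewrite mulr_ge0// ltW.
  have l12E : eta ^+ 2 * (l1 * l2) <= 1 / (16 * 16).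
    have -> : eta ^+ 2 * (l1 * l2) = (eta * r) ^+ 2 by rewrite exprMn (sqr_sqrtr l120).
    have -> : 1 / (16 * 16) = (1 / 16) ^+ 2 :> R by field.
    by rewrite ler_pXn2r ?nnegrE// ?mulr_ge0// ltW.
  have tb5 : t / beta <= 5 by rewrite ler_pdivrMr//; lra.
  have tb0 : 0 <= t / beta by rewrite divr_ge0//; lra.
  have et0 : 0 < eta * t by rewrite mulr_gt0//; lra.
  rewrite -(ler_pM2r et0).
  have -> : t^-1 / eta / 4 * (eta * t) = 1 / 4 by field; rewrite !gt_eqF.
  have -> : (2 * eta * (l1 * l2) / beta + gam / eta + 2 * gam * c + 4 * gam * h) * (eta * t) =
    2 * (eta ^+ 2 * (l1 * l2) * (t / beta)) + gam * t * (1 + 2 * B1) +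
    4 * (gam * t) * (eta * h).
    by rewrite /c; field; rewrite !gt_eqF.
  have p1 : eta ^+ 2 * (l1 * l2) * (t / beta) <= 1 / (16 * 16) * 5.
    apply: ler_pM => //; exact: mulr_ge0 (sqr_ge0 _) l120.
  have p2 : eta * h <= 1.
    have : eta * s * tau <= eta * s * 1 by rewrite ler_pM2l.
    by rewrite /h; lra.
  have gt0 : 0 < gam * t by rewrite mulr_gt0//; lra.
  have p3 : gam * t * (eta * h) <= gam * t * 1 by rewrite ler_pM2l.
  move: gE p1 p3; move: (gam * t) B1 (eta * h) (_ * _ * (t / beta)) => g B x y gE p1 p3.
  by lra.
- by move: tau2d d0; move: delta (tau ^+ 2) => x y; lra.
(* From [eta s <= eta s t = 4 tau^2 <= 4 tau]: the weight [h] is not too small compared with [c]. *)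
- have hs : eta * s ^+ 2 <= 4 * 96 * h.
    have -> : eta * s ^+ 2 = s * (eta * s) by ring.
    have -> : 4 * 96 * h = s * (4 * tau) by rewrite /h; field.
    by rewrite ler_pM2l//; lra.
  move: dB; rewrite -[16 * 96 * B1 / _]mulrA; set Z := B1 / _ => dB.
  have hc : c <= 4 * 96 * h * Z.
    have -> : c = eta * s ^+ 2 * Z by rewrite /c /Z; field; rewrite !gt_eqF.
    by rewrite ler_wpM2r// divr_ge0// sqr_ge0.
  have z0 : 0 <= delta * (2 + 8 * lam) by apply: mulr_ge0 (ltW d0) _; lra.
  move: dB hc z0 h0; move: (delta * _) (Z) (c) (h) => y z c' h' dB hc z0 h0.
  apply: le_trans (_ : _ <= h' * ((16 * 96 * z + 6) * y)) _.
    by rewrite [leRHS]mulrA ler_wpM2r//; lra.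
  by have := ler_wpM2l (ltW h0) dB; lra.
Qed.

End StepSizeChoice.

(** * Number of rounds and epochs, and the resulting complexity *)

Lemma nat_ceil {R : realType} (x : R) : 0 <= x -> exists k : nat, x <= k%:R <= x + 1.
Proof.
move=> x0; exists (Num.truncn x).+1; have /andP[h1 h2] := truncn_itv x0.
by rewrite (ltW h2) -natr1 lerD2r.
Qed.

(** With [s = sqrt (1 - lam2^2)], [eta_w = 1 / (1 + s) <= 1 - s / 2 <= exp (- s / 2)], and [s] is at
    least [sqrt (1 - lam2)]; this is the accelerated dependence on the spectral gap. *)
Lemma mixing_rounds {R : realType} (lam2 delta : R) :
  0 <= lam2 -> lam2 < 1 -> 0 < delta -> delta <= 1 ->
  exists M : nat, 4 * eta_w lam2 ^+ M <= delta /\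
    M%:R <= (2 * ln (4 / delta) + 1) / Num.sqrt (1 - lam2).
Proof.
move=> l0 l1 d0 d1; pose s := Num.sqrt (1 - lam2 ^+ 2).
have l2 : lam2 ^+ 2 <= lam2 by rewrite expr2 ler_piMr// ltW.
have s0 : 0 < s by rewrite sqrtr_gt0; lra.
have s1 : s <= 1.
  by rewrite -[leRHS]sqrtr1 ler_wsqrtr// gerBl sqr_ge0.
have g0 : 0 < Num.sqrt (1 - lam2) by rewrite sqrtr_gt0 subr_gt0.
have g1 : Num.sqrt (1 - lam2) <= 1.
  by rewrite -[leRHS]sqrtr1 ler_wsqrtr// gerBl.
have gs : Num.sqrt (1 - lam2) <= s by rewrite ler_wsqrtr//; lra.
have y0 : 0 <= ln (4 / delta).
  by apply: ln_ge0; rewrite ler_pdivlMr//; lra.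
have x0 : 0 <= 2 / s * ln (4 / delta) by rewrite mulr_ge0// divr_ge0// ltW.
have [M /andP[Mge Mle]] := nat_ceil x0; exists M; split.
  have ew : eta_w lam2 <= expR (- s / 2).
    apply: le_trans (expR_ge1Dx _).
    have h : 0 < 1 + s by lra.
    rewrite /eta_w -/s -(ler_pM2r h) mulVf ?gt_eqF//.
    have : s * s <= s by rewrite ler_piMr// ltW.
    lra.
  have : eta_w lam2 ^+ M <= expR (- s / 2) ^+ M.
    by apply: lerXn2r; rewrite ?nnegrE ?expR_ge0 ?(ltW (eta_w_gt0 _)).
  rewrite -expRM_natl => h; have d4 : 0 < 4 / delta by rewrite divr_gt0.
  have : expR (M%:R * (- s / 2)) <= (4 / delta)^-1.
    rewrite -[(4 / delta)]lnK ?posrE// -expRN ler_expR.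
    have s2 : 0 < s / 2 by rewrite divr_gt0.
    have := ler_wpM2r (ltW s2) Mge.
    have -> : 2 / s * ln (4 / delta) * (s / 2) = ln (4 / delta) by field; rewrite gt_eqF.
    by clear; move: (M%:R) (ln _) => a y; lra.
  move: h; rewrite invf_div; clear; lra.
rewrite ler_pdivlMr//; apply: le_trans (ler_wpM2r (ltW g0) Mle) _.
rewrite mulrDl mul1r lerD//; apply: le_trans (ler_wpM2l x0 gs) _.
by rewrite mulrAC divfK// gt_eqF.
Qed.

(** [8 * logD / tau] epochs give [exp (- 2 logD)]: one factor [exp (- logD)] brings [D] down to
    [eps], the other pays for the constant [2], as [logD >= 1]. *)
Lemma epoch_count {R : realType} (tau eps D : R) : 0 < tau -> tau <= 1 ->
  0 < eps -> 0 <= D -> 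
  let logD := Num.max 1 (ln (D / eps)) in
  exists K : nat, (1 - tau / 4) ^+ K * (2 * D) <= eps /\ K%:R <= 9 * logD / tau.
Proof.
move=> tau0 tau1 eps0 D0 logD.
have l1 : 1 <= logD by rewrite le_max lexx.
have lD : ln (D / eps) <= logD by rewrite le_max lexx orbT.
clearbody logD.
have x0 : 0 <= 8 * logD / tau by rewrite divr_ge0 ?mulr_ge0//; lra.
have [K /andP[Kge Kle]] := nat_ceil x0; exists K; split; last first.
  have : 1 <= logD / tau by rewrite ler_pdivlMr// mul1r; exact: le_trans l1.
  by rewrite -[9 * logD / tau]mulrA; rewrite -[8 * logD / tau]mulrA in Kle; lra.
have De : D <= eps * expR logD.
  have [->|D1] := eqVneq D 0; first by rewrite mulr_ge0 ?expR_ge0// ltW.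
  have Dp : 0 < D / eps by rewrite divr_gt0// lt_neqAle eq_sym D1.
  by rewrite mulrC -ler_pdivrMr// -[leLHS]lnK ?posrE// ler_expR.
have e2 : 2 <= expR logD by have := expR_ge1Dx logD; lra.
have h : (1 - tau / 4) ^+ K <= expR (- (logD + logD)).
  apply: le_trans (_ : _ <= expR (- (tau / 4)) ^+ K) _.
    by apply: lerXn2r; rewrite ?nnegrE ?expR_ge0 ?expR_ge1Dx//; lra.
  rewrite -expRM_natl ler_expR.
  have t4 : 0 < tau / 4 by lra.
  have := ler_wpM2r (ltW t4) Kge.
  have -> : 8 * logD / tau * (tau / 4) = 2 * logD by field; rewrite gt_eqF.
  by move: (K%:R) => k; lra.
have e0 := expR_gt0 logD.
rewrite expRN expRD in h.
have D2 : 0 <= 2 * D by lra.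
apply: le_trans (ler_wpM2r D2 h) _.
rewrite mulrC ler_pdivrMr ?mulr_gt0//.
have := ler_wpM2l (ltW eps0) (ler_wpM2r (ltW e0) e2); lra.
Qed.

Lemma ln_mixing_acc {R : realType} (m n : nat) (L l1 l2 s : R) :
  (0 < m)%N -> (0 < n)%N -> 0 <= L -> 0 < l1 -> l1 <= l2 -> 0 < s ->
  1 <= log_factor m n L l1 l2 s /\
  ln (4 / mixing_acc L l2 s n%:R) <=
    (ln 4 + 13 * ln (14 * 14) + 13) * log_factor m n L l1 l2 s.
Proof.
move=> m0 n0 L0 l10 l12 s0.
have Ls : 1 <= 1 + L / s by rewrite lerDl divr_ge0// ltW.
have ls : 1 <= 1 + l2 / s by rewrite lerDl divr_ge0//; lra.
have l1s : 1 <= 1 + l1 / s by rewrite lerDl divr_ge0//; lra.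
have n1 : 1 <= n%:R :> R by rewrite ler1n.
have m1 : 1 <= m%:R :> R by rewrite ler1n.
have := ln_ge0 Ls; have := ln_ge0 ls; have := ln_ge0 l1s; have := ln_ge0 n1; have := ln_ge0 m1.
have c4 : 0 <= ln 4 :> R by apply: ln_ge0; lra.
have c196 : 0 <= ln (14 * 14) :> R by apply: ln_ge0; lra.
have pos (x : R) : 1 <= x -> 0 < x by exact: lt_le_trans.
have -> : ln (4 / mixing_acc L l2 s n%:R) =
    ln 4 + 13 * (ln (14 * 14) + (ln (1 + L / s) + ln (1 + l2 / s) + ln n%:R)).
  rewrite /mixing_acc /cond invrK; move: (pos _ Ls) (pos _ ls) (pos _ n1).
  move: (1 + L / s) (1 + l2 / s) (n%:R : R) => x y z x0 y0 z0.
  have xy0 : 0 < x * y by exact: mulr_gt0.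
  have xyz0 : 0 < x * y * z by exact: mulr_gt0.
  have X0 : 0 < 14 * 14 * (x * y * z) by exact: mulr_gt0.
  rewrite (@lnM _ 4 (_ ^+ _)) ?posrE ?exprn_gt0// lnXn//.
  rewrite (@lnM _ (14 * 14) (x * y * z)) ?posrE// (@lnM _ (x * y) z) ?posrE// (@lnM _ x y) ?posrE//.
  by rewrite -[_ *+ 13]mulr_natl.
rewrite /log_factor.
move: (ln (1 + L / s)) (ln (1 + l2 / s)) (ln (1 + l1 / s)) (ln n%:R) (ln m%:R) => a c e N M'.
move: (ln 4) (ln (14 * 14)) c4 c196 => u v u0 v0 M0 N0 e0 c0 a0; split; first by lra.
set f := 1 + _ + _ + _ + _ + _.
have f1 : 1 <= f by rewrite /f; lra.
have : u * 1 <= u * f by rewrite ler_wpM2l.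
have : v * 1 <= v * f by rewrite ler_wpM2l.
have : a + c + N <= f by rewrite /f; lra.
lra.
Qed.

Lemma powR_quarter {R : realType} (x : R) : 0 <= x -> x `^ (1 / 4) = Num.sqrt (Num.sqrt x).
Proof.
move=> x0; rewrite -[Num.sqrt x]powR12_sqrt// -powR12_sqrt ?powR_ge0// -powRrM.
by congr (_ `^ _); field.
Qed.

Lemma powR_three_quarters {R : realType} (x : R) : 0 <= x ->
  x `^ (3 / 4) = Num.sqrt (Num.sqrt x) ^+ 3.
Proof.
move=> x0; rewrite -powR_quarter// -powR_mulrn ?powR_ge0// -powRrM.
by congr (_ `^ _); field.
Qed.

Lemma kappa_bound {R : realType} (L r s : R) : 0 <= L -> 0 <= r -> 0 < s ->
  let kappa := (Num.sqrt L + Num.sqrt r) / Num.sqrt s in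
  0 <= kappa /\ L + r <= s * kappa ^+ 2.
Proof.
move=> L0 r0 s0 kappa; have ss : 0 < Num.sqrt s by rewrite sqrtr_gt0.
have a0 := sqrtr_ge0 L; have b0 := sqrtr_ge0 r.
split; first by rewrite divr_ge0 ?addr_ge0// ltW.
rewrite /kappa exprMn exprVn (sqr_sqrtr (ltW s0)) mulrCA mulfV ?gt_eqF// mulr1.
rewrite -{1}(sqr_sqrtr L0) -{1}(sqr_sqrtr r0) sqrrD.
by have := mulr_ge0 a0 b0; move: (Num.sqrt L) (Num.sqrt r) => a b; lra.
Qed.

(** For [A = L + sqrt (l1 l2)], [1 / tau^2 = 64 (1 + A / (s t))] and [A <= 2 s t (kappa / q)^2]. In
    the application [q] is the fourth root of [n]. *)
Lemma momentum_inv {R : realType} (L l1 l2 s t q kappa : R) :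
  0 <= L -> 0 < s -> 1 <= t -> 0 < q -> q ^+ 2 / 2 <= t -> 0 <= kappa ->
  L + Num.sqrt (l1 * l2) <= s * kappa ^+ 2 ->
  (momentum L l1 l2 s t)^-1 <= 8 + 16 * (kappa / q).
Proof.
move=> L0 s0 t1 q0 qt k0 Lk.
have e0 := step_size_gt0 l1 l2 L0 s0 t1.
have [tau0 _] := momentum_gt0_le1 l1 l2 L0 s0 t1.
have tauE := momentum_sqrE l1 l2 L0 s0 t1.
have kq : 0 <= kappa / q by rewrite divr_ge0// ltW.
have A0 : 0 <= 8 + 16 * (kappa / q) by rewrite addr_ge0// mulr_ge0.
rewrite -(ler_pM2l tau0) mulfV ?gt_eqF// -(@ler_pXn2r _ 2)// ?nnegrE ?mulr_ge0// ?(ltW tau0)//.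
rewrite expr1n exprMn -(@ler_pM2l _ 4)// [leRHS]mulrA tauE.
have st0 : 0 < s * t by rewrite mulr_gt0//; lra.
set A := L + Num.sqrt (l1 * l2) in Lk.
have eA : step_size L l1 l2 s t * (16 * (A + s * t)) = 1.
  have Ap : 0 <= A by exact: addr_ge0 L0 (sqrtr_ge0 _).
  have AS : 0 < 16 * (A + s * t) by move: Ap st0; move: (s * t) (A) => x y; lra.
  by rewrite /step_size mulVf// gt_eqF.
have h : A <= 2 * (s * t) * (kappa / q) ^+ 2.
  apply: le_trans Lk _; rewrite exprMn exprVn.
  have q2 : 0 < q ^+ 2 by rewrite exprn_gt0.
  have -> : s * kappa ^+ 2 = s * q ^+ 2 * (kappa ^+ 2 / q ^+ 2) by field; rewrite gt_eqF.
  apply: ler_wpM2r; first by rewrite divr_ge0 ?sqr_ge0.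
  by have := ler_wpM2l (ltW s0) qt; lra.
have stk : 0 <= s * t * (kappa / q) by rewrite mulr_ge0// ltW.
have -> : 4 * 1 = step_size L l1 l2 s t * (4 * (16 * (A + s * t))) by rewrite mulrCA eA.
rewrite -[leRHS]mulrA ler_pM2l//.
have stk2 : 0 <= s * t * (kappa / q) ^+ 2 by rewrite mulr_ge0 ?sqr_ge0// ltW.
move: h stk stk2; move: (A) (s * t) (kappa / q) => a u v h stk stk2; lra.
Qed.

(** [N] is the number of components per agent, [bt] batch size times mean epoch length, [v] is
    [kappa] and [ti] is [1 / tau]. *)
Lemma sfo_arith {R : realType} (K N bt q v logD ti : R) : 0 < q -> q ^+ 4 = N ->
  0 <= v -> 1 <= logD -> 0 <= K -> K <= 9 * logD * ti -> ti <= 8 + 16 * (v / q) ->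
  bt <= 3 * N -> N + K * (2 * N + 2 * bt) <= 32 * 36 * (N + v * q ^+ 3) * logD.
Proof.
move=> q0 qN v0 l1 K0 Kle tile btle.
have N0 : 0 <= N by rewrite -qN exprn_ge0// ltW.
have vq : v / q * N = v * q ^+ 3 by rewrite -qN; field; rewrite gt_eqF.
have vq0 : 0 <= v * q ^+ 3 by rewrite mulr_ge0// exprn_ge0// ltW.
have l0 : 0 <= 9 * logD by lra.
have l1' : 0 <= logD by lra.
have h1 : K <= 9 * logD * (8 + 16 * (v / q)) by apply: le_trans Kle _; rewrite ler_wpM2l.
have h2 : K * (2 * N + 2 * bt) <= K * (8 * N) by rewrite ler_wpM2l//; lra.
have h3 : K * (8 * N) <= 9 * logD * (8 + 16 * (v / q)) * (8 * N) by rewrite ler_wpM2r// mulr_ge0.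
have h4 : 9 * logD * (8 + 16 * (v / q)) * (8 * N) =
  9 * 8 * 8 * (logD * N) + 9 * 16 * 8 * (logD * (v / q * N)) by ring.
rewrite vq in h4.
have h5 : 1 * N <= logD * N by rewrite ler_wpM2r.
have h6 : 0 <= logD * (v * q ^+ 3) by rewrite mulr_ge0.
lra.
Qed.

Lemma comm_arith {R : realType} (K M t q v logD ti m : R) : 0 < q ->
  0 <= v -> 1 <= logD -> 0 <= K -> K <= 9 * logD * ti -> ti <= 8 + 16 * (v / q) ->
  1 <= t -> t <= 3 * q ^+ 2 -> 0 <= M -> M <= m ->
  K * (3 * M + 2 * M * t) <= 36 * 60 * (q ^+ 2 + v * q) * logD * m.
Proof.
move=> q0 v0 l1 K0 Kle tile t1 tq M0 Mm.
have l0 : 0 <= 9 * logD by lra.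
have l1' : 0 <= logD by lra.
have q2 : 0 <= q ^+ 2 by rewrite exprn_ge0// ltW.
have vq : v / q * q ^+ 2 = v * q by field; rewrite gt_eqF.
have vq0 : 0 <= v * q by rewrite mulr_ge0// ltW.
have h1 : K <= 9 * logD * (8 + 16 * (v / q)) by apply: le_trans Kle _; rewrite ler_wpM2l.
have h2 : 3 * M + 2 * M * t <= 15 * (M * q ^+ 2).
  have := ler_wpM2l M0 t1; have := ler_wpM2l M0 tq; lra.
have h3 : K * q ^+ 2 <= 144 * (q ^+ 2 + v * q) * logD.
  apply: le_trans (ler_wpM2r q2 h1) _.
  have -> : 9 * logD * (8 + 16 * (v / q)) * q ^+ 2 =
    72 * (logD * q ^+ 2) + 144 * (logD * (v / q * q ^+ 2)) by ring.
  by rewrite vq; have := mulr_ge0 l1' q2; lra.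
have h4 := ler_wpM2l K0 h2; apply: le_trans h4 _.
have h5 : 0 <= 144 * (q ^+ 2 + v * q) * logD.
  by apply: le_trans h3; exact: mulr_ge0.
have h6 := ler_wpM2r M0 h3; have h7 := ler_wpM2l h5 Mm; lra.
Qed.

(** Tested on two distinct points, which exist as [0 < d]. *)
Lemma lsmooth_ge0 {R : realType} {d : nat} (L : R) (g : 'rV[R]_d -> R) :
  (0 < d)%N -> lsmooth L g -> 0 <= L.
Proof.
case: d g => // d g _ /(_ (delta_mx 0 0) 0) h.
have e0 : 0 < enorm (delta_mx 0 0 - 0 : 'rV[R]_d.+1).
  rewrite subr0 sqrtr_gt0 big_ord1 (bigD1 ord0)//= mxE !eqxx expr1n.
  by rewrite ltr_pwDl// sumr_ge0// => j _; exact: sqr_ge0.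
rewrite -(ler_pM2r e0) mul0r; apply: le_trans h; exact: sqrtr_ge0.
Qed.

Theorem corollary5p3 (R : realType) :
  exists (C : R) (a : nat), 0 < C /\
  forall (m n d : nat), (0 < m)%N -> (0 < n)%N -> (0 < d)%N ->
  forall (f : 'I_m -> 'I_n -> 'rV[R]_d -> R) (psi : 'rV[R]_d -> \bar R)
         (L l1 l2 sigma_f sigma_psi : R) (xstar x0 : 'rV[R]_d),
  let F := objective f psi in
  let sigma := sigma_f + sigma_psi in
  (forall i j x, differentiable (f i j) x) ->
  lsmooth L (f_global f) ->
  0 <= sigma_f -> 0 <= sigma_psi -> 0 < sigma ->
  strongly_convex sigma_f (EFin \o f_global f) ->
  strongly_convex sigma_psi psi ->
  proper_function psi ->
  (forall (eta : R) x, 0 < eta -> exists z, is_argmin (prox_obj eta psi x) z) ->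
  0 < l1 -> l1 <= l2 ->
  (forall i j, l12smooth l1 l2 (f i j)) ->
  is_argmin F xstar ->
  psi x0 != +oo%E ->
  forall (edge : rel 'I_m) (W : 'M[R]_m) (lam2 : R),
  symmetric edge ->
  gossip_matrix edge W ->
  second_largest_eigenvalue W lam2 ->
  forall (b : nat) (eps : R),
  (0 < b)%N -> `|b%:R - Num.sqrt n%:R| < 1 :> R ->
  0 < eps ->
  let ybar0 := mean (out_y (initial_state f x0)) in
  let logD := Num.max 1 (ln (fine (F ybar0 - F xstar)%E / eps)) in
  let kappa := (L `^ 2^-1 + (l1 * l2) `^ 4^-1) / Num.sqrt sigma in
  exists (eta tau : R) (M K : nat),
    [/\ 0 < eta, 0 < tau, tau <= 1 &
    forall (dO : measure_display) (Omega : measurableType dO)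
           (P : probability Omega R) (T : nat -> Omega -> nat)
           (B : nat -> nat -> 'I_m -> 'I_b -> Omega -> 'I_n),
    sampling P T B ->
    let out w := pmgt_katyushaX f psi W lam2 x0 eta tau M
                   (fun k => T k w) (fun k t i l => B k t i l w) K in
    [/\ (\int[P]_w F (mean (out_y (out w))) - F xstar <= eps%:E)%E,
        ('E_P[fun w => (out_sfo (out w))%:R] <=
           (C * (n%:R + kappa * n%:R `^ (3 / 4)) * logD)%:E)%E
      & ('E_P[fun w => (out_comm (out w))%:R] <=
           (C * ((Num.sqrt n%:R + kappa * n%:R `^ (1 / 4))
                 / Num.sqrt (1 - lam2))
              * logD * log_factor m n L l1 l2 sigma ^+ a)%:E)%E]].
Proof.
pose c : R := ln 4 + 13 * ln (14 * 14) + 13.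
have c0 : 0 <= c.
  have h4 : 0 <= ln 4 :> R by apply: ln_ge0; lra.
  have h196 : 0 <= ln (14 * 14) :> R by apply: ln_ge0; lra.
  by rewrite /c; lra.
(* [36 * 60] comes from [comm_arith] and exceeds the [32 * 36] of [sfo_arith]. [2 * c + 1] comes
   from the number of mixing rounds, which is linear in [log_factor]; hence the exponent [1]. *)
exists (36 * 60 * (2 * c + 1)), 1%N; split; first by rewrite !mulr_gt0//; lra.
move=> m n d m0 n0 d0 f psi L l1 l2 sf sp xs x0 F s fdiff fL sf0 sp0 s0 fcvx pcvx
  pproper pprox l10 l12 fl12 xsmin x0dom edge W lam2 _ gW lam2P b eps b0 bn eps0 ybar0 logD kappa.
have L0 : 0 <= L := lsmooth_ge0 d0 fL.
have dx0 : psi x0 \is a fin_num by rewrite (domE pproper).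
have Fx0 : F x0 = (objr f psi x0)%:E by rewrite /F /objective -(fineK dx0) -EFinD.
have dxs : psi xs \is a fin_num.
  rewrite (domE pproper); apply/eqP => e; have := xsmin x0.
  by rewrite -/F Fx0 /F /objective e addey// leye_eq.
have xs_min x : psi x \is a fin_num -> objr f psi xs <= objr f psi x.
  move=> dx; have := xsmin x.
  by rewrite /F /objective -(fineK dx) -(fineK dxs) -!EFinD lee_fin.
pose D := objr f psi x0 - objr f psi xs.
have D0 : 0 <= D by rewrite subr_ge0 xs_min.
have logDE : logD = Num.max 1 (ln (D / eps)).
  rewrite /logD /F (_ : ybar0 = x0) ?objective_gap// /ybar0.
  by rewrite (_ : out_y _ = bcast x0)// mean_bcast.
have [lam0 lam1 _] := lam2_spec m0 gW lam2P.
pose t : R := (ceil_div n b)%:R.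
have t1 : 1 <= t by rewrite ler1n ceil_div_gt0.
have [_ _ tn] := ceil_div_bounds n0 b0.
have tN : t <= n%:R by rewrite ler_nat.
have [rt1 rt2 t5 bt /andP[trt t3]] := batch_size_bounds n0 b0 bn.
pose eta := step_size L l1 l2 s t; pose tau := momentum L l1 l2 s t.
have eta0 : 0 < eta := step_size_gt0 l1 l2 L0 s0 t1.
have [tau0 tau1] := momentum_gt0_le1 l1 l2 L0 s0 t1.
have [gam0 gam1 dsmall R1 [del0 R3 R3' R4]] := parameter_facts L0 l10 l12 s0 t1 tN t5.
have [lf1 lnle] := ln_mixing_acc m0 n0 L0 l10 l12 s0.
have del1 : mixing_acc L l2 s n%:R <= 1 by move: R3' del0; clear; lra.
have [M [Mdel Mle]] := mixing_rounds lam0 lam1 del0 del1.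
have [K [Kgap Kle]] := epoch_count tau0 tau1 eps0 D0.
rewrite -logDE in Kle.
have H : setting f psi W lam2 b eta M L l1 l2 sf sp (mixing_acc L l2 s n%:R)
    (consensus_rate L l1 l2 s t).
  split=> //.
  - by move=> A; rewrite (mean_fastmix _ gW).
  - move=> A; apply: le_trans (fastmix_contract m0 gW lam2P A M) _.
    by rewrite ler_wpM2r ?nvar_ge0.
  - have [h1 _ h2] := step_size_le l1 l2 L0 s0 t1.
    have : eta * sf <= eta * (s * t).
      rewrite ler_pM2l//; apply: le_trans (_ : _ <= s) _; first by rewrite lerDl.
      by rewrite ler_peMr// ltW.
    rewrite -!mulrA => h; move: h1 h2 h; rewrite -/eta.
    by clear; move: (eta * L) (eta * (s * t)) (eta * sf) => x y z; lra.
  - exact: ltW.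
exists eta, tau, M, K; split=> // dO Omega P T B samp out.
have l1D : 1 <= logD by rewrite /logD le_max lexx.
pose q : R := Num.sqrt (Num.sqrt n%:R).
have q0 : 0 < q by rewrite sqrtr_gt0; apply: lt_le_trans rt1.
have q2 : q ^+ 2 = Num.sqrt n%:R by rewrite sqr_sqrtr ?sqrtr_ge0.
have q4 : q ^+ 4 = n%:R by rewrite -rt2 -q2 -exprM.
have l120 : 0 <= l1 * l2 by rewrite mulr_ge0 ?(ltW l10)//; apply: le_trans l12; exact: ltW.
have kE : kappa = (Num.sqrt L + Num.sqrt (Num.sqrt (l1 * l2))) / Num.sqrt s.
  by rewrite /kappa powR12_sqrt// -(div1r 4) powR_quarter.
have [k0 kL] := kappa_bound L0 (sqrtr_ge0 (l1 * l2)) s0; rewrite -kE in k0 kL.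
have tau_inv : tau^-1 <= 8 + 16 * (kappa / q).
  by apply: momentum_inv => //; rewrite q2.
have K0 : 0 <= K%:R :> R by [].
have tauE : tau ^+ 2 * (t^-1 / eta) = s / 4 := momentum_sqr l1 l2 L0 s0 t1.
split.
- apply: le_trans (expect_objective H samp dx0 dxs xs_min tau0 tau1 tauE R1 R3 R3' R4 K) _.
  by rewrite lee_fin.
- rewrite unlock; apply: le_trans (expect_sfo H tau samp dx0 K) _.
  rewrite lee_fin powR_three_quarters// -/q -mulrA.
  apply: le_trans (sfo_arith q0 q4 k0 l1D K0 Kle tau_inv bt) _.
  apply: ler_wpM2r; first exact: le_trans ler01 l1D.
  apply: ler_wpM2r; last by move: c0; move: (c); clear => y; lra.
  by rewrite addr_ge0// mulr_ge0// exprn_ge0// ltW.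
- rewrite unlock; apply: le_trans (expect_comm H tau samp dx0 K) _.
  rewrite lee_fin powR_quarter// -/q expr1.
  have g0 : 0 < Num.sqrt (1 - lam2) by rewrite sqrtr_gt0 subr_gt0.
  have Mm : M%:R <= (2 * c + 1) * log_factor m n L l1 l2 s / Num.sqrt (1 - lam2).
    apply: le_trans Mle _; rewrite ler_pM2r ?invr_gt0//.
    move: lnle lf1; rewrite -/c; move: (log_factor _ _ _ _ _ _) (ln _) (c).
    by clear => x y z; lra.
  rewrite -q2 in t3 *.
  apply: le_trans (comm_arith q0 k0 l1D K0 Kle tau_inv t1 t3 _ Mm) _ => //.
  rewrite le_eqVlt; apply/orP; left; apply/eqP.
  by move: (log_factor _ _ _ _ _ _) (Num.sqrt _) (q ^+ 2) => x y z; ring.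
Qed.
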